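(* Let $\alpha>-1$, let $\phi_1,\phi_2$ be analytic self-maps of $\mathbb{D}$ and $\psi_1,\psi_2$ analytic on $\mathbb{D}$ such that $C_{\psi_1,\phi_1}$ and $C_{\psi_2,\phi_2}$ are bounded on $L^2_a(dA_\alpha)$. (i) If $\phi_1$ and $\phi_2$ are both the identity map of $\mathbb{D}$ and $\psi_1,\psi_2$ have a common zero in $\mathbb{D}$, then $0\in W(C_{\psi_1,\phi_1}+C_{\psi_2,\phi_2})$. (ii) If neither $\phi_1$ nor $\phi_2$ is the identity map of $\mathbb{D}$ and $\psi_1,\psi_2\in H^\infty$, then $0\in\overline{W(C_{\psi_1,\phi_1}+C_{\psi_2,\phi_2})}$.
   Context: $\mathbb{D}$ is the open unit disc, $H^\infty$ the bounded analytic functions on $\mathbb{D}$. $L^2_a(dA_\alpha)$ is the weighted Bergman space of analytic $f$ on $\mathbb{D}$ with $\int_{\mathbb{D}}|f|^2dA_\alpha<\infty$, $dA_{\alpha}(z)=(\alpha+1)(1-|z|^2)^{\alpha}dA(z)$, $dA$ normalized area measure. $C_{\psi,\phi}f=\psi\cdot(f\circ\phi)$. $W(T)=\{\langle Tf,f\rangle:\|f\|=1\}$ and $\overline{X}$ is the closure. *)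

(* Defs.v *)
(* Complex numbers are  R[i] := complex R  (real-closed
   library) over an arbitrary  R : realType.  Area measure on the plane is the
   product Lebesgue measure on R * R, identified with C via (x,y) |-> x + i y. *)
From HB Require Import structures.
From mathcomp Require Import all_boot all_order all_algebra.
From mathcomp Require Import all_classical all_reals all_analysis.
From mathcomp Require Import complex.
Set Implicit Arguments. Unset Strict Implicit. Unset Printing Implicit Defensive.
Import Order.TTheory GRing.Theory Num.Theory.
Local Open Scope ring_scope.
Local Open Scope classical_set_scope.

Section BergmanDefs.
Variable R : realType.

(* planar Lebesgue measure *)
Definition leb2 := (@lebesgue_measure R \x @lebesgue_measure R)%E.

(* identification R*R ~ C *)
Definition toC (p : R * R) : R[i] := (p.1 +i* p.2)%C.

(* the open unit disc, as a subset of R*R and of C *)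
Definition Dset : set (R * R) := [set p | p.1 ^+ 2 + p.2 ^+ 2 < 1].
Definition inD (z : R[i]) : Prop := `|z| < 1.

(* density of dA_alpha w.r.t. planar Lebesgue measure:
   (alpha+1)(1-|z|^2)^alpha / pi  (dA = dx dy / pi is normalized area measure) *)
Definition wgt (alpha : R) (p : R * R) : R :=
  (alpha + 1) * ((1 - (p.1 ^+ 2 + p.2 ^+ 2)) `^ alpha) / pi.

(* f is analytic (holomorphic) on D: complex differentiable at every point *)
Definition analytic_on_D (f : R[i] -> R[i]) : Prop :=
  forall z : R[i], inD z -> derivable (f : R[i]^o -> R[i]^o) z 1.

(* squared norm in L^2(dA_alpha): \int_D |f|^2 dA_alpha (extended real) *)
Definition normA2 (alpha : R) (f : R[i] -> R[i]) : \bar R :=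
  (\int[leb2]_(p in Dset) ((wgt alpha p) * complex.Re (`|f (toC p)| ^+ 2))%:E)%E.

(* membership in the weighted Bergman space L^2_a(dA_alpha) *)
Definition inA2 (alpha : R) (f : R[i] -> R[i]) : Prop :=
  analytic_on_D f /\ (normA2 alpha f < +oo)%E.

(* inner product <f,g> = \int_D f conj(g) dA_alpha, via real and imaginary parts *)
Definition ipA2 (alpha : R) (f g : R[i] -> R[i]) : R[i] :=
  ((Rintegral leb2 Dset (fun p => wgt alpha p * complex.Re (f (toC p) * (g (toC p))^*)))
   +i* (Rintegral leb2 Dset (fun p => wgt alpha p * complex.Im (f (toC p) * (g (toC p))^*))))%C.

(* weighted composition operator C_{psi,phi} f = psi * (f o phi) *)
Definition wcomp (psi phi : R[i] -> R[i]) (f : R[i] -> R[i]) : R[i] -> R[i] :=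
  fun z => psi z * f (phi z).

(* T is a bounded operator on L^2_a(dA_alpha) *)
Definition bounded_on_A2 (alpha : R) (T : (R[i] -> R[i]) -> (R[i] -> R[i])) : Prop :=
  (forall f, inA2 alpha f -> inA2 alpha (T f)) /\
  exists M : R, forall f, inA2 alpha f -> (normA2 alpha (T f) <= M%:E * normA2 alpha f)%E.

(* analytic self-map of D *)
Definition selfmap_D (phi : R[i] -> R[i]) : Prop :=
  analytic_on_D phi /\ forall z, inD z -> inD (phi z).

(* phi is the identity map of D *)
Definition is_id_D (phi : R[i] -> R[i]) : Prop := forall z, inD z -> phi z = z.

(* H^infty: bounded analytic functions on D *)
Definition Hinf (psi : R[i] -> R[i]) : Prop :=
  analytic_on_D psi /\ exists M : R, forall z, inD z -> `|psi z| <= (M%:C)%C.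

(* numerical range W(T) = { <Tf,f> : f in L^2_a(dA_alpha), ||f|| = 1 } *)
Definition numrange (alpha : R) (T : (R[i] -> R[i]) -> (R[i] -> R[i])) : set R[i] :=
  [set w | exists f, inA2 alpha f /\ normA2 alpha f = 1%E /\ w = ipA2 alpha (T f) f].

(* sum of operators *)
Definition opadd (S T : (R[i] -> R[i]) -> (R[i] -> R[i])) :=
  fun f => (fun z => S f z + T f z).

End BergmanDefs.

(* Main.v *)
(** The function k_w(z) = sum_n (conj w z)^n / m_n, where m_n is the integral of
    |z|^2n dA_alpha, reproduces the values at w of the functions of the Bergman
    space, so that the number <(C_1 + C_2) k_w, k_w> / |k_w|^2 of the numerical
    range is sum_i psi_i(w) K(conj w phi_i(w)) / K(|w|^2) with
    K(x) = sum_n x^n / m_n.  It vanishes at a common zero w of psi_1 and psi_2.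

    For (ii), the coefficients 1 / m_n are nondecreasing, whence
    |1 - x| |K(x)| <= (1 - r) K(r) for |x| <= r, and
    1 / m_(2n+1) <= k / m_n, whence K(r) <= 2 k K(r^2).  So it is enough to find w with
    (1 - |w|) / |1 - conj w phi_i(w)| small for both i.  If there were none, then
    z (z - phi_1(z)) (z - phi_2(z)) would tend to 0 at the unit circle, hence
    would be identically 0, and one of the phi_i would be the identity. *)
Require Import Defs.
From HB Require Import structures.
From mathcomp Require Import all_boot all_order all_algebra.
From mathcomp Require Import all_classical all_reals all_analysis.
From mathcomp Require Import measurable_realfun complex ring lra.
Import Order.TTheory GRing.Theory Num.Theory.
Import numFieldNormedType.Exports.
Local Open Scope ring_scope.
Local Open Scope classical_set_scope.
Set Implicit Arguments. Unset Strict Implicit. Unset Printing Implicit Defensive.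

Local Notation Re := complex.Re.
Local Notation Im := complex.Im.

(** * Modulus and topology of R[i] *)

Section ComplexModulus.
Variable R : realType.
Implicit Types (x y z : R[i]).

Definition cabs z : R := Normc.normc z.

Lemma normcE z : `|z| = ((cabs z)%:C)%C.
Proof. by case: z => a b; rewrite normc_def. Qed.

Lemma cabs_ge0 z : 0 <= cabs z.
Proof. by rewrite -ler0c -normcE. Qed.

Lemma cabs0 : cabs 0 = 0. Proof. exact: Normc.normc0. Qed.

Lemma cabs1 : cabs 1 = 1. Proof. exact: Normc.normc1. Qed.

Lemma cabsM x y : cabs (x * y) = cabs x * cabs y.
Proof. exact: Normc.normcM. Qed.

Lemma cabsV x : cabs x^-1 = (cabs x)^-1.
Proof. exact: Normc.normcV. Qed.

Lemma cabsN x : cabs (- x) = cabs x.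
Proof. exact: normcN. Qed.

Lemma cabs_distC x y : cabs (x - y) = cabs (y - x).
Proof. by rewrite -cabsN opprB. Qed.

Lemma cabsD x y : cabs (x + y) <= cabs x + cabs y.
Proof. exact: le_normcD. Qed.

Lemma cabsB x y : cabs (x - y) <= cabs x + cabs y.
Proof. by rewrite (le_trans (cabsD _ _))// cabsN. Qed.

Lemma cabs_eq0 x : cabs x = 0 -> x = 0.
Proof. exact: Normc.eq0_normc. Qed.

Lemma cabs_gt0 x : x != 0 -> 0 < cabs x.
Proof.
move=> x0; rewrite lt_neqAle cabs_ge0 andbT eq_sym.
by apply: contra x0 => /eqP/cabs_eq0/eqP.
Qed.

Lemma cabsX x n : cabs (x ^+ n) = cabs x ^+ n.
Proof. by elim: n => [|n IH]; rewrite ?expr0 ?cabs1// !exprS cabsM IH. Qed.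

Lemma cabs_dist x y : cabs x - cabs y <= cabs (x - y).
Proof. by rewrite lerBlDr -{1}(subrK y x) cabsD. Qed.

Lemma cabs_sum (I : Type) (r : seq I) (P : pred I) (F : I -> R[i]) :
  cabs (\sum_(i <- r | P i) F i) <= \sum_(i <- r | P i) cabs (F i).
Proof.
elim/big_ind2: _ => [|a b c d ab cd|i _]; first by rewrite cabs0.
  by rewrite (le_trans (cabsD _ _)) ?lerD.
exact: lexx.
Qed.

Lemma cabs_real (a : R) : cabs (a%:C)%C = `|a|.
Proof. by rewrite /cabs/= expr0n/= addr0 sqrtr_sqr. Qed.

Lemma sqr_cabs z : cabs z ^+ 2 = Re z ^+ 2 + Im z ^+ 2.
Proof. by case: z => a b; rewrite /cabs/= sqr_sqrtr// addr_ge0 ?sqr_ge0. Qed.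

Lemma cabs_conj z : cabs (z^*)%C = cabs z.
Proof. by case: z => a b; rewrite /cabs/= sqrrN. Qed.

Lemma Re_le_cabs z : `|Re z| <= cabs z.
Proof.
rewrite -(@ler_pXn2r _ 2) ?nnegrE ?cabs_ge0//.
by rewrite sqr_cabs real_normK ?num_real// lerDl sqr_ge0.
Qed.

Lemma Im_le_cabs z : `|Im z| <= cabs z.
Proof.
rewrite -(@ler_pXn2r _ 2) ?nnegrE ?cabs_ge0//.
by rewrite sqr_cabs real_normK ?num_real// lerDr sqr_ge0.
Qed.

Lemma cabs_le_ReIm z : cabs z <= `|Re z| + `|Im z|.
Proof.
rewrite -ler_sqr ?nnegrE ?cabs_ge0 ?addr_ge0// sqr_cabs sqrrD !real_normK ?num_real//.
by rewrite -addrA lerD2l lerDr mulrn_wge0// mulr_ge0.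
Qed.

Lemma ReD x y : Re (x + y) = Re x + Re y. Proof. by case: x y => [? ?] []. Qed.
Lemma ImD x y : Im (x + y) = Im x + Im y. Proof. by case: x y => [? ?] []. Qed.
Lemma ReN x : Re (- x) = - Re x. Proof. by case: x. Qed.
Lemma ImN x : Im (- x) = - Im x. Proof. by case: x. Qed.
Lemma ReM x y : Re (x * y) = Re x * Re y - Im x * Im y.
Proof. by case: x y => [? ?] []. Qed.
Lemma ImM x y : Im (x * y) = Re x * Im y + Im x * Re y.
Proof. by case: x y => [? ?] []. Qed.

Lemma complexP x y : Re x = Re y -> Im x = Im y -> x = y.
Proof. by case: x y => [? ?] [? ?] /= -> ->. Qed.

Lemma inDE z : inD z <-> cabs z < 1.
Proof. by rewrite /inD normcE ltcR. Qed.

Lemma cabs_small_eq0 z : (forall e : R, 0 < e -> cabs z <= e) -> z = 0.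
Proof.
move=> h; apply: cabs_eq0; apply/eqP; rewrite eq_le cabs_ge0 andbT.
by apply/ler_addgt0Pr => e e0; rewrite add0r h.
Qed.

End ComplexModulus.

Section ComplexTopology.
Variable R : realType.
Local Notation C := (R[i]^o).

Lemma cvg_cabsP {T : Type} (F : set_system T) {FF : Filter F} (f : T -> C) (l : C) :
  f @ F --> l <-> forall e : R, 0 < e -> \forall x \near F, cabs (l - f x) < e.
Proof.
split.
  move=> /cvgrPdist_lt h e e0.
  have e0' : 0 < (e%:C)%C :> R[i] by rewrite ltcR.
  near=> x; rewrite -ltcR -normcE; near: x; exact: (h _ e0').
move=> h; apply/cvgrPdist_lt => -[e e']; rewrite ltcE/= => /andP[/eqP-> e0].
by near=> x; rewrite normcE ltcR; near: x; exact: h.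
Unshelve. all: by end_near. Qed.

Lemma cont_Re : continuous (fun z : C => Re z : R).
Proof.
move=> z; apply/(@cvgrPdist_lt _ _ _ _ (nbhs_filter z)) => e e0.
have h := (@cvg_cabsP C (nbhs z) (nbhs_filter z) (fun x => x) z).1 cvg_id _ e0.
near=> x; rewrite -ReN -ReD (le_lt_trans (Re_le_cabs _))//; near: x.
exact: h.
Unshelve. all: by end_near. Qed.

Lemma cont_Im : continuous (fun z : C => Im z : R).
Proof.
move=> z; apply/(@cvgrPdist_lt _ _ _ _ (nbhs_filter z)) => e e0.
have h := (@cvg_cabsP C (nbhs z) (nbhs_filter z) (fun x => x) z).1 cvg_id _ e0.
near=> x; rewrite -ImN -ImD (le_lt_trans (Im_le_cabs _))//; near: x.
exact: h.
Unshelve. all: by end_near. Qed.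

Lemma cont_cabs : continuous (fun z : C => cabs z : R).
Proof.
move=> z; apply/(@cvgrPdist_lt _ _ _ _ (nbhs_filter z)) => e e0.
have h := (@cvg_cabsP C (nbhs z) (nbhs_filter z) (fun x => x) z).1 cvg_id _ e0.
near=> x; rewrite (@le_lt_trans _ _ (cabs (z - x)))//; last by near: x; exact: h.
by rewrite ler_norml cabs_dist andbT lerNl opprB cabs_distC cabs_dist.
Unshelve. all: by end_near. Qed.

Lemma cvg_complex {T : Type} (F : set_system T) {FF : Filter F} (f g : T -> R) (a b : R) :
  f @ F --> a -> g @ F --> b ->
  (fun x => (f x +i* g x)%C : C) @ F --> ((a +i* b)%C : C).
Proof.
move=> /cvgrPdist_lt fa /cvgrPdist_lt gb; apply/cvg_cabsP => e e0.
have e2 : 0 < e / 2 by rewrite divr_gt0.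
near=> x; rewrite (le_lt_trans (cabs_le_ReIm _))//=.
rewrite [ltRHS]splitr ltrD//; near: x; [exact: fa|exact: gb].
Unshelve. all: by end_near. Qed.

Lemma nbhs_cabsP (z : C) (P : set C) :
  (\forall y \near z, P y) <->
  exists2 d : R, 0 < d & forall y, cabs (y - z) < d -> P y.
Proof.
split.
  move=> /nbhs_ballP[[d d'] /=]; rewrite ltcE/= => /andP[/eqP-> d0] h.
  exists d => // y yz; apply: h; rewrite /ball/=.
  by rewrite distrC normcE ltcR.
move=> [d d0 h]; apply/nbhs_ballP; exists (d%:C)%C => /=; first by rewrite ltcR.
by move=> y; rewrite /ball/= distrC normcE ltcR => /h.
Qed.

Definition cdiff (f : R[i] -> R[i]) (z l : R[i]) :=
  forall e : R, 0 < e -> exists2 d : R, 0 < d &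
    forall h, cabs h < d -> cabs (f (z + h) - f z - l * h) <= e * cabs h.

Lemma derivable_cdiffP (f : R[i] -> R[i]) (z : R[i]) :
  derivable (f : C -> C) z 1 <-> exists l, cdiff f z l.
Proof.
split.
  move=> df; exists ('D_1 (f : C -> C) z) => e e0.
  have /cvg_cabsP/(_ _ e0) := df.
  rewrite near_withinE => /nbhs_cabsP[d d0 hd]; exists d => // h hd'.
  have [->|h0] := eqVneq h 0; first by rewrite mulr0 addr0 !subrr cabs0 mulr0.
  have := hd h; rewrite subr0 => /(_ hd' h0).
  rewrite -(@ltr_pM2r _ (cabs h)) ?cabs_gt0// -cabsM => /ltW; apply: le_trans.
  rewrite -cabsN opprB mulrBl -[_ *: _]/(_ * _) mulrAC mulVf// mul1r.
  by rewrite -[h *: 1]/(h * 1) mulr1 (addrC z h).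
move=> [l hl]; apply/cvg_ex; exists l; apply/cvg_cabsP => e e0.
have e2 : 0 < e / 2 by rewrite divr_gt0.
have [d d0 hd] := hl _ e2.
rewrite near_withinE; apply/nbhs_cabsP; exists d => // h; rewrite subr0 => hhd h0.
have h1 : 0 < cabs h by rewrite cabs_gt0.
rewrite -(@ltr_pM2r _ (cabs h))// -cabsM mulrBl -[_ *: _]/(_ * _) mulrAC mulVf// mul1r.
rewrite -cabsN opprB /= -[h *: 1]/(h * 1) mulr1 (addrC h z).
rewrite (le_lt_trans (hd _ hhd))// ltr_pM2r// ltr_pdivrMr// ltr_pMr//.
by rewrite ltr1n.
Qed.

Lemma analytic_cdiff (f : R[i] -> R[i]) :
  analytic_on_D f <-> forall z, cabs z < 1 -> exists l, cdiff f z l.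
Proof.
split=> h z; first by move=> /inDE/h /derivable_cdiffP.
by move=> /inDE/h /derivable_cdiffP.
Qed.

Lemma cdiff_continuous (f : R[i] -> R[i]) z l : cdiff f z l ->
  {for z, continuous (f : C -> C)}.
Proof.
move=> fl; suff h : (f : C -> C) @ (z : C) --> (f z : C) by exact: h.
apply: (@cvg_cabsP C (nbhs (z : C)) (nbhs_filter (z : C)) f (f z)).2 => e e0.
have [d d0 hd] := fl _ ltr01.
apply/nbhs_cabsP.
have l0 := cabs_ge0 l.
have p0 : 0 < 1 + cabs l by lra.
exists (Num.min d (e / (1 + cabs l))).
  by rewrite lt_min d0 divr_gt0.
move=> y; rewrite lt_min => /andP[yd ye].
rewrite cabs_distC.
have := hd _ yd; rewrite (addrC z) subrK mul1r => h1.
have -> : f y - f z = (f y - f z - l * (y - z)) + l * (y - z) by ring.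
rewrite (le_lt_trans (cabsD _ _))// cabsM.
move: ye; rewrite ltr_pdivlMr//.
by apply: le_lt_trans; rewrite [leRHS]mulrDr mulr1 lerD// mulrC.
Qed.

Lemma analytic_continuous (f : R[i] -> R[i]) z : analytic_on_D f -> cabs z < 1 ->
  {for z, continuous (f : C -> C)}.
Proof. by move=> /analytic_cdiff h /h[l /cdiff_continuous]. Qed.

End ComplexTopology.

(** * Cauchy integrals and Taylor expansion on the disc *)

Section Bisection.
Variable R : realType.
Implicit Types a b c d : R.

Let rect := (R * R * (R * R))%type.

Lemma bisection_eq0 (Q : R -> R -> R -> R -> R[i]) a0 b0 c0 d0 :
  a0 <= b0 -> c0 <= d0 ->
  (forall a m b c d, a0 <= a -> a <= m -> m <= b -> b <= b0 ->
     c0 <= c -> c <= d -> d <= d0 -> Q a b c d = Q a m c d + Q m b c d) ->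
  (forall a b c m d, a0 <= a -> a <= b -> b <= b0 ->
     c0 <= c -> c <= m -> m <= d -> d <= d0 -> Q a b c d = Q a b c m + Q a b m d) ->
  (forall t s, a0 <= t <= b0 -> c0 <= s <= d0 -> forall e, 0 < e ->
     exists2 dl, 0 < dl & forall a b c d, a0 <= a -> a <= t -> t <= b -> b <= b0 ->
       c0 <= c -> c <= s -> s <= d -> d <= d0 -> b - a < dl -> d - c < dl ->
       cabs (Q a b c d) <= e * (b - a + (d - c)) ^+ 2) ->
  Q a0 b0 c0 d0 = 0.
Proof.
move=> ab0 cd0 addt adds loc.
pose q (r : rect) := Q r.1.1 r.1.2 r.2.1 r.2.2.
pose mt (r : rect) := (r.1.1 + r.1.2) / 2.
pose ms (r : rect) := (r.2.1 + r.2.2) / 2.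
pose r1 r : rect := ((r.1.1, mt r), (r.2.1, ms r)).
pose r2 r : rect := ((r.1.1, mt r), (ms r, r.2.2)).
pose r3 r : rect := ((mt r, r.1.2), (r.2.1, ms r)).
pose r4 r : rect := ((mt r, r.1.2), (ms r, r.2.2)).
pose big r r' := cabs (q r) <= 4 * cabs (q r').
pose step r := if big r (r1 r) then r1 r else if big r (r2 r) then r2 r else
  if big r (r3 r) then r3 r else r4 r.
pose ok (r : rect) := [/\ a0 <= r.1.1, r.1.1 <= r.1.2, r.1.2 <= b0 &
  [/\ c0 <= r.2.1, r.2.1 <= r.2.2 & r.2.2 <= d0]].
have stepE r : [\/ step r = r1 r, step r = r2 r, step r = r3 r | step r = r4 r].
  rewrite /step; case: ifP => _; first by constructor 1.
  case: ifP => _; first by constructor 2.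
  by case: ifP => _; [constructor 3|constructor 4].
have stepP r : ok r -> [/\ ok (step r),
    r.1.1 <= (step r).1.1, (step r).1.2 <= r.1.2 &
    [/\ r.2.1 <= (step r).2.1, (step r).2.2 <= r.2.2,
    (step r).1.2 - (step r).1.1 = (r.1.2 - r.1.1) / 2 &
    (step r).2.2 - (step r).2.1 = (r.2.2 - r.2.1) / 2]].
  have mid (x y : R) : x <= y -> [/\ x <= (x + y) / 2, (x + y) / 2 <= y,
      (x + y) / 2 - x = (y - x) / 2 & y - (x + y) / 2 = (y - x) / 2].
    by clear; move=> xy; split; lra.
  move=> [h1 h2 h3 [h4 h5 h6]].
  have [m1 m2 m3 m4] := mid _ _ h2; have [n1 n2 n3 n4] := mid _ _ h5.
  have k1 := le_trans h1 m1; have k2 := le_trans m2 h3.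
  have k3 := le_trans h4 n1; have k4 := le_trans n2 h6.
  by have [] := stepE r => ->.
have stepQ r : ok r -> big r (step r).
  move=> [h1 h2 h3 [h4 h5 h6]].
  rewrite /step; case: ifPn => // n1; case: ifPn => // n2; case: ifPn => // n3.
  have hq : q r = q (r1 r) + q (r2 r) + (q (r3 r) + q (r4 r)).
    have m1 : r.1.1 <= mt r by rewrite /mt; lra.
    have m2 : mt r <= r.1.2 by rewrite /mt; lra.
    have m3 : r.2.1 <= ms r by rewrite /ms; lra.
    have m4 : ms r <= r.2.2 by rewrite /ms; lra.
    rewrite /q (addt _ _ _ _ _ h1 m1 m2 h3 h4 h5 h6).
    rewrite (adds _ _ _ _ _ h1 m1 (le_trans m2 h3) h4 m3 m4 h6).
    by rewrite (adds _ _ _ _ _ (le_trans h1 m1) m2 h3 h4 m3 m4 h6).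
  have := cabsD (q (r1 r) + q (r2 r)) (q (r3 r) + q (r4 r)).
  have := cabsD (q (r1 r)) (q (r2 r)).
  have := cabsD (q (r3 r)) (q (r4 r)).
  move: n1 n2 n3; rewrite /big -!ltNge -hq; lra.
pose u n := iter n step ((a0, b0), (c0, d0)).
have uS n : u n.+1 = step (u n) by [].
have uok n : ok (u n).
  by elim: n => [|n IH]; [rewrite /ok/=; do !split|rewrite uS; case: (stepP _ IH)].
have hw n : (u n).1.2 - (u n).1.1 = (b0 - a0) / 2 ^+ n /\
            (u n).2.2 - (u n).2.1 = (d0 - c0) / 2 ^+ n.
  elim: n => [|n [IH1 IH2]]; first by rewrite expr0 !divr1.
  have [_ _ _ [_ _]] := stepP _ (uok n); rewrite -uS => -> ->.
  by rewrite IH1 IH2 exprSr !invfM !mulrA.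
have hQ n : cabs (Q a0 b0 c0 d0) <= 4 ^+ n * cabs (q (u n)).
  elim: n => [|n IH]; first by rewrite expr0 mul1r.
  rewrite (le_trans IH)// exprSr -mulrA ler_wpM2l ?exprn_ge0//.
  exact: stepQ (uok n).
have mono n k : [/\ (u n).1.1 <= (u (n + k)%N).1.1, (u (n + k)%N).1.2 <= (u n).1.2,
    (u n).2.1 <= (u (n + k)%N).2.1 & (u (n + k)%N).2.2 <= (u n).2.2].
  elim: k => [|k [i1 i2 i3 i4]]; first by rewrite addn0.
  rewrite addnS uS; have [_ j1 j2 [j3 j4 _ _]] := stepP _ (uok (n + k)%N).
  by split; [exact: le_trans i1 j1|exact: le_trans j2 i2|exact: le_trans i3 j3
    |exact: le_trans j4 i4].
have crossT n m : (u n).1.1 <= (u m).1.2.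
  have [h1 _ _ _] := mono n m; have [_ h2 _ _] := mono m n.
  have [_ h3 _ _] := uok (n + m)%N; rewrite addnC in h2.
  by rewrite (le_trans h1)// (le_trans h3).
have crossS n m : (u n).2.1 <= (u m).2.2.
  have [_ _ h1 _] := mono n m; have [_ _ _ h2] := mono m n.
  have [_ _ _ [_ h3 _]] := uok (n + m)%N; rewrite addnC in h2.
  by rewrite (le_trans h1)// (le_trans h3).
pose t := sup (range (fun n => (u n).1.1)).
pose s := sup (range (fun n => (u n).2.1)).
have tl n : (u n).1.1 <= t.
  apply: ub_le_sup; last by exists n.
  by exists (u 0).1.2 => _ [m _ <-]; exact: crossT.
have tr n : t <= (u n).1.2.
  apply: ge_sup; first by exists (u 0).1.1, 0%N.
  by move=> _ [m _ <-]; exact: crossT.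
have sl n : (u n).2.1 <= s.
  apply: ub_le_sup; last by exists n.
  by exists (u 0).2.2 => _ [m _ <-]; exact: crossS.
have sr n : s <= (u n).2.2.
  apply: ge_sup; first by exists (u 0).2.1, 0%N.
  by move=> _ [m _ <-]; exact: crossS.
apply: cabs_small_eq0 => e e0.
pose L := b0 - a0 + (d0 - c0).
have L0 : 0 <= L by rewrite /L; lra.
have L1 : 0 < L ^+ 2 + 1 by rewrite ltr_wpDl ?sqr_ge0.
have e1 : 0 < e / (L ^+ 2 + 1) by rewrite divr_gt0.
have tin : a0 <= t <= b0 by rewrite (tl 0) (tr 0).
have sin : c0 <= s <= d0 by rewrite (sl 0) (sr 0).
have [dl dl0 hdl] := loc t s tin sin _ e1.
have [n hn] : exists n, L / dl < 2 ^+ n.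
  exists (Num.bound (L / dl)); rewrite (lt_trans (archi_boundP _))//.
    by rewrite divr_ge0// ltW.
  by rewrite -natrX ltr_nat ltn_expl.
have p2 : 0 < 2 ^+ n :> R by rewrite exprn_gt0.
have [w1 w2] := hw n.
have Ln : L / 2 ^+ n < dl.
  by rewrite ltr_pdivrMr// mulrC -ltr_pdivrMr.
have le1 : (b0 - a0) / 2 ^+ n <= L / 2 ^+ n.
  by rewrite ler_pM2r ?invr_gt0// /L; lra.
have le2 : (d0 - c0) / 2 ^+ n <= L / 2 ^+ n.
  by rewrite ler_pM2r ?invr_gt0// /L; lra.
have [k1 k2 k3 [k4 k5 k6]] := uok n.
have := hdl (u n).1.1 (u n).1.2 (u n).2.1 (u n).2.2 k1 (tl n) (tr n) k3 k4 (sl n) (sr n) k6.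
rewrite w1 w2 => /(_ (le_lt_trans le1 Ln) (le_lt_trans le2 Ln)) hfin.
rewrite (le_trans (hQ n))//.
have p4 : 0 < 4 ^+ n :> R by rewrite exprn_gt0.
have : 4 ^+ n * cabs (q (u n)) <=
    4 ^+ n * (e / (L ^+ 2 + 1) * ((b0 - a0) / 2 ^+ n + (d0 - c0) / 2 ^+ n) ^+ 2).
  by rewrite ler_pM2l.
move=> /le_trans; apply.
rewrite -mulrDl -/L expr_div_n -exprM mulnC exprM.
have -> : (2 ^+ 2 : R) = 4 by ring.
have -> : 4 ^+ n * (e / (L ^+ 2 + 1) * (L ^+ 2 / 4 ^+ n)) = e * (L ^+ 2 / (L ^+ 2 + 1)).
  by field; rewrite !gt_eqF.
by rewrite ler_piMr ?(ltW e0)// ler_pdivrMr// mul1r lerDl.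
Qed.

End Bisection.

Section ComplexIntegral.
Variable R : realType.
Local Notation C := (R[i]^o).
Notation mu := (@lebesgue_measure R).
Implicit Types (f g : R -> R[i]) (a b : R).

Definition cint a b f : R[i] :=
  (\int[mu]_(x in `[a, b]) Re (f x) +i* \int[mu]_(x in `[a, b]) Im (f x))%C.

Definition cont_on a b f := forall x, a <= x <= b -> {for x, continuous (f : R -> C)}.

Lemma integrable_cont_on a b (f : R -> R) :
  (forall x, a <= x <= b -> {for x, continuous f}) ->
  mu.-integrable `[a, b] (EFin \o f).
Proof.
move=> h; apply: continuous_compact_integrable; first exact: segment_compact.
by apply: continuous_in_subspaceT => x; rewrite inE/= in_itv/=; exact: h.
Qed.

Lemma cont_on_Re a b f : cont_on a b f ->
  forall x, a <= x <= b -> {for x, continuous (fun y => Re (f y))}.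
Proof.
move=> h x xab.
by apply: (@cvg_comp _ _ _ (f : R -> C) (fun z : C => Re z : R)); [exact: h|exact: cont_Re].
Qed.

Lemma cont_on_Im a b f : cont_on a b f ->
  forall x, a <= x <= b -> {for x, continuous (fun y => Im (f y))}.
Proof.
move=> h x xab.
by apply: (@cvg_comp _ _ _ (f : R -> C) (fun z : C => Im z : R)); [exact: h|exact: cont_Im].
Qed.

Lemma cont_onD a b f g : cont_on a b f -> cont_on a b g ->
  cont_on a b (fun x => f x + g x).
Proof. by move=> hf hg x xab; apply: (@cvgD _ C); [exact: hf|exact: hg]. Qed.

Lemma cont_onN a b f : cont_on a b f -> cont_on a b (fun x => - f x).
Proof. by move=> hf x xab; apply: (@cvgN _ C); exact: hf. Qed.

Lemma cont_onM a b f g : cont_on a b f -> cont_on a b g ->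
  cont_on a b (fun x => f x * g x).
Proof. by move=> hf hg x xab; apply: (@cvgM R[i]); [exact: hf|exact: hg]. Qed.

Lemma cont_on_cst a b k : cont_on a b (fun=> k).
Proof. by move=> x xab; apply: cvg_cst. Qed.

Lemma cont_on_real a b (f : R -> R) : (forall x, a <= x <= b -> {for x, continuous f}) ->
  cont_on a b (fun x => (f x)%:C%C).
Proof. by move=> h x xab; apply: cvg_complex; [exact: h|exact: cvg_cst]. Qed.

Lemma cont_onV a b f : cont_on a b f -> (forall x, a <= x <= b -> f x != 0) ->
  cont_on a b (fun x => (f x)^-1).
Proof. by move=> h h0 x xab; apply: (@cvgV R[i]); [exact: h0|exact: h]. Qed.

Lemma eq_cint a b f g : (forall x, a <= x <= b -> f x = g x) ->
  cint a b f = cint a b g.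
Proof.
move=> h; rewrite /cint; congr Complex; apply: eq_Rintegral => x;
  by rewrite inE/= in_itv/= => /h ->.
Qed.

Lemma cintD a b f g : cont_on a b f -> cont_on a b g ->
  cint a b (fun x => f x + g x) = cint a b f + cint a b g.
Proof.
move=> cf cg; apply: complexP.
  rewrite ReD /= -RintegralD//; [|exact: integrable_cont_on (cont_on_Re cf)
    |exact: integrable_cont_on (cont_on_Re cg)].
  by apply: eq_Rintegral => x _; rewrite ReD.
rewrite ImD /= -RintegralD//; [|exact: integrable_cont_on (cont_on_Im cf)
  |exact: integrable_cont_on (cont_on_Im cg)].
by apply: eq_Rintegral => x _; rewrite ImD.
Qed.

Lemma cintZ a b k f : cont_on a b f -> cint a b (fun x => k * f x) = k * cint a b f.
Proof.
move=> cf.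
have i1 := integrable_cont_on (cont_on_Re cf).
have i2 := integrable_cont_on (cont_on_Im cf).
have i1' (r : R) : mu.-integrable `[a, b] (EFin \o (fun x => r * Re (f x))).
  exact: (@integrableZl _ _ _ _ _ _ r _ i1).
have i2' (r : R) : mu.-integrable `[a, b] (EFin \o (fun x => r * Im (f x))).
  exact: (@integrableZl _ _ _ _ _ _ r _ i2).
apply: complexP.
  rewrite ReM /= -!RintegralZl// -RintegralB//.
  by apply: eq_Rintegral => x _; rewrite ReM.
rewrite ImM /= -!RintegralZl// -RintegralD//.
by apply: eq_Rintegral => x _; rewrite ImM.
Qed.

Lemma cintN a b f : cont_on a b f -> cint a b (fun x => - f x) = - cint a b f.
Proof.
move=> cf; rewrite -mulN1r -cintZ//.
by apply: eq_cint => x _; rewrite mulN1r.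
Qed.

Lemma cintB a b f g : cont_on a b f -> cont_on a b g ->
  cint a b (fun x => f x - g x) = cint a b f - cint a b g.
Proof. by move=> cf cg; rewrite -(cintN cg) (cintD cf (cont_onN cg)). Qed.

Lemma cint_split a m b f : a <= m -> m <= b -> cont_on a b f ->
  cint a b f = cint a m f + cint m b f.
Proof.
move=> am mb cf.
have aux (g : R -> R) : mu.-integrable `[a, b] (EFin \o g) ->
    \int[mu]_(x in `[a, b]) g x = \int[mu]_(x in `[a, m]) g x + \int[mu]_(x in `[m, b]) g x.
  move=> ig; apply/eqP; rewrite addrC -subr_eq; apply/eqP.
  rewrite Rintegral_itvB ?bnd_simp// Rintegral_itv_obnd_cbnd//.
  apply: integrableS ig => //; apply: subset_itv; rewrite bnd_simp//.
by apply: complexP; rewrite ?ReD ?ImD /= aux//; apply: integrable_cont_on;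
  [exact: cont_on_Re|exact: cont_on_Im].
Qed.

Lemma cint_bound a b f M : a <= b -> cont_on a b f ->
  (forall x, a <= x <= b -> cabs (f x) <= M) ->
  cabs (cint a b f) <= 2 * ((b - a) * M).
Proof.
move=> ab cf fM.
have aux (g : R -> R) : mu.-integrable `[a, b] (EFin \o g) ->
    (forall x, a <= x <= b -> `|g x| <= M) ->
    `|\int[mu]_(x in `[a, b]) g x| <= (b - a) * M.
  move=> ig gM; rewrite (le_trans (le_normr_Rintegral _ _))//.
  have -> : (b - a) * M = \int[mu]_(x in `[a, b]) (cst M x).
    have lm : mu `[a, b] = (b - a)%:E.
      rewrite lebesgue_measure_itv/= lte_fin.
      by case: ltP => [_|ba]; rewrite -?EFinB//; congr EFin; lra.
    by rewrite /Rintegral (integral_cst _ _ M%:E)// [X in (_ * X)%E]lm -EFinM mulrC.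
  apply: le_Rintegral => //; first exact: (integrable_norm ig).
    by apply: integrable_cont_on => x _; exact: cvg_cst.
have h1 := aux _ (integrable_cont_on (cont_on_Re cf))
  (fun x xab => le_trans (Re_le_cabs _) (fM x xab)).
have h2 := aux _ (integrable_cont_on (cont_on_Im cf))
  (fun x xab => le_trans (Im_le_cabs _) (fM x xab)).
by rewrite (le_trans (cabs_le_ReIm _))// mulr_natl mulr2n lerD.
Qed.

Lemma cint_ftc a b f (F : R -> R[i]) : a <= b -> cont_on a b f ->
  (forall x : R, is_derive x (1 : R) (fun y => Re (F y)) (Re (f x))) ->
  (forall x : R, is_derive x (1 : R) (fun y => Im (F y)) (Im (f x))) ->
  cint a b f = F b - F a.
Proof.
rewrite le_eqVlt => /predU1P[-> _ _ _|ab cf dRe dIm].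
  by rewrite subrr /cint set_itv1 !Rintegral_set1.
have aux (g G : R -> R) : (forall x, a <= x <= b -> {for x, continuous g}) ->
    (forall x : R, is_derive x (1 : R) G (g x)) -> \int[mu]_(x in `[a, b]) g x = G b - G a.
  move=> cg dG; have dG' x : derivable G x 1 by case: (dG x).
  have cG : continuous G.
    by move=> x; apply: differentiable_continuous; exact/derivable1_diffP.
  rewrite /Rintegral (@continuous_FTC2 _ g G)//.
  - by apply: continuous_in_subspaceT => x; rewrite inE/= in_itv/=; exact: cg.
  - split => //; first by apply: cvg_at_right_filter; exact: cG.
    by apply: cvg_at_left_filter; exact: cG.
  - by move=> x _; rewrite derive1E; case: (dG x).
by apply: complexP; rewrite ?ReD ?ImD ?ReN ?ImN /=;
  [exact: (aux _ (fun y => Re (F y)) (cont_on_Re cf) dRe)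
  |exact: (aux _ (fun y => Im (F y)) (cont_on_Im cf) dIm)].
Qed.

Lemma cint_cst a b k : a <= b -> cint a b (fun=> k) = (b - a)%:C%C * k.
Proof.
move=> ab.
have -> : (b - a)%:C%C * k = k * b%:C%C - k * a%:C%C by rewrite rmorphB; ring.
apply: (@cint_ftc a b (fun=> k) (fun t => k * t%:C%C) ab).
- exact: cont_on_cst.
- move=> x; have -> : (fun y => Re (k * y%:C%C)) = (fun y => Re k * y).
    by apply/funext => y; rewrite ReM /= mulr0 subr0.
  by apply: is_derive_eq; rewrite /GRing.scale/= mulr1.
- move=> x; have -> : (fun y => Im (k * y%:C%C)) = (fun y => Im k * y).
    by apply/funext => y; rewrite ImM /= mulr0 add0r.
  by apply: is_derive_eq; rewrite /GRing.scale/= mulr1.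
Qed.

End ComplexIntegral.

Section CircleExponential.
Variable R : realType.
Local Notation C := (R[i]^o).

Definition expi (t : R) : R[i] := (cos t +i* sin t)%C.

Lemma cabs_expi t : cabs (expi t) = 1.
Proof.
apply/eqP; rewrite -(@eqrXn2 _ 2) ?cabs_ge0//.
by rewrite sqr_cabs/= cos2Dsin2 expr1n.
Qed.

Lemma expiD s t : expi (s + t) = expi s * expi t.
Proof. by apply: complexP; rewrite ?ReM ?ImM /= ?cosD ?sinD// [RHS]addrC; ring. Qed.

Lemma expi0 : expi 0 = 1.
Proof. by rewrite /expi cos0 sin0. Qed.

Lemma expi2pi : expi (2 * pi) = 1.
Proof. by rewrite /expi mulr_natl cos2pi sin2pi. Qed.

Lemma expi_neq0 t : expi t != 0.
Proof. by apply/eqP => /(congr1 (@cabs R)); rewrite cabs_expi cabs0 => /eqP; rewrite oner_eq0. Qed.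

Lemma expiV t : (expi t)^-1 = expi (- t).
Proof.
by apply: (mulfI (expi_neq0 t)); rewrite mulfV ?expi_neq0// -expiD subrr expi0.
Qed.

Lemma expiX t n : expi t ^+ n = expi (n%:R * t).
Proof.
elim: n => [|n IH]; first by rewrite expr0 mul0r expi0.
by rewrite exprS IH -expiD -natr1 mulrDl mul1r addrC.
Qed.

Lemma cont_expi (k : R) a b : cont_on a b (fun t => expi (k * t)).
Proof.
move=> x _; apply: cvg_complex.
  apply: continuous_comp; last exact: continuous_cos.
  exact: mulrl_continuous.
apply: continuous_comp; last exact: continuous_sin.
exact: mulrl_continuous.
Qed.

Lemma cint_expi (k a b : R) : a <= b -> k != 0 ->
  cint a b (fun t => expi (k * t)) = - ('i%C / (k%:C)%C) * (expi (k * b) - expi (k * a)).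
Proof.
move=> ab k0; rewrite mulrBr.
have kV : (k%:C%C)^-1 = (k^-1)%:C%C :> R[i] by rewrite fmorphV.
apply: (@cint_ftc R a b _ (fun t => - ('i%C / (k%:C)%C) * expi (k * t)) ab).
- exact: cont_expi.
- move=> x; have -> : (fun t => Re (- ('i%C / (k%:C)%C) * expi (k * t))) =
      (fun t => k^-1 * sin (k * t)).
    by apply/funext => t; rewrite kV ReM /=; ring.
  apply: is_derive_eq; rewrite /= /GRing.scale /=; field; exact: k0.
- move=> x; have -> : (fun t => Im (- ('i%C / (k%:C)%C) * expi (k * t))) =
      (fun t => - k^-1 * cos (k * t)).
    by apply/funext => t; rewrite kV ImM /=; ring.
  apply: is_derive_eq; rewrite /= /GRing.scale /=; field; exact: k0.
Qed.

End CircleExponential.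

Section CauchyCircle.
Variable R : realType.
Local Notation C := (R[i]^o).
Variables (F : R[i] -> R[i]) (r : R) (w : R[i]).
Hypotheses (aF : analytic_on_D F) (r0 : 0 < r) (r1 : r < 1) (wr : cabs w < r).

Definition circ (s : R) : R[i] := r%:C%C * expi s.
Definition cker (s : R) : R[i] := circ s / (circ s - w).
Definition cone (t s : R) : R[i] := w + t%:C%C * (circ s - w).

Lemma cabs_circ s : cabs (circ s) = r.
Proof. by rewrite cabsM cabs_real cabs_expi mulr1 gtr0_norm. Qed.

Lemma cont_on_circ a b : cont_on a b circ.
Proof.
apply: cont_onM; first exact: cont_on_cst.
have -> : @expi R = (fun t => expi (1 * t)) by apply/funext => t; rewrite mul1r.
exact: cont_expi.
Qed.

Lemma cabs_circB s : r - cabs w <= cabs (circ s - w).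
Proof. by rewrite -(cabs_circ s) cabs_dist. Qed.

Lemma circB_neq0 s : circ s - w != 0.
Proof.
apply/eqP => h; have := cabs_circB s; rewrite h cabs0.
by have := wr; lra.
Qed.

Lemma cabs_cker s : cabs (cker s) <= r / (r - cabs w).
Proof.
rewrite /cker cabsM cabsV cabs_circ ler_wpM2l ?(ltW r0)//.
rewrite lef_pV2 ?posrE ?cabs_circB// ?subr_gt0//.
by rewrite (lt_le_trans _ (cabs_circB s))// subr_gt0.
Qed.

Lemma cont_on_cker a b : cont_on a b cker.
Proof.
apply: cont_onM; first exact: cont_on_circ.
apply: cont_onV => [|x _]; last exact: circB_neq0.
by apply: cont_onD; [exact: cont_on_circ|exact: cont_on_cst].
Qed.

Lemma cont_on_analytic a b (f : R -> R[i]) : cont_on a b f ->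
  (forall x, a <= x <= b -> cabs (f x) < 1) -> cont_on a b (fun x => F (f x)).
Proof.
move=> cf f1 x xab.
apply: (@cvg_comp _ _ _ (f : R -> C) (F : C -> C)); first exact: cf.
exact: (analytic_continuous aF (f1 _ xab)).
Qed.

Lemma cabs_cone t s : 0 <= t <= 1 -> cabs (cone t s) <= r.
Proof.
move=> /andP[t0 t1].
have -> : cone t s = (1 - t)%:C%C * w + t%:C%C * circ s.
  by rewrite /cone rmorphB rmorph1; ring.
rewrite (le_trans (cabsD _ _))// cabsM cabsM cabs_circ !cabs_real.
rewrite !ger0_norm ?subr_ge0//.
have := cabs_ge0 w; have := wr; have := r0; nra.
Qed.

Lemma cabs_cone1 t s : 0 <= t <= 1 -> cabs (cone t s) < 1.
Proof. by move=> /cabs_cone h; rewrite (le_lt_trans (h s)). Qed.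

Lemma cont_cone_s t a b : cont_on a b (cone t).
Proof.
apply: cont_onD; first exact: cont_on_cst.
apply: cont_onM; first exact: cont_on_cst.
by apply: cont_onD; [exact: cont_on_circ|exact: cont_on_cst].
Qed.

Lemma cont_cone_t s a b : cont_on a b (cone^~ s).
Proof.
apply: cont_onD; first exact: cont_on_cst.
apply: cont_onM; last exact: cont_on_cst.
by apply: cont_on_real => x _; exact: cvg_id.
Qed.

Lemma cont_Fcone_s t a b : 0 <= t <= 1 -> cont_on a b (fun s => F (cone t s)).
Proof.
by move=> t1; apply: cont_on_analytic; [exact: cont_cone_s|move=> x _; exact: cabs_cone1].
Qed.

Lemma cont_Fcone_t s a b : 0 <= a -> b <= 1 -> cont_on a b (fun t => F (cone t s)).
Proof.
move=> a0 b1; apply: cont_on_analytic; first exact: cont_cone_t.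
by move=> x /andP[ax xb]; apply: cabs_cone1; rewrite (le_trans a0)//= (le_trans xb).
Qed.

Lemma cont_on_inv a b : 0 < a -> cont_on a b (fun t : R => (t%:C%C)^-1 : R[i]).
Proof.
move=> a0; apply: cont_onV; first by apply: cont_on_real => x _; exact: cvg_id.
move=> x /andP[ax _]; rewrite eq_complex/= negb_and gt_eqF//.
exact: lt_le_trans ax.
Qed.

(* The integral of F(z) dz / (z - w) along the boundary of the image of a
   rectangle under cone, divided by i and written in the coordinates (t, s). *)
Definition bdint (a b c d : R) : R[i] :=
  cint c d (fun s => (F (cone b s) - F (cone a s)) * cker s) +
  'i%C * cint a b (fun t => (F (cone t d) - F (cone t c)) * (t%:C%C)^-1).

Lemma cont_bdint_s a b c d : 0 <= a <= 1 -> 0 <= b <= 1 ->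
  cont_on c d (fun s => (F (cone b s) - F (cone a s)) * cker s).
Proof.
move=> a1 b1; apply: cont_onM; last exact: cont_on_cker.
by apply: cont_onD; [exact: cont_Fcone_s|apply: cont_onN; exact: cont_Fcone_s].
Qed.

Lemma cont_bdint_t a b c d : 0 < a -> b <= 1 ->
  cont_on a b (fun t => (F (cone t d) - F (cone t c)) * (t%:C%C)^-1).
Proof.
move=> a0 b1; apply: cont_onM; last exact: cont_on_inv.
by apply: cont_onD; [exact: cont_Fcone_t (ltW _) _|apply: cont_onN; exact: cont_Fcone_t (ltW _) _].
Qed.

Lemma bdint_addt a m b c d : 0 < a -> a <= m -> m <= b -> b <= 1 ->
  bdint a b c d = bdint a m c d + bdint m b c d.
Proof.
move=> a0 am mb b1.
have a01 : 0 <= a <= 1 by apply/andP; split; lra.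
have m01 : 0 <= m <= 1 by apply/andP; split; lra.
have b01 : 0 <= b <= 1 by apply/andP; split; lra.
rewrite /bdint (cint_split am mb); last exact: cont_bdint_t.
have -> : cint c d (fun s => (F (cone b s) - F (cone a s)) * cker s) =
   cint c d (fun s => (F (cone m s) - F (cone a s)) * cker s) +
   cint c d (fun s => (F (cone b s) - F (cone m s)) * cker s).
  rewrite -(cintD (cont_bdint_s _ _) (cont_bdint_s _ _))//.
  by apply: eq_cint => x _; ring.
by ring.
Qed.

Lemma bdint_adds a b c m d : 0 < a -> a <= b -> b <= 1 -> c <= m -> m <= d ->
  bdint a b c d = bdint a b c m + bdint a b m d.
Proof.
move=> a0 ab b1 cm md.
have a01 : 0 <= a <= 1 by apply/andP; split; lra.
have b01 : 0 <= b <= 1 by apply/andP; split; lra.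
rewrite /bdint (cint_split cm md); last exact: cont_bdint_s.
have -> : cint a b (fun t => (F (cone t d) - F (cone t c)) * (t%:C%C)^-1) =
   cint a b (fun t => (F (cone t m) - F (cone t c)) * (t%:C%C)^-1) +
   cint a b (fun t => (F (cone t d) - F (cone t m)) * (t%:C%C)^-1).
  rewrite -(cintD (cont_bdint_t a0 b1) (cont_bdint_t a0 b1)).
  by apply: eq_cint => x _; ring.
by ring.
Qed.

Lemma cint_circ c d : c <= d ->
  cint c d circ = - 'i%C * (circ d - circ c).
Proof.
move=> cd.
have -> : cint c d circ = cint c d (fun s => r%:C%C * expi (1 * s)).
  by apply: eq_cint => x _; rewrite mul1r.
rewrite cintZ; last exact: cont_expi.
by rewrite cint_expi ?oner_eq0// divr1 /circ !mul1r; ring.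
Qed.

Lemma dist_circ c d : cabs (circ d - circ c) <= 2 * `|d - c|.
Proof.
wlog cd : c d / c <= d.
  move=> h; case: (leP c d) => [/h//|/ltW/h]; rewrite cabs_distC => /le_trans; apply.
  by rewrite distrC.
rewrite ger0_norm ?subr_ge0//.
have -> : circ d - circ c = 'i%C * cint c d circ.
  by rewrite cint_circ// mulrA mulrN -expr2 sqr_i opprK mul1r.
rewrite cabsM {1}/cabs/= expr0n/= expr1n add0r sqrtr1 mul1r.
have := @cint_bound _ _ _ _ 1 cd (cont_on_circ (a := c) (b := d)).
by rewrite mulr1; apply => x _; rewrite cabs_circ ltW.
Qed.

Lemma dist_cone t s t' s' : 0 <= t' <= 1 ->
  cabs (cone t s - cone t' s') <= 2 * (`|t - t'| + `|s - s'|).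
Proof.
move=> /andP[t0 t1].
have -> : cone t s - cone t' s' = (t - t')%:C%C * (circ s - w) + t'%:C%C * (circ s - circ s').
  by rewrite /cone rmorphB; ring.
rewrite (le_trans (cabsD _ _))// cabsM cabsM !cabs_real mulrDr lerD//.
  rewrite mulrC ler_wpM2r//.
  by rewrite (le_trans (cabsB _ _))// cabs_circ; have := wr; have := r1; lra.
rewrite ger0_norm//; have := dist_circ s' s; have := cabs_ge0 (circ s - circ s').
by nra.
Qed.

Lemma bdint_local t0 s0 tau : 0 < tau -> tau <= t0 -> t0 <= 1 ->
  forall e, 0 < e -> exists2 dl, 0 < dl &
  forall a b c d, tau <= a -> a <= t0 -> t0 <= b -> b <= 1 ->
    c <= s0 -> s0 <= d -> b - a < dl -> d - c < dl ->
    cabs (bdint a b c d) <= e * (b - a + (d - c)) ^+ 2.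
Proof.
move=> tau0 taut t1 e e0.
have t01 : 0 <= t0 <= 1 by rewrite t1 andbT; lra.
pose z0 := cone t0 s0.
have [l hl] := (analytic_cdiff F).1 aF z0 (cabs_cone1 s0 t01).
pose W := r / (r - cabs w).
have W0 : 0 <= W by rewrite divr_ge0 ?subr_ge0 ?ltW.
pose M := 8 * (W + tau^-1).
have M0 : 0 < M by rewrite mulr_gt0// ltr_wpDl// invr_gt0.
have eM : 0 < e / M by rewrite divr_gt0.
have [dl0 dl00 hd] := hl _ eM.
exists (dl0 / 4); first by rewrite divr_gt0.
move=> a b c d taua at0 tb b1 cs sd ba dc.
pose E z := F z - F z0 - l * (z - z0).
have hE t s : a <= t <= b -> c <= s <= d ->
    cabs (E (cone t s)) <= e / M * (2 * (b - a + (d - c))).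
  move=> /andP[ta tb'] /andP[sc sd'].
  have dP : cabs (cone t s - z0) <= 2 * (b - a + (d - c)).
    rewrite (le_trans (dist_cone _ _ _ t01))// ler_pM2l// lerD// ler_norml;
      apply/andP; split; lra.
  have := hd (cone t s - z0); rewrite (addrC z0) subrK => hd'.
  rewrite /E (le_trans (hd' _))//; last by rewrite ler_pM2l.
  by rewrite (le_lt_trans dP)//; lra.
have a0 : 0 < a := lt_le_trans tau0 taua.
have ab : a <= b := le_trans at0 tb.
have cd : c <= d := le_trans cs sd.
have a01 : 0 <= a <= 1 by rewrite (ltW a0) (le_trans ab b1).
have b01 : 0 <= b <= 1 by rewrite (le_trans (ltW a0) ab) b1.
have aa : a <= a <= b by rewrite lexx ab.
have bb : a <= b <= b by rewrite lexx ab.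
have cc : c <= c <= d by rewrite lexx cd.
have dd : c <= d <= d by rewrite lexx cd.
have cE1 : cont_on c d (fun s => (E (cone b s) - E (cone a s)) * cker s).
  apply: cont_onM; last exact: cont_on_cker.
  have cE u : 0 <= u <= 1 -> cont_on c d (fun s => E (cone u s)).
    move=> u1; apply: cont_onD.
      by apply: cont_onD; [exact: cont_Fcone_s|exact: cont_on_cst].
    apply: cont_onN; apply: cont_onM; first exact: cont_on_cst.
    by apply: cont_onD; [exact: cont_cone_s|exact: cont_on_cst].
  by apply: cont_onD; [exact: cE|apply: cont_onN; exact: cE].
have cE2 : cont_on a b (fun t => (E (cone t d) - E (cone t c)) * (t%:C%C)^-1).
  apply: cont_onM; last exact: cont_on_inv.
  have cE u : cont_on a b (fun t => E (cone t u)).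
    apply: cont_onD.
      by apply: cont_onD; [exact: cont_Fcone_t (ltW a0) _|exact: cont_on_cst].
    apply: cont_onN; apply: cont_onM; first exact: cont_on_cst.
    by apply: cont_onD; [exact: cont_cone_t|exact: cont_on_cst].
  by apply: cont_onD; [exact: cE|apply: cont_onN; exact: cE].
have -> : bdint a b c d = cint c d (fun s => (E (cone b s) - E (cone a s)) * cker s) +
  'i%C * cint a b (fun t => (E (cone t d) - E (cone t c)) * (t%:C%C)^-1).
  have -> : cint c d (fun s => (E (cone b s) - E (cone a s)) * cker s) =
      cint c d (fun s => (F (cone b s) - F (cone a s)) * cker s) -
      l * (b - a)%:C%C * cint c d circ.
    rewrite -cintZ; last exact: cont_on_circ.
    rewrite -cintB; [|exact: cont_bdint_s|]; last first.
      by apply: cont_onM; [exact: cont_on_cst|exact: cont_on_circ].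
    apply: eq_cint => s _; rewrite /E /cone /cker rmorphB.
    by field; exact: circB_neq0.
  have -> : cint a b (fun t => (E (cone t d) - E (cone t c)) * (t%:C%C)^-1) =
      cint a b (fun t => (F (cone t d) - F (cone t c)) * (t%:C%C)^-1) -
      l * (b - a)%:C%C * (circ d - circ c).
    have -> : l * (b - a)%:C%C * (circ d - circ c) =
        cint a b (fun=> l * (circ d - circ c)).
      by rewrite cint_cst//; ring.
    rewrite -cintB; [|exact: cont_bdint_t|exact: cont_on_cst].
    apply: eq_cint => t /andP[ta tb']; rewrite /E /cone; field.
    by rewrite eq_complex/= negb_and gt_eqF//; lra.
  by rewrite /bdint cint_circ//; ring.
set S := b - a + (d - c) in hE *.
have S0 : 0 <= S by rewrite /S; lra.
have hb1 : cabs (cint c d (fun s => (E (cone b s) - E (cone a s)) * cker s)) <=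
    2 * ((d - c) * (e / M * (4 * S) * W)).
  apply: cint_bound => // s sd'; rewrite cabsM ler_pM ?cabs_ge0 ?cabs_cker//.
  rewrite (le_trans (cabsB _ _))//.
  have h1 := hE b s; have h2 := hE a s.
  have -> : e / M * (4 * S) = e / M * (2 * S) + e / M * (2 * S) by ring.
  exact: lerD (h1 bb sd') (h2 aa sd').
have hb2 : cabs (cint a b (fun t => (E (cone t d) - E (cone t c)) * (t%:C%C)^-1)) <=
    2 * ((b - a) * (e / M * (4 * S) * tau^-1)).
  apply: cint_bound => // t tab; rewrite cabsM ler_pM ?cabs_ge0//.
    rewrite (le_trans (cabsB _ _))//.
    have h1 := hE t c tab; have h2 := hE t d tab.
    have -> : e / M * (4 * S) = e / M * (2 * S) + e / M * (2 * S) by ring.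
    exact: lerD (h2 dd) (h1 cc).
  move: tab => /andP[ta _]; have tat := le_trans taua ta.
  have t0' := lt_le_trans tau0 tat.
  by rewrite cabsV cabs_real gtr0_norm// lef_pV2 ?posrE.
rewrite (le_trans (cabsD _ _))// cabsM.
have -> : cabs 'i%C = 1 :> R by rewrite /cabs/= expr0n/= expr1n add0r sqrtr1.
rewrite mul1r (le_trans (lerD hb1 hb2))//.
have -> : 2 * ((d - c) * (e / M * (4 * S) * W)) +
  2 * ((b - a) * (e / M * (4 * S) * tau^-1)) =
  e * S * ((8 * ((d - c) * W + (b - a) * tau^-1)) / M).
  by field; rewrite gt_eqF//=; rewrite gt_eqF.
have -> : e * S ^+ 2 = e * S * S by ring.
apply: ler_wpM2l; first by rewrite mulr_ge0// ltW.
rewrite ler_pdivrMr// /M /S.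
have tV : 0 < tau^-1 by rewrite invr_gt0.
have h1 : 0 <= (b - a) * W by rewrite mulr_ge0// subr_ge0.
have h2 : 0 <= (d - c) * tau^-1 by rewrite mulr_ge0 ?subr_ge0 ?(ltW tV).
by nra.
Qed.

End CauchyCircle.

Section CauchyTaylor.
Variable R : realType.
Local Notation C := (R[i]^o).
Variables (F : R[i] -> R[i]).
Hypotheses (aF : analytic_on_D F).

Let twopi_ge0 : 0 <= 2 * pi :> R.
Proof. by rewrite mulr_ge0// ?pi_ge0//. Qed.

Lemma circ2pi (r : R) : circ r (2 * pi) = circ r 0.
Proof. by rewrite /circ expi2pi expi0. Qed.

Lemma cont_Fcirc (r : R) a b : 0 < r -> r < 1 -> cont_on a b (fun s => F (circ r s)).
Proof.
move=> r0 r1; apply: cont_on_analytic => //; first exact: cont_on_circ.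
by move=> x _; rewrite cabs_circ.
Qed.

Lemma bdint_eq0 (r : R) (w : R[i]) (tau : R) : 0 < r -> r < 1 -> cabs w < r ->
  0 < tau -> tau <= 1 -> bdint F r w tau 1 0 (2 * pi) = 0.
Proof.
move=> r0 r1 wr t0 t1; apply: bisection_eq0 => //.
- move=> a m b c d ta am mb b1 _ _ _.
  exact: (bdint_addt aF r0 r1 wr c d (lt_le_trans t0 ta) am mb b1).
- move=> a b c m d ta ab b1 _ cm md _.
  exact: (bdint_adds aF r0 r1 wr (lt_le_trans t0 ta) ab b1 cm md).
- move=> t s /andP[tt t1'] _ e e0.
  have [dl dl0 h] := bdint_local aF r0 r1 wr s t0 tt t1' e0.
  by exists dl => // a b c d ta at1 tb b1 _ cs sd _; exact: h.
Qed.

Lemma cauchy_cker (r : R) (w : R[i]) : 0 < r -> r < 1 -> cabs w < r ->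
  cint 0 (2 * pi) (fun s => (F (circ r s) - F w) * cker r w s) = 0.
Proof.
move=> r0 r1 wr; apply: cabs_small_eq0 => e e0.
have w1 : cabs w < 1 by rewrite (lt_trans wr).
pose W := r / (r - cabs w).
have W0 : 0 <= W by rewrite divr_ge0 ?subr_ge0 ?ltW.
pose M := 4 * pi * W + 1.
have M0 : 0 < M.
  by apply: ltr_wpDl => //; apply: mulr_ge0 => //; rewrite mulr_ge0 ?pi_ge0.
have eM : 0 < e / M by rewrite divr_gt0.
have := analytic_continuous aF w1.
move=> /(@cvg_cabsP R C (nbhs (w : C)) (nbhs_filter (w : C)) F (F w))/(_ _ eM).
move=> /nbhs_cabsP[d d0 hd].
pose tau := Num.min 1 (d / 4).
have tau0 : 0 < tau by rewrite lt_min ltr01 divr_gt0.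
have tau1 : tau <= 1 by rewrite ge_min lexx.
have taud : tau <= d / 4 by rewrite ge_min lexx orbT.
have t01 : 0 <= tau <= 1 by rewrite (ltW tau0).
have one01 : 0 <= (1 : R) <= 1 by rewrite ler01 lexx.
have cE : cont_on 0 (2 * pi) (fun s => (F (cone r w tau s) - F w) * cker r w s).
  apply: cont_onM; last exact: cont_on_cker.
  by apply: cont_onD; [exact: cont_Fcone_s|exact: cont_on_cst].
have := bdint_eq0 r0 r1 wr tau0 tau1; rewrite /bdint.
rewrite (@eq_cint _ tau 1 _ (fun=> 0)); last first.
  by move=> t _; rewrite /cone circ2pi subrr mul0r.
rewrite cint_cst// mulr0 mulr0 addr0 => h0.
have -> : cint 0 (2 * pi) (fun s => (F (circ r s) - F w) * cker r w s) =
    cint 0 (2 * pi) (fun s => (F (cone r w tau s) - F w) * cker r w s).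
  have := cintD (cont_bdint_s aF r0 r1 wr t01 one01) cE.
  rewrite h0 add0r => <-; apply: eq_cint => s _.
  have -> : circ r s = cone r w 1 s by rewrite /cone mul1r addrC subrK.
  by ring.
rewrite (le_trans (cint_bound (M := e / M * W) twopi_ge0 cE _))//.
  move=> s _; rewrite cabsM ler_pM ?cabs_ge0 ?cabs_cker// cabs_distC ltW// hd//.
  rewrite /cone addrC addKr cabsM cabs_real gtr0_norm//.
  have := cabsB (circ r s) w; rewrite cabs_circ// => hh.
  have hq : tau * cabs (circ r s - w) <= d / 4 * 2.
    by apply: ler_pM => //; [exact: ltW|exact: cabs_ge0|lra].
  by apply: (le_lt_trans hq); lra.
have -> : 2 * ((2 * pi - 0) * (e / M * W)) = e * ((M - 1) / M).
  have -> : M - 1 = 4 * pi * W by rewrite /M addrK.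
  by field; exact: lt0r_neq0.
by rewrite ler_piMr ?(ltW e0)// ler_pdivrMr// mul1r gerBl.
Qed.

Lemma cint_circVX (r : R) n : 0 < r ->
  cint 0 (2 * pi) (fun s => (circ r s)^-1 ^+ n) = if n is 0%N then (2 * pi)%:C%C else 0.
Proof.
move=> r0; case: n => [|n].
  rewrite (@eq_cint _ _ _ _ (fun=> 1)); last by move=> x _; rewrite expr0.
  by rewrite cint_cst// subr0 mulr1.
rewrite (@eq_cint _ _ _ _ (fun s => (r%:C%C)^-1 ^+ n.+1 * expi ((- n.+1%:R) * s))).
  rewrite cintZ; last exact: cont_expi.
  rewrite cint_expi// ?oppr_eq0 ?pnatr_eq0//.
  have -> : expi (- n.+1%:R * (2 * pi)) = 1 :> R[i].
    by rewrite mulNr -expiV -expiX expi2pi expr1n invr1.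
  by rewrite mulr0 expi0 subrr !mulr0.
move=> s _; rewrite /circ invfM exprMn expiV expiX; congr (_ * expi _).
by rewrite mulrN mulNr.
Qed.

Lemma cont_circVX (r : R) n a b : 0 < r -> cont_on a b (fun s => (circ r s)^-1 ^+ n).
Proof.
move=> r0; have c0 s : circ r s != 0.
  by apply/eqP => h; have := cabs_circ r0 s; rewrite h cabs0 => h'; move: r0; rewrite -h' ltxx.
elim: n => [|n IH].
  rewrite (_ : (fun _ => _) = (fun=> 1)); first exact: cont_on_cst.
  by apply/funext => s; rewrite expr0.
rewrite (_ : (fun _ => _) = (fun s => (circ r s)^-1 * (circ r s)^-1 ^+ n)).
  apply: cont_onM; last exact: IH.
  by apply: cont_onV; [exact: cont_on_circ|move=> s _; exact: c0].
by apply/funext => s; rewrite exprS.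
Qed.

Lemma cker_expansion (r : R) (w : R[i]) N s : 0 < r -> cabs w < r ->
  cker r w s = \sum_(n < N) w ^+ n * (circ r s)^-1 ^+ n +
               w ^+ N * (circ r s)^-1 ^+ N * cker r w s.
Proof.
move=> r0 wr.
have c0 : circ r s != 0.
  by apply/eqP => h; have := cabs_circ r0 s; rewrite h cabs0 => h'; move: r0; rewrite -h' ltxx.
have cw : circ r s - w != 0 by exact: circB_neq0.
elim: N => [|N {1}->]; first by rewrite big_ord0 !expr0 !mul1r add0r.
rewrite big_ord_recr /= -addrA; congr (_ + _).
rewrite !exprS /cker.
set X := w ^+ N * _.
have -> : w * w ^+ N * ((circ r s)^-1 * (circ r s)^-1 ^+ N) = X * (w / circ r s).
  by rewrite /X; ring.
by field; rewrite c0 cw.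
Qed.

Lemma cint_sum (N : nat) (f : nat -> R -> R[i]) a b : (forall n, cont_on a b (f n)) ->
  cont_on a b (fun s => \sum_(n < N) f n s) /\
  cint a b (fun s => \sum_(n < N) f n s) = \sum_(n < N) cint a b (f n).
Proof.
move=> cf; elim: N => [|N [IH1 IH2]].
  have -> : (fun s => \sum_(n < 0) f n s) = (fun=> 0).
    by apply/funext => s; rewrite big_ord0.
  split; first exact: cont_on_cst.
  rewrite big_ord0 (@eq_cint _ _ _ _ (fun s => 0 * f 0%N s)).
    by rewrite (cintZ _ (cf 0%N)) mul0r.
  by move=> s _; rewrite mul0r.
have -> : (fun s => \sum_(n < N.+1) f n s) = (fun s => (\sum_(n < N) f n s) + f N s).
  by apply/funext => s; rewrite big_ord_recr.
split; first exact: (cont_onD IH1 (cf N)).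
by rewrite (cintD IH1 (cf N)) IH2 big_ord_recr.
Qed.

Lemma cint_mul_cker (G : R -> R[i]) (M r : R) (w : R[i]) N : 0 < r -> cabs w < r ->
  (forall a b, cont_on a b G) -> (forall s, 0 <= s <= 2 * pi -> cabs (G s) <= M) ->
  cabs (cint 0 (2 * pi) (fun s => G s * cker r w s) -
        \sum_(n < N) w ^+ n * cint 0 (2 * pi) (fun s => G s * (circ r s)^-1 ^+ n)) <=
  4 * pi * M * ((cabs w / r) ^+ N * (r / (r - cabs w))).
Proof.
move=> r0 wr cG GM.
have cGX n a b : cont_on a b (fun s => G s * (circ r s)^-1 ^+ n).
  by apply: cont_onM; [exact: cG|exact: cont_circVX].
have [c1 e1] := @cint_sum N (fun n s => w ^+ n * (G s * (circ r s)^-1 ^+ n)) 0 (2 * pi)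
  (fun n => cont_onM (cont_on_cst (k := w ^+ n)) (cGX n 0 (2 * pi))).
have -> : \sum_(n < N) w ^+ n * cint 0 (2 * pi) (fun s => G s * (circ r s)^-1 ^+ n) =
    cint 0 (2 * pi) (fun s => \sum_(n < N) w ^+ n * (G s * (circ r s)^-1 ^+ n)).
  by rewrite e1; apply: eq_bigr => n _; rewrite (cintZ _ (cGX n 0 (2 * pi))).
have cR : cont_on 0 (2 * pi) (fun s => G s * (w ^+ N * (circ r s)^-1 ^+ N * cker r w s)).
  apply: cont_onM; first exact: cG.
  apply: cont_onM; last exact: cont_on_cker.
  by apply: cont_onM; [exact: cont_on_cst|exact: cont_circVX].
have -> : cint 0 (2 * pi) (fun s => G s * cker r w s) =
    cint 0 (2 * pi) (fun s => \sum_(n < N) w ^+ n * (G s * (circ r s)^-1 ^+ n)) +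
    cint 0 (2 * pi) (fun s => G s * (w ^+ N * (circ r s)^-1 ^+ N * cker r w s)).
  rewrite -(cintD c1 cR); apply: eq_cint => s _.
  rewrite {1}(cker_expansion N s r0 wr) mulrDr; congr (_ + _).
  by rewrite mulr_sumr; apply: eq_bigr => n _; rewrite mulrCA.
rewrite addrC addKr.
rewrite (le_trans (cint_bound (M := M * ((cabs w / r) ^+ N * (r / (r - cabs w)))) twopi_ge0 cR _))//.
  move=> s s01; rewrite cabsM ler_pM ?cabs_ge0 ?GM// cabsM ler_pM ?cabs_ge0 ?cabs_cker//.
  by rewrite cabsM !cabsX cabsV cabs_circ// expr_div_n exprVn.
by rewrite le_eqVlt; apply/orP; left; apply/eqP; ring.
Qed.

Lemma geometric_small (q K e : R) : 0 <= q -> q < 1 -> 0 < e ->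
  exists N0, forall N, (N0 <= N)%N -> K * q ^+ N <= e.
Proof.
move=> q0 q1 e0.
have : (fun N => K * q ^+ N) @ \oo --> (K * 0 : R).
  by apply: cvgMr; apply: cvg_expr; rewrite ger0_norm.
rewrite mulr0 => /cvgrPdist_lt/(_ _ e0)[N0 _ h]; exists N0 => N hN.
by have := h N hN; rewrite /= sub0r normrN => /ltW; apply: le_trans; exact: ler_norm.
Qed.

Lemma cint_cker (r : R) (w : R[i]) : 0 < r -> cabs w < r ->
  cint 0 (2 * pi) (cker r w) = (2 * pi)%:C%C.
Proof.
move=> r0 wr; apply/eqP; rewrite -subr_eq0; apply/eqP; apply: cabs_small_eq0 => e e0.
have q0 : 0 <= cabs w / r by rewrite divr_ge0 ?cabs_ge0 ?ltW.
have q1 : cabs w / r < 1 by rewrite ltr_pdivrMr// mul1r.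
have [N0 hN] := geometric_small (4 * pi * (r / (r - cabs w))) q0 q1 e0.
have := @cint_mul_cker (fun=> 1) 1 r w N0.+1 r0 wr (fun _ _ => cont_on_cst (k := 1)).
rewrite cabs1 => /(_ (fun _ _ => lexx 1)).
have mul1 (G : R -> R[i]) : cint 0 (2 * pi) (fun s => 1 * G s) = cint 0 (2 * pi) G.
  by apply: eq_cint => s _; rewrite mul1r.
rewrite (mul1 (cker r w)) big_ord_recl (mul1 (fun s => (circ r s)^-1 ^+ 0)).
rewrite big1 ?addr0; last first.
  move=> i _; rewrite (mul1 (fun s => (circ r s)^-1 ^+ (lift ord0 i))).
  by rewrite cint_circVX// mulr0.
rewrite cint_circVX// expr0 mul1r mulr1 => /le_trans; apply.
by rewrite (le_trans _ (hN N0.+1 _))// le_eqVlt; apply/orP; left; apply/eqP; ring.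
Qed.

Definition cauchy_coef (r : R) n : R[i] :=
  ((2 * pi)%:C%C)^-1 * cint 0 (2 * pi) (fun s => F (circ r s) * (circ r s)^-1 ^+ n).

Let pi2_neq0 : (2 * pi)%:C%C != 0 :> R[i].
Proof. by rewrite eq_complex/= negb_and gt_eqF// mulr_gt0// pi_gt0. Qed.

Lemma cabs_pi2V : cabs ((2 * pi)%:C%C)^-1 = (2 * pi : R)^-1.
Proof. by rewrite cabsV cabs_real ger0_norm. Qed.

Lemma cauchy_taylor (r M : R) (w : R[i]) N : 0 < r -> r < 1 -> cabs w < r ->
  (forall s, 0 <= s <= 2 * pi -> cabs (F (circ r s)) <= M) ->
  cabs (F w - \sum_(n < N) cauchy_coef r n * w ^+ n) <=
  2 * M * ((cabs w / r) ^+ N * (r / (r - cabs w))).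
Proof.
move=> r0 r1 wr FM.
have h1 := cauchy_cker r0 r1 wr.
have Fw : F w = ((2 * pi)%:C%C)^-1 * cint 0 (2 * pi) (fun s => F (circ r s) * cker r w s).
  apply: (mulfI pi2_neq0); rewrite mulrA mulfV ?mul1r//.
  rewrite -(cint_cker r0 wr) mulrC -cintZ; last exact: cont_on_cker.
  apply/esym/eqP; rewrite -subr_eq0 -cintB.
  - rewrite -h1; apply/eqP; apply: eq_cint => s _; ring.
  - by apply: cont_onM; [exact: cont_Fcirc|exact: cont_on_cker].
  - by apply: cont_onM; [exact: cont_on_cst|exact: cont_on_cker].
have -> : \sum_(n < N) cauchy_coef r n * w ^+ n = ((2 * pi)%:C%C)^-1 *
    \sum_(n < N) w ^+ n * cint 0 (2 * pi) (fun s => F (circ r s) * (circ r s)^-1 ^+ n).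
  by rewrite mulr_sumr; apply: eq_bigr => n _; rewrite /cauchy_coef mulrAC mulrA.
rewrite Fw -mulrBr cabsM cabs_pi2V.
have := @cint_mul_cker (fun s => F (circ r s)) M r w N r0 wr
  (fun a b => cont_Fcirc r0 r1) FM.
move=> h; rewrite ler_pdivrMl; last by rewrite mulr_gt0// pi_gt0.
by rewrite (le_trans h)// le_eqVlt; apply/orP; left; apply/eqP; ring.
Qed.

Lemma cauchy_coef_bound (r M : R) n : 0 < r -> r < 1 ->
  (forall s, 0 <= s <= 2 * pi -> cabs (F (circ r s)) <= M) -> cabs (cauchy_coef r n) * r ^+ n <= 2 * M.
Proof.
move=> r0 r1 FM.
have cR : cont_on 0 (2 * pi) (fun s => F (circ r s) * (circ r s)^-1 ^+ n).
  by apply: cont_onM; [exact: cont_Fcirc|exact: cont_circVX].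
rewrite /cauchy_coef cabsM cabs_pi2V -ler_pdivlMr ?exprn_gt0//.
rewrite ler_pdivrMl; last by rewrite mulr_gt0// pi_gt0.
rewrite (le_trans (cint_bound (M := M * r^-1 ^+ n) twopi_ge0 cR _))//.
  by move=> s s01; rewrite cabsM cabsX cabsV cabs_circ// ler_wpM2r ?FM// exprn_ge0// invr_ge0 ltW.
by rewrite le_eqVlt; apply/orP; left; apply/eqP; rewrite exprVn; ring.
Qed.

Lemma bounded_circ (r : R) : 0 < r -> r < 1 -> exists M, forall s, 0 <= s <= 2 * pi -> cabs (F (circ r s)) <= M.
Proof.
move=> r0 r1.
have [|c _ hc] := @EVT_max R (fun s => cabs (F (circ r s))) 0 (2 * pi) twopi_ge0.
  apply: continuous_in_subspaceT => x; rewrite inE/= in_itv/= => xab.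
  apply: (@cvg_comp _ _ _ (fun s => F (circ r s) : C) (fun z : C => cabs z : R)).
    exact: (cont_Fcirc r0 r1 xab).
  exact: cont_cabs.
by exists (cabs (F (circ r c))) => s s01; apply: hc; rewrite in_itv.
Qed.

End CauchyTaylor.

Section Taylor.
Variable R : realType.

Definition taylor_on_D (a : nat -> R[i]) (F : R[i] -> R[i]) :=
  forall rho : R, 0 < rho -> rho < 1 -> exists K r : R, [/\ 0 <= K, rho < r &
    forall N w, cabs w <= rho ->
      cabs (F w - \sum_(n < N) a n * w ^+ n) <= K * (cabs w / r) ^+ N].

Lemma coef_unique (a b : nat -> R[i]) :
  (forall N, exists K d : R, 0 < d /\ forall w, cabs w < d ->
     cabs (\sum_(n < N) a n * w ^+ n - \sum_(n < N) b n * w ^+ n) <= K * cabs w ^+ N) ->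
  forall n, a n = b n.
Proof.
move=> h n; elim/ltn_ind: n => n IH.
have [K [d [d0 hd]]] := h n.+1.
apply/eqP; rewrite -subr_eq0; apply/eqP; apply: cabs_small_eq0 => e e0.
have K1 : 0 < `|K| + 1 by rewrite ltr_wpDl.
pose t := Num.min (d / 2) (e / (`|K| + 1)).
have t0 : 0 < t by rewrite lt_min !divr_gt0.
have td : t < d.
  by rewrite (@le_lt_trans _ _ (d / 2)) ?ge_min ?lexx// ltr_pdivrMr// ltr_pMr// ltr1n.
have te : t <= e / (`|K| + 1) by rewrite ge_min lexx orbT.
have ct : cabs (t%:C%C) = t :> R by rewrite cabs_real gtr0_norm.
have := hd t%:C%C; rewrite ct => /(_ td).
rewrite !big_ord_recr /=.
rewrite (eq_bigr (fun i : 'I_n => b i * t%:C%C ^+ i)); last by move=> i _; rewrite IH.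
set S := \sum_(i < n) _.
have -> : S + a n * t%:C%C ^+ n - (S + b n * t%:C%C ^+ n) = (a n - b n) * t%:C%C ^+ n.
  by ring.
rewrite cabsM cabsX ct exprSr mulrA mulrAC ler_pM2r ?exprn_gt0// => /le_trans; apply.
rewrite (@le_trans _ _ ((`|K| + 1) * t))//.
  by rewrite ler_pM2r// (le_trans (ler_norm _))// lerDl.
by rewrite mulrC -ler_pdivlMr.
Qed.

Lemma taylor_exists (F : R[i] -> R[i]) : analytic_on_D F ->
  exists a, taylor_on_D a F /\ forall (r M : R) n, 0 < r -> r < 1 ->
    (forall z, cabs z = r -> cabs (F z) <= M) -> cabs (a n) * r ^+ n <= 2 * M.
Proof.
move=> aF.
have tay r : 0 < r -> r < 1 -> exists2 K, 0 <= K & forall rho, rho < r ->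
    forall N w, cabs w <= rho ->
      cabs (F w - \sum_(n < N) cauchy_coef F r n * w ^+ n) <=
      K / (r - rho) * (cabs w / r) ^+ N.
  move=> r0 r1; have [M FM] := bounded_circ aF r0 r1.
  have M0 : 0 <= M.
    by rewrite (le_trans (cabs_ge0 _) (FM 0 _))// lexx mulr_ge0// pi_ge0.
  exists (2 * M * r) => [|rho rr N w wr]; first by rewrite !mulr_ge0// ltW.
  rewrite (le_trans (cauchy_taylor aF N r0 r1 (le_lt_trans wr rr) FM))//.
  rewrite -!mulrA ler_wpM2l// ler_wpM2l// mulrCA ler_wpM2l ?(ltW r0)//.
  rewrite mulrC ler_wpM2r ?exprn_ge0 ?divr_ge0 ?cabs_ge0 ?(ltW r0)//.
  have := le_lt_trans wr rr => wr'.
  by rewrite lef_pV2 ?posrE ?subr_gt0// lerB.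
have half0 : 0 < 2^-1 :> R by rewrite invr_gt0.
have half1 : 2^-1 < 1 :> R by rewrite invf_lt1// ltr1n.
have uniq r : 0 < r -> r < 1 -> forall n, cauchy_coef F r n = cauchy_coef F 2^-1 n.
  move=> r0 r1; apply: coef_unique => N.
  have [K1 K10 h1] := tay _ r0 r1; have [K2 K20 h2] := tay _ half0 half1.
  pose d := Num.min (r / 2) (2^-1 / 2).
  have d0 : 0 < d by rewrite lt_min !divr_gt0.
  have dr : d < r.
    by rewrite (@le_lt_trans _ _ (r / 2)) ?ge_min ?lexx// ltr_pdivrMr// ltr_pMr// ltr1n.
  have dh : d < 2^-1.
    rewrite (@le_lt_trans _ _ (2^-1 / 2)) ?ge_min ?lexx ?orbT//.
    by rewrite ltr_pdivrMr// ltr_pMr// ltr1n.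
  exists (K1 / (r - d) / r ^+ N + K2 / (2^-1 - d) / 2^-1 ^+ N), d; split=> // w /ltW wd.
  have -> (A B : R[i]) : A - B = (F w - B) - (F w - A) by ring.
  rewrite (le_trans (cabsB _ _))// addrC mulrDl.
  have g1 := h1 _ dr N _ wd; have g2 := h2 _ dh N _ wd.
  rewrite lerD//.
    by rewrite (le_trans g1)// expr_div_n mulrA mulrAC.
  by rewrite (le_trans g2)// expr_div_n mulrA mulrAC.
exists (cauchy_coef F 2^-1); split.
  move=> rho rho0 rho1.
  have [r [r0 r1 rr]] : exists r : R, [/\ 0 < r, r < 1 & rho < r].
    by exists ((1 + rho) / 2); split; lra.
  have [K K0 h] := tay _ r0 r1.
  have ec : cauchy_coef F r = cauchy_coef F 2^-1 by apply/funext; exact: uniq.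
  have Kr : 0 <= K / (r - rho).
    by apply: divr_ge0; [exact: K0|rewrite subr_ge0; exact: (ltW rr)].
  move: h; rewrite ec => h.
  by exists (K / (r - rho)), r; split; [exact: Kr|exact: rr|exact: (h _ rr)].
move=> r M n r0 r1 FM; rewrite -(uniq _ r0 r1).
by apply: cauchy_coef_bound => // s _; apply: FM; exact: cabs_circ.
Qed.

Lemma taylor_zero (a : nat -> R[i]) F : taylor_on_D a F -> (forall n, a n = 0) ->
  forall z, cabs z < 1 -> F z = 0.
Proof.
move=> ta a0 z z1; apply: cabs_small_eq0 => e e0.
pose rho := (1 + cabs z) / 2.
have z0 := cabs_ge0 z.
have rho0 : 0 < rho by rewrite /rho; lra.
have rho1 : rho < 1 by rewrite /rho; lra.
have [K [r [K0 rr h]]] := ta _ rho0 rho1.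
have r0 : 0 < r by apply: lt_trans rr.
have zr : cabs z <= rho by rewrite /rho; lra.
have q1 : cabs z / r < 1 by rewrite ltr_pdivrMr// mul1r (le_lt_trans zr).
have q0 : 0 <= cabs z / r by rewrite divr_ge0// ltW.
have [N0 hN] := geometric_small K q0 q1 e0.
have := h N0 z zr; rewrite big1 ?subr0; last by move=> i _; rewrite a0 mul0r.
by move=> /le_trans; apply; exact: hN.
Qed.

Lemma taylor_lowest (a : nat -> R[i]) F m : taylor_on_D a F ->
  (forall n, (n < m)%N -> a n = 0) -> a m != 0 ->
  exists2 d : R, 0 < d & forall z, z != 0 -> cabs z < d -> F z != 0.
Proof.
move=> ta am am0.
have half0 : 0 < 2^-1 :> R by rewrite invr_gt0.
have half1 : 2^-1 < 1 :> R by rewrite invf_lt1// ltr1n.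
have [K [r [K0 rr h]]] := ta _ half0 half1.
have r0 : 0 < r by apply: lt_trans rr.
pose B := K / r ^+ m.+1 + 1.
have B0 : 0 < B by rewrite ltr_wpDl// divr_ge0// exprn_ge0// ltW.
have cam : 0 < cabs (a m) by rewrite cabs_gt0.
exists (Num.min 2^-1 (cabs (a m) / B)); first by rewrite lt_min half0 divr_gt0.
move=> z z0; rewrite lt_min => /andP[/ltW zh zB].
apply/eqP => Fz; have := h m.+1 z zh.
rewrite Fz sub0r cabsN big_ord_recr /= big1 ?add0r; last first.
  by move=> i _; rewrite am ?mul0r.
have cz := cabs_gt0 z0.
rewrite cabsM cabsX expr_div_n.
have -> : K * (cabs z ^+ m.+1 / r ^+ m.+1) = K / r ^+ m.+1 * cabs z * cabs z ^+ m.
  by rewrite [cabs z ^+ m.+1]exprSr; ring.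
rewrite ler_pM2r ?exprn_gt0//.
move: zB; rewrite ltr_pdivlMr// => zB; apply/negP; rewrite -ltNge (le_lt_trans _ zB)//.
by rewrite mulrC ler_wpM2l ?cabs_ge0// /B lerDl.
Qed.

Lemma analytic_nonzero_near0 (F : R[i] -> R[i]) : analytic_on_D F ->
  ~ (forall z, cabs z < 1 -> F z = 0) ->
  exists2 d : R, 0 < d & forall z, z != 0 -> cabs z < d -> F z != 0.
Proof.
move=> aF nF; have [a [ta _]] := taylor_exists aF.
have : exists n, a n != 0.
  apply: contrapT => hn; apply: nF; apply: taylor_zero ta _ => n.
  by apply: contrapT => an; apply: hn; exists n; apply/eqP.
move=> ex; case: (ex_minnP ex) => m am hm.
apply: (taylor_lowest ta _ am) => n nm; apply/eqP.
by apply: contraTT nm => an; rewrite -leqNgt; exact: hm.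
Qed.

End Taylor.

(** * Planar Lebesgue measure and moments of the weight *)

Section PlanarLebesgue.
Variable R : realType.
Notation mu := (@lebesgue_measure R).
Local Notation plane := (measurableTypeR R * measurableTypeR R)%type.
Local Notation pushm m mf :=
  (measure_function_pushforward__canonical__measure_function_Measure m mf).

Lemma lebesgue_measure_affine (s t : R) (s0 : 0 < s) (A : set R) : measurable A ->
  mu ((fun y => s * y + t) @^-1` A) = (s^-1%:E * mu A)%E.
Proof.
move=> mA.
pose f := (fun y => s * y + t) : measurableTypeR R -> measurableTypeR R.
have mf : measurable_fun setT f.
  by apply: measurable_funD => //; apply: measurable_funM.
pose p : {measure set (measurableTypeR R) -> \bar R} := pushm mu mf.
pose m' : {measure set (measurableTypeR R) -> \bar R} := mscale (NngNum (ltW s0)) p.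
have h : mu A = m' A.
  apply: lebesgue_measure_unique => // _ [[a b] _ <-] /=.
  rewrite /m' /p /mscale /= /pushforward.
  have -> : f @^-1` `]a, b] = `](a - t) / s, (b - t) / s].
    apply/seteqP; split => y; rewrite /= !in_itv /= /f.
    by move=> /andP[h1 h2]; rewrite ltr_pdivrMr// ler_pdivlMr//; apply/andP; split; lra.
    by rewrite ltr_pdivrMr// ler_pdivlMr// => /andP[h1 h2]; apply/andP; split; lra.
  rewrite !lebesgue_measure_itv /= !lte_fin ltr_pM2r ?invr_gt0// ltrD2r.
  case: ifPn => _; rewrite ?mule0//.
  by rewrite -!EFinB -EFinM; congr EFin; field; rewrite gt_eqF.
by rewrite h /m' /p /mscale /= /pushforward muleA -EFinM mulVf ?gt_eqF// mul1e.
Qed.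

Lemma lebesgue_measure_shift (t : R) (A : set R) : measurable A ->
  mu ((fun y => y + t) @^-1` A) = mu A.
Proof.
move=> mA; have := lebesgue_measure_affine t ltr01 mA.
rewrite invr1 mul1e => <-; congr (mu _).
by apply/seteqP; split => y /=; rewrite mul1r.
Qed.

Definition leb2_preserving (T : plane -> plane) :=
  measurable_fun setT T /\ forall A : set plane, measurable A -> leb2 (T @^-1` A) = leb2 A.

Lemma leb2_preserving_comp S T : leb2_preserving S -> leb2_preserving T ->
  leb2_preserving (S \o T).
Proof.
move=> [mS iS] [mT iT]; split; first exact: measurableT_comp.
move=> A mA; rewrite comp_preimage iT ?iS//.
by rewrite -[X in measurable X]setTI; exact: mS.
Qed.

Lemma leb2_preserving_shear (c : R) : leb2_preserving (fun p : plane => (p.1, p.2 + c * p.1)).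
Proof.
split.
  apply: measurable_fun_pair => //; apply: measurable_funD => //.
  exact: measurable_funM.
move=> A mA; rewrite /leb2 /product_measure1; apply: eq_integral => x _ /=.
have -> : xsection ((fun p : plane => (p.1, p.2 + c * p.1)) @^-1` A) x =
    (fun y => y + c * x) @^-1` (xsection A x).
  by apply/seteqP; split => y; rewrite /xsection /= !inE.
by apply: lebesgue_measure_shift; exact: measurable_xsection.
Qed.

Lemma leb2_preserving_swap : leb2_preserving (fun p : plane => (p.2, p.1)).
Proof.
have mT : measurable_fun [set: plane] (fun p : plane => (p.2, p.1)).
  exact: measurable_fun_pair.
split=> // A mA; apply/esym.
pose m' : {measure set plane -> \bar R} := pushm (mu \x mu)%E mT.
suff h : leb2 A = m' A by exact: h.
rewrite /leb2; apply: (@product_measure_unique _ _ _ _ _ mu mu m') => // B1 B2 mB1 mB2.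
rewrite /m' /= /pushforward.
have -> : (fun p : plane => (p.2, p.1)) @^-1` (B1 `*` B2) = B2 `*` B1.
  by apply/seteqP; split => -[x y] /= [].
by rewrite product_measure1E// muleC.
Qed.

(* A rotation is a product of three shears. *)
Lemma leb2_preserving_rot (c s : R) : c ^+ 2 + s ^+ 2 = 1 -> s != 0 ->
  leb2_preserving (fun p : plane => (c * p.1 - s * p.2, s * p.1 + c * p.2)).
Proof.
move=> cs s0.
have sx a : leb2_preserving (fun p : plane => (p.1 + a * p.2, p.2)).
  have := leb2_preserving_comp leb2_preserving_swap
    (leb2_preserving_comp (leb2_preserving_shear a) leb2_preserving_swap).
  by congr leb2_preserving.
have := leb2_preserving_comp (sx ((c - 1) / s))
  (leb2_preserving_comp (leb2_preserving_shear s) (sx ((c - 1) / s))).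
congr leb2_preserving; apply/funext => -[x y] /=.
have s2 : s ^+ 2 = 1 - c ^+ 2 by rewrite -cs addrAC subrr add0r.
have yE : y + s * (x + (c - 1) / s * y) = s * x + c * y by field.
rewrite yE; congr (_, _).
apply: (mulfI s0); transitivity (s * c * x - s ^+ 2 * y); last by ring.
by rewrite s2; field.
Qed.

Lemma leb2_scale (s : R) (s0 : 0 < s) (A : set plane) : measurable A ->
  leb2 ((fun p : plane => (s * p.1, s * p.2) : plane) @^-1` A) = ((s ^- 2)%:E * leb2 A)%E.
Proof.
move=> mA.
have mT : measurable_fun [set: plane] (fun p : plane => (s * p.1, s * p.2) : plane).
  by apply: measurable_fun_pair; apply: measurable_funM.
pose p : {measure set plane -> \bar R} := pushm (mu \x mu)%E mT.
pose m' : {measure set plane -> \bar R} := mscale (NngNum (ltW (exprn_gt0 2 s0))) p.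
have h : leb2 A = m' A.
  rewrite /leb2; apply: (@product_measure_unique _ _ _ _ _ mu mu m') => // B1 B2 mB1 mB2.
  rewrite /m' /p /mscale /= /pushforward.
  pose U (B : set (measurableTypeR R)) : set (measurableTypeR R) :=
    (fun y => s * y + 0) @^-1` B.
  transitivity ((s ^+ 2)%:E * (mu \x mu) (U B1 `*` U B2))%E.
    congr (_ * _)%E; congr (product_measure1 _ _ _).
    by apply/seteqP; split => -[x y] /= []; rewrite /U /= !addr0.
  have mB (B : set (measurableTypeR R)) : measurable B -> measurable (U B).
    move=> mB; rewrite -[X in measurable X]setTI.
    have : measurable_fun setT (fun y : measurableTypeR R => s * y + 0).
      by apply: measurable_funD => //; apply: measurable_funM.
    by apply.
  rewrite product_measure1E//; [|exact: mB|exact: mB].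
  have muU B : measurable B -> mu (U B) = (s^-1%:E * mu B)%E.
    exact: lebesgue_measure_affine.
  rewrite [X in (_ * (X * _))%E](muU _ mB1) [X in (_ * (_ * X))%E](muU _ mB2) muleACA -EFinM.
  by rewrite !muleA -EFinM (_ : s ^+ 2 * (s^-1 * s^-1) = 1) ?mul1e//; field; rewrite gt_eqF.
rewrite h /m' /p /mscale /= /pushforward muleA -EFinM mulVf ?mul1e//.
by rewrite expf_neq0// gt_eqF.
Qed.

Lemma measurable_sqnorm : measurable_fun setT (fun p : plane => p.1 ^+ 2 + p.2 ^+ 2).
Proof. by apply: measurable_funD; apply: measurable_funX. Qed.

Lemma measurable_disc (s : R) : measurable [set p : plane | p.1 ^+ 2 + p.2 ^+ 2 < s].
Proof.
rewrite -[X in measurable X]setTI.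
exact: (@measurable_sqnorm measurableT `]-oo, s[ (measurable_itv _)).
Qed.

Lemma leb2_disc (s : R) : 0 < s ->
  leb2 [set p : plane | p.1 ^+ 2 + p.2 ^+ 2 < s] = (s%:E * leb2 (@Dset R : set plane))%E.
Proof.
move=> s0; pose q := Num.sqrt s.
have q0 : 0 < q by rewrite sqrtr_gt0.
have q2 : q ^+ 2 = s by rewrite sqr_sqrtr// ltW.
have := leb2_scale q0 (measurable_disc s).
have -> : (fun p : plane => (q * p.1, q * p.2) : plane) @^-1`
    [set p | p.1 ^+ 2 + p.2 ^+ 2 < s] = (@Dset R : set plane).
  apply/seteqP; split => -[x y] /=; rewrite /Dset/=.
    by rewrite !exprMn -mulrDr q2 gtr_pMr.
  by move=> h; rewrite !exprMn -mulrDr q2 gtr_pMr.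
rewrite q2 => ->; rewrite muleA -EFinM mulfV ?mul1e// gt_eqF//.
Qed.

Lemma measurable_Dset : measurable (@Dset R : set plane).
Proof. exact: measurable_disc. Qed.

Lemma leb2_box (a b : R) : a <= b ->
  leb2 (`[a, b] `*` `[a, b] : set plane) = ((b - a) ^+ 2)%:E.
Proof.
move=> ab; have lm : mu `[a, b] = (b - a)%:E.
  rewrite lebesgue_measure_itv/= lte_fin.
  by case: ltP => [_|ba]; rewrite -?EFinB//; congr EFin; lra.
rewrite /leb2 product_measure1E// [X in (X * _)%E]lm [X in (_ * X)%E]lm.
by rewrite -EFinM expr2.
Qed.

Lemma leb2_Dset_fin : (leb2 (@Dset R : set plane) < +oo)%E.
Proof.
apply: (@le_lt_trans _ _ (leb2 (`[-1, 1] `*` `[-1, 1] : set plane))).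
  apply: le_measure; rewrite ?inE; [exact: measurable_Dset|exact: measurableX|].
  move=> [x y]; rewrite /Dset/= !in_itv/= => h.
  by split; rewrite -ler_norml -(@expr_le1 _ 2)// ?real_normK ?num_real//;
    have := sqr_ge0 x; have := sqr_ge0 y; lra.
by rewrite leb2_box ?ltry//; lra.
Qed.

Lemma leb2_Dset_gt0 : (0 < leb2 (@Dset R : set plane))%E.
Proof.
apply: (@lt_le_trans _ _ (leb2 (`[0, 2^-1] `*` `[0, 2^-1] : set plane))).
  by rewrite leb2_box ?invr_ge0// lte_fin subr0 exprn_gt0// invr_gt0.
apply: le_measure; rewrite ?inE; [exact: measurableX|exact: measurable_Dset|].
move=> [x y]; rewrite /Dset/= !in_itv/= => -[/andP[x0 x1] /andP[y0 y1]].
have hx : x ^+ 2 <= 2^-1 ^+ 2 by rewrite ler_pXn2r ?nnegrE// invr_ge0.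
have hy : y ^+ 2 <= 2^-1 ^+ 2 by rewrite ler_pXn2r ?nnegrE// invr_ge0.
have h4 : 2^-1 ^+ 2 = 4^-1 :> R by field.
by rewrite h4 in hx hy; rewrite (le_lt_trans (lerD hx hy))//; lra.
Qed.

End PlanarLebesgue.

Section BetaWeight.
Variable R : realType.
Notation mu := (@lebesgue_measure R).
Local Notation RR := (measurableTypeR R).
Local Notation pushm m mf :=
  (measure_function_pushforward__canonical__measure_function_Measure m mf).
Variable alpha : R.
Hypothesis halpha : -1 < alpha.

Definition betaw (n : nat) (u : R) : R := u ^+ n * (1 - u) `^ alpha.

Lemma measurable_onem_powR (D : set RR) : measurable_fun D (fun u : RR => (1 - u) `^ alpha).
Proof.
apply: (@measurableT_comp _ _ _ _ _ _ (@powR R ^~ alpha)).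
  exact: measurable_powR.
by apply: measurable_funB.
Qed.

Lemma measurable_betaw n (D : set RR) : measurable_fun D (fun u : RR => betaw n u).
Proof. by apply: measurable_funM; [exact: measurable_funX|exact: measurable_onem_powR]. Qed.

Lemma betaw_ge0 n u : 0 <= u -> 0 <= betaw n u.
Proof. by move=> u0; rewrite mulr_ge0 ?exprn_ge0 ?powR_ge0. Qed.

(* The substitution u |-> (1 + u) / 2 halves 1 - u. *)
Lemma integral_half (a b : R) (h : RR -> R) : measurable_fun setT h ->
  (forall u, 0 <= h u) ->
  (\int[mu]_(v in `[(2^-1 * a + 2^-1)%R, (2^-1 * b + 2^-1)%R[) (h v)%:E =
   2^-1%:E * \int[mu]_(u in `[a, b[) (h (2^-1 * u + 2^-1)%R)%:E)%E.
Proof.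
move=> mh h0.
have half0 : 0 < 2^-1 :> R by rewrite invr_gt0.
pose f := (fun y => 2^-1 * y + 2^-1) : RR -> RR.
have mf : measurable_fun setT f.
  by apply: measurable_funD => //; apply: measurable_funM.
pose p : {measure set RR -> \bar R} := pushm mu mf.
pose m' : {measure set RR -> \bar R} := mscale (NngNum (ltW half0)) p.
have mE A : measurable A -> mu A = m' A.
  move=> mA; have fA : mu (f @^-1` A) = (2^-1^-1%:E * mu A)%E by exact: lebesgue_measure_affine.
  have -> : m' A = (2^-1%:E * mu (f @^-1` A))%E by [].
  by rewrite fA muleA -EFinM mulfV ?mul1e// gt_eqF.
transitivity (\int[m']_(v in `[(2^-1 * a + 2^-1)%R, (2^-1 * b + 2^-1)%R[) (h v)%:E)%E.
  by apply: eq_measure_integral => A mA _; exact: mE.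
have mhE (D : set RR) : measurable_fun D (fun x => (h x)%:E).
  by apply/measurable_EFinP; exact: measurable_funS mh.
rewrite ge0_integral_mscale//=; last by move=> u _; rewrite lee_fin.
congr (_ * _)%E; rewrite ge0_integral_pushforward//; last by move=> u _; rewrite lee_fin.
rewrite (_ : f @^-1` _ = `[a, b[)//.
by apply/seteqP; split => u; rewrite /= !in_itv/= /f lerD2r ltrD2r ler_pM2l// ltr_pM2l.
Qed.

Lemma half_powR (u : R) : u <= 1 ->
  (1 - (2^-1 * u + 2^-1)) `^ alpha = 2^-1 `^ alpha * (1 - u) `^ alpha.
Proof.
move=> u1; rewrite -powRM ?invr_ge0// ?subr_ge0//; congr (_ `^ _).
by field.
Qed.

Lemma half_powR_lt1 : 2^-1 * 2^-1 `^ alpha < 1.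
Proof.
have h : 2^-1 != 0 :> R by rewrite invr_eq0.
rewrite -{1}(@powRr1 _ 2^-1) ?invr_ge0// -powRD ?h ?implybT//.
have e1 : 1 `^ (1 + alpha) = 1 :> R by rewrite powR1.
rewrite -[ltRHS]e1; have a1 : 0 < 1 + alpha by have := halpha; lra.
by apply: gt0_ltr_powR => //; rewrite ?nnegrE ?invr_ge0 ?invf_lt1 ?ltr1n.
Qed.

Let mEFin n (D : set RR) : measurable_fun D (fun u : RR => (betaw n u)%:E).
Proof. by apply/measurable_EFinP; exact: measurable_betaw. Qed.

Let mb (D : set RR) : measurable_fun D (fun u : RR => ((1 - u) `^ alpha)%:E).
Proof. by apply/measurable_EFinP; exact: measurable_onem_powR. Qed.

Lemma onem_powR_bound (u : R) : 0 <= u -> u <= 2^-1 ->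
  (1 - u) `^ alpha <= 1 + 2^-1 `^ alpha.
Proof.
move=> u0 u2.
have [a0|a0] := leP 0 alpha.
  have e1 : 1 `^ alpha = 1 :> R by rewrite powR1.
  rewrite (@le_trans _ _ 1) ?lerDl ?powR_ge0// -[leRHS]e1.
  by apply: ge0_ler_powR; rewrite ?nnegrE//; lra.
rewrite (@le_trans _ _ (2^-1 `^ alpha)) ?lerDr//.
rewrite -(opprK alpha) !(powRN _ (- alpha)) lef_pV2 ?posrE ?powR_gt0//; last lra.
by apply: ge0_ler_powR; rewrite ?nnegrE//; lra.
Qed.

Lemma integral_onem_powR_fin : (\int[mu]_(u in `[0%R, 1%R[) ((1 - u) `^ alpha)%:E < +oo)%E.
Proof.
pose b k : R := 1 - 2^-1 ^+ k.
pose J k : \bar R := (\int[mu]_(u in `[0%R, b k[) ((1 - u) `^ alpha)%:E)%E.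
pose q : R := 2^-1 * 2^-1 `^ alpha.
have q1 : q < 1 by exact: half_powR_lt1.
have q0 : 0 <= q by rewrite mulr_ge0 ?powR_ge0// invr_ge0.
pose A : R := 1 + 2^-1 `^ alpha.
have A0 : 0 <= A by rewrite addr_ge0 ?powR_ge0.
have pk k : 0 < 2^-1 ^+ k :> R by rewrite exprn_gt0// invr_gt0.
have pk1 k : 2^-1 ^+ k <= 1 :> R by rewrite exprn_ile1 ?invr_ge0// invf_le1// ler1n.
have hJ k : (J k <= (A / (1 - q))%:E)%E.
  elim: k => [|k IH].
    rewrite /J /b expr0 subrr set_itvco0 integral_set0 lee_fin divr_ge0//.
    by rewrite subr_ge0 ltW.
  have hb : 2^-1 <= b k.+1.
    by rewrite /b exprS; have := pk1 k; lra.
  have -> : J k.+1 = (\int[mu]_(u in `[0%R, 2^-1%R[) ((1 - u) `^ alpha)%:E +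
      \int[mu]_(u in `[2^-1%R, b k.+1[) ((1 - u) `^ alpha)%:E)%E.
    rewrite -ge0_integral_setU//.
    - congr integral; rewrite -itv_bndbnd_setU ?bnd_simp ?invr_ge0//.
    - by move=> u _; rewrite lee_fin powR_ge0.
    - apply/disj_set2P/seteqP; split => // u [] /=; rewrite !in_itv/= => /andP[_ h1] /andP[h2 _].
      by move: h1; rewrite ltNge h2.
  have h1 : (\int[mu]_(u in `[0%R, 2^-1%R[) ((1 - u) `^ alpha)%:E <= A%:E)%E.
    apply: (@le_trans _ _ (\int[mu]_(u in `[0%R, 2^-1%R[) (cst A%:E u))%E).
      apply: ge0_le_integral => //=.
      - by move=> u _; rewrite lee_fin powR_ge0.
      - move=> u; rewrite in_itv/= => /andP[u0 /ltW u2]; rewrite lee_fin.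
        exact: onem_powR_bound.
    rewrite integral_cst// [X in (_ * X)%E]lebesgue_measure_itv/= lte_fin invr_gt0 ltr0n.
    rewrite -EFinB -EFinM lee_fin subr0 ler_piMr//.
    by rewrite invf_le1// ler1n.
  have -> : (\int[mu]_(u in `[2^-1%R, b k.+1[) ((1 - u) `^ alpha)%:E = q%:E * J k)%E.
    have eb : b k.+1 = 2^-1 * b k + 2^-1 by rewrite /b exprS; field.
    have e0 : 2^-1 = 2^-1 * 0 + 2^-1 :> R by rewrite mulr0 add0r.
    rewrite eb {1}e0 (@integral_half 0 (b k) (fun u => (1 - u) `^ alpha)
      (@measurable_onem_powR _) (fun u => powR_ge0 _ _)).
    rewrite /q EFinM -muleA; congr (_ * _)%E.
    rewrite -ge0_integralZl_EFin ?powR_ge0//; last first.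
      by move=> u _; rewrite lee_fin powR_ge0.
    apply: eq_integral => u; rewrite inE/= in_itv/= => /andP[_ ub].
    by rewrite -EFinM half_powR// (le_trans (ltW ub))// /b gerBl ltW.
  apply: (@le_trans _ _ (A%:E + q%:E * (A / (1 - q))%:E)%E).
    by apply: leeD => //; apply: lee_wpmul2l.
  rewrite -EFinM -EFinD lee_fin le_eqVlt; apply/orP; left; apply/eqP.
  by field; rewrite subr_eq0 gt_eqF.
have -> : `[0, 1[ = \bigcup_k `[0, b k[ :> set RR.
  apply/seteqP; split => u /=; last first.
    move=> [k _] /=; rewrite !in_itv/= => /andP[-> ub].
    by rewrite (lt_trans ub)// /b gtrBl.
  rewrite in_itv/= => /andP[u0 u1].
  have g0 : 0 <= 2^-1 :> R by rewrite invr_ge0.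
  have g1 : 2^-1 < 1 :> R by rewrite invf_lt1// ltr1n.
  have g2 : 0 < (1 - u) / 2 by rewrite divr_gt0// subr_gt0.
  have [N hN] := geometric_small 1 g0 g1 g2.
  exists N => //=; rewrite in_itv/= u0 /b/=.
  by have := hN N (leqnn N); rewrite mul1r; lra.
apply: (@le_lt_trans _ _ (A / (1 - q))%:E); last exact: ltry.
have ndb : nondecreasing_seq (fun k => `[0, b k[%classic : set RR).
  apply/nondecreasing_seqP => k; apply/subsetPset => u /=; rewrite !in_itv/=.
  move=> /andP[-> ub]; rewrite (lt_le_trans ub)// /b lerB// exprS.
  by have := pk k; lra.
have cv := @ge0_nondecreasing_set_cvg_integral _ RR R (fun k => `[0, b k[%classic : set RR)
  (fun u => ((1 - u) `^ alpha)%:E) mu ndb (fun i => measurable_itv _)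
  (fun i => @mb _) (fun i u _ => powR_ge0 _ _).
by apply: (cvge_le _ cv); apply: nearW => k; exact: hJ.
Qed.

Lemma integral_betaw_fin n : (\int[mu]_(u in `[0%R, 1%R[) (betaw n u)%:E < +oo)%E.
Proof.
apply: le_lt_trans integral_onem_powR_fin; apply: ge0_le_integral => //=.
- by move=> u; rewrite in_itv/= => /andP[u0 _]; rewrite lee_fin betaw_ge0.
- move=> u; rewrite in_itv/= => /andP[u0 u1]; rewrite lee_fin.
  by rewrite ler_piMl ?powR_ge0// exprn_ile1// ltW.
Qed.

(* (1 + u)^2 / 4 >= u turns the exponent 2 n + 1 after substitution back into n. *)
Lemma integral_betaw_doubling n :
  ((2^-1 * 2^-1 `^ alpha * 2^-1)%:E * \int[mu]_(u in `[0%R, 1%R[) (betaw n u)%:E <=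
   \int[mu]_(u in `[0%R, 1%R[) (betaw (n.*2.+1) u)%:E)%E.
Proof.
pose h (u : RR) : R := `|u| ^+ n.*2.+1 * (1 - u) `^ alpha.
have h0 u : 0 <= h u by rewrite /h mulr_ge0 ?exprn_ge0 ?powR_ge0.
have mh : measurable_fun setT h.
  apply: measurable_funM; last exact: measurable_onem_powR.
  by apply: measurable_funX; exact: normr_measurable.
have mhE (D : set RR) : measurable_fun D (fun x => (h x)%:E).
  by apply/measurable_EFinP; exact: measurable_funS mh.
have -> : (\int[mu]_(u in `[0%R, 1%R[) (betaw (n.*2.+1) u)%:E =
    \int[mu]_(u in `[0%R, 1%R[) (h u)%:E)%E.
  apply: eq_integral => u; rewrite inE/= in_itv/= => /andP[u0 _].
  by rewrite /h ger0_norm.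
apply: (@le_trans _ _ (\int[mu]_(u in `[(2^-1 * 0 + 2^-1)%R, (2^-1 * 1 + 2^-1)%R[) (h u)%:E)%E); last first.
  apply: ge0_subset_integral => //.
    by move=> u _; rewrite lee_fin.
  move=> u /=; rewrite !in_itv/= mulr0 mulr1 => /andP[h1 h2].
  by apply/andP; split; lra.
rewrite (integral_half 0 1 mh h0) -[X in (X%:E * _)%E]mulrA EFinM -muleA; apply: lee_wpmul2l.
  by rewrite lee_fin invr_ge0.
have k0 : 0 <= 2^-1 `^ alpha * 2^-1 by rewrite mulr_ge0 ?powR_ge0// invr_ge0.
rewrite -ge0_integralZl_EFin//; last first.
  by move=> u; rewrite /= in_itv/= => /andP[u0 _]; rewrite lee_fin betaw_ge0.
apply: ge0_le_integral => //=.
- move=> u; rewrite in_itv/= => /andP[u0 _].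
  by rewrite lee_fin mulr_ge0 ?betaw_ge0// mulr_ge0 ?powR_ge0// invr_ge0.
- by apply/measurable_EFinP; apply: measurable_funM => //; exact: measurable_betaw.
- apply/measurable_EFinP.
  have := @measurableT_comp _ _ _ RR RR R h setT (fun y : RR => 2^-1 * y + 2^-1 : RR) mh.
  move=> hh; apply: measurable_funS (hh _) => //.
  by apply: measurable_funD => //; apply: measurable_funM.
- move=> u; rewrite in_itv/= => /andP[u0 u1]; rewrite -?EFinM lee_fin /h /betaw (half_powR (ltW u1)).
  have -> : 2^-1 `^ alpha * 2^-1 * (u ^+ n * (1 - u) `^ alpha) =
    (2^-1 * u ^+ n) * (2^-1 `^ alpha * (1 - u) `^ alpha) by ring.
  rewrite ler_wpM2r ?mulr_ge0 ?powR_ge0//.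
  rewrite ger0_norm; last by lra.
  rewrite exprS ler_pM ?invr_ge0 ?exprn_ge0//; first by lra.
  rewrite -muln2 mulnC exprM lerXn2r ?nnegrE ?sqr_ge0//.
  have : 0 <= (u - 1) ^+ 2 by exact: sqr_ge0.
  rewrite !expr2; lra.
Qed.

End BetaWeight.

Section RadialLaw.
Variable R : realType.
Notation mu := (@lebesgue_measure R).
Local Notation RR := (measurableTypeR R).
Local Notation plane := (measurableTypeR R * measurableTypeR R)%type.
Local Notation pushm m mf :=
  (measure_function_pushforward__canonical__measure_function_Measure m mf).

Definition sqnorm (p : plane) : R := p.1 ^+ 2 + p.2 ^+ 2.

Lemma sqnorm_ge0 p : 0 <= sqnorm p.
Proof. by rewrite addr_ge0 ?sqr_ge0. Qed.

Lemma measurable_sqnormRR : measurable_fun setT (sqnorm : plane -> RR).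
Proof. exact: measurable_sqnorm. Qed.

Definition disc_area : R := fine (leb2 (@Dset R : set plane)).

Lemma disc_areaE : leb2 (@Dset R : set plane) = disc_area%:E.
Proof. by rewrite /disc_area fineK// ge0_fin_numE ?leb2_Dset_fin// ltW// leb2_Dset_gt0. Qed.

Lemma disc_area_gt0 : 0 < disc_area.
Proof. by rewrite -lte_fin -disc_areaE leb2_Dset_gt0. Qed.

Lemma measurable_cdisc (s : R) : measurable [set p : plane | sqnorm p <= s].
Proof.
rewrite -[X in measurable X]setTI.
exact: (@measurable_sqnorm R measurableT `]-oo, s] (measurable_itv _)).
Qed.

Let leb2m : {measure set plane -> \bar R} := (mu \x mu)%E.

Let leb2_set0 : leb2 (set0 : set plane) = 0%E.
Proof. exact: (measure0 leb2m). Qed.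

Let leb2_ge0 (A : set plane) : (0 <= leb2 A)%E.
Proof. exact: (measure_ge0 leb2m). Qed.

Lemma leb2_cdisc (s : R) :
  leb2 [set p : plane | sqnorm p <= s] = (disc_area * Num.max s 0)%:E.
Proof.
have [s0|s0] := ltP s 0.
  rewrite mulr0 (_ : [set _ | _] = set0) ?leb2_set0//.
  apply/seteqP; split => p //=; rewrite leNgt => /negP; apply.
  by rewrite (lt_le_trans s0) ?sqnorm_ge0.
apply/eqP; rewrite eq_le; apply/andP; split.
  apply/lee_addgt0Pr => e e0; pose e' := e / disc_area.
  have e'0 : 0 < e' by rewrite divr_gt0// disc_area_gt0.
  apply: (@le_trans _ _ (leb2 [set p : plane | p.1 ^+ 2 + p.2 ^+ 2 < s + e'])).
    apply: le_measure; rewrite ?inE; [exact: measurable_cdisc|exact: measurable_disc|].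
    by move=> p /= ps; rewrite (le_lt_trans ps)// ltrDl.
  rewrite leb2_disc ?disc_areaE ?ltr_wpDl// -EFinM -EFinD lee_fin mulrDl mulrC lerD2l.
  by rewrite /e' divfK// gt_eqF// disc_area_gt0.
have [->|sn0] := eqVneq s 0; first by rewrite mulr0 leb2_ge0.
have {}s0 : 0 < s by rewrite lt_neqAle eq_sym sn0.
apply: (@le_trans _ _ (leb2 [set p : plane | p.1 ^+ 2 + p.2 ^+ 2 < s])).
  by rewrite leb2_disc// disc_areaE -EFinM lee_fin mulrC.
apply: le_measure; rewrite ?inE; [exact: measurable_disc|exact: measurable_cdisc|].
by move=> p /= /ltW.
Qed.

Lemma leb2_sqnorm_preimage (A : set RR) : measurable A -> A `<=` `[0, 1[ ->
  leb2 (sqnorm @^-1` A) = (disc_area%:E * mu A)%E.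
Proof.
move=> mA A01.
have c0 := disc_area_gt0.
have cV0 : 0 <= disc_area^-1 by rewrite invr_ge0 ltW.
pose N : set RR := `]-oo, 0].
have mD : measurable N by exact: measurable_itv.
pose p : {measure set RR -> \bar R} := pushm (mu \x mu)%E measurable_sqnormRR.
pose r : {measure set RR -> \bar R} := mscale (NngNum (ltW c0)) (mrestr mu mD).
pose m' : {measure set RR -> \bar R} := mscale (NngNum cV0) (measure_add p r).
have m'E B : m' B = (disc_area^-1%:E * (leb2 (sqnorm @^-1` B) +
    disc_area%:E * mu (B `&` N)))%E.
  transitivity (disc_area^-1%:E * measure_add p r B)%E; first by [].
  by rewrite measure_addE.
have h : mu A = m' A.
  apply: lebesgue_measure_unique => // _ [[a b] _ <-].
  rewrite m'E /=.
  have [ba|ab] := leP b a.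
    rewrite set_itv_ge -?leNgt// ?bnd_simp//.
    by rewrite preimage_set0 set0I leb2_set0 !measure0 mule0 adde0 mule0.
  have -> : leb2 (sqnorm @^-1` `]a, b]) = (disc_area * (Num.max b 0 - Num.max a 0))%:E.
    rewrite (_ : _ @^-1` _ = [set p : plane | sqnorm p <= b] `\` [set p : plane | sqnorm p <= a]).
      rewrite [LHS](@measureD _ _ _ leb2m); [|exact: measurable_cdisc|exact: measurable_cdisc|]; last first.
        by rewrite [X in (X < _)%E]leb2_cdisc ltry.
      rewrite setIC (setIidl _); last by move=> q /= qa; rewrite (le_trans qa)// ltW.
      by rewrite [X in (X - _)%E]leb2_cdisc [X in (_ - X)%E]leb2_cdisc -EFinB mulrBr.
    apply/seteqP; split => q /=; rewrite in_itv/=.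
      by move=> /andP[aq qb]; split => //; apply/negP; rewrite -ltNge.
    by move=> [-> /negP]; rewrite -ltNge => ->.
  have -> : mu (`]a, b]%classic `&` N) = (Num.min b 0 - Num.min a 0)%:E.
    rewrite (_ : _ `&` _ = `]a, Num.min b 0]%classic); last first.
      apply/seteqP; split => q; rewrite /N /= !in_itv/= le_min.
        by move=> [/andP[-> ->] ->].
      by move=> /andP[-> /andP[-> ->]].
    rewrite lebesgue_measure_itv/= lte_fin lt_min ab/=.
    have [a0|a0] := ltP a 0; first by rewrite -EFinB.
    by rewrite min_r ?subrr// (le_trans a0)// ltW.
  rewrite lebesgue_measure_itv/= lte_fin ab.
  suff e : b - a = disc_area^-1 * (disc_area * (Num.max b 0 - Num.max a 0) +
      disc_area * (Num.min b 0 - Num.min a 0)) by exact: (congr1 EFin e).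
  rewrite -mulrDr mulKf ?gt_eqF//.
  have := addr_max_min b 0; have := addr_max_min a 0; lra.
have A0 : mu (A `&` N) = 0%E.
  apply/eqP; rewrite eq_le measure_ge0 andbT.
  rewrite -(lebesgue_measure_set1 (0 : R)); apply: le_measure; rewrite ?inE//.
    exact: measurableI.
  move=> q [/A01 /=]; rewrite /N /= !in_itv/= => /andP[q0 _] q1.
  by apply/eqP; rewrite eq_le q0 q1.
rewrite h m'E A0 mule0 adde0 muleA -EFinM mulfV ?mul1e//.
by rewrite gt_eqF.
Qed.

Lemma integral_radial (f : RR -> R) : measurable_fun setT f ->
  (forall u, 0 <= u -> 0 <= f u) ->
  (\int[@leb2 R]_(p in (@Dset R : set plane)) (f (sqnorm p))%:E =
   disc_area%:E * \int[mu]_(u in `[0%R, 1%R[) (f u)%:E)%E.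
Proof.
move=> mf f0.
have mE (D : set RR) : measurable_fun D (fun x => (f x)%:E).
  by apply/measurable_EFinP; exact: measurable_funS mf.
pose m' : {measure set RR -> \bar R} := mscale (NngNum (ltW disc_area_gt0)) mu.
pose p : {measure set RR -> \bar R} := pushm (mu \x mu)%E measurable_sqnormRR.
transitivity (\int[m']_(u in `[0%R, 1%R[) (f u)%:E)%E; last first.
  rewrite ge0_integral_mscale//= => u; rewrite in_itv/= => /andP[u0 _].
  by rewrite lee_fin f0.
transitivity (\int[p]_(u in `[0%R, 1%R[) (f u)%:E)%E; last first.
  by apply: eq_measure_integral => A mA A01; exact: leb2_sqnorm_preimage.
rewrite /p ge0_integral_pushforward//; [|exact: measurable_sqnormRR|]; last first.
  by move=> u; rewrite inE/= in_itv/= => /andP[u0 _]; rewrite lee_fin f0.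
rewrite (_ : _ @^-1` _ = (@Dset R : set plane))//.
by apply/seteqP; split => q /=; rewrite in_itv/= sqnorm_ge0.
Qed.

End RadialLaw.

Section Moments.
Variable R : realType.
Notation mu := (@lebesgue_measure R).
Local Notation RR := (measurableTypeR R).
Local Notation plane := (measurableTypeR R * measurableTypeR R)%type.
Variable alpha : R.
Hypothesis halpha : -1 < alpha.

Let Dp : set plane := @Dset R.
Let leb2m : {measure set plane -> \bar R} := (mu \x mu)%E.

Definition mom (n : nat) : R :=
  Rintegral (@leb2 R) (@Dset R) (fun p => wgt alpha p * sqnorm p ^+ n).

Definition kap : R := (alpha + 1) / pi.

Lemma kap_gt0 : 0 < kap.
Proof. by rewrite divr_gt0 ?pi_gt0//; have := halpha; lra. Qed.

Lemma wgtE (p : plane) : wgt alpha p = kap * (1 - sqnorm p) `^ alpha.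
Proof. by rewrite /wgt /kap /sqnorm mulrAC. Qed.

Lemma wgt_ge0 (p : plane) : 0 <= wgt alpha p.
Proof. by rewrite wgtE mulr_ge0 ?powR_ge0// ltW// kap_gt0. Qed.

Lemma measurable_wgt (D : set plane) : measurable_fun D (wgt alpha : plane -> R).
Proof.
rewrite (_ : wgt alpha = (fun p : plane => kap * (1 - sqnorm p) `^ alpha)).
  apply: measurable_funM => //.
  apply: (@measurableT_comp _ _ _ _ _ _ (@powR R ^~ alpha)).
    exact: measurable_powR.
  by apply: measurable_funB => //; apply: measurable_funS (@measurable_sqnorm R).
by apply/funext => p; exact: wgtE.
Qed.

Definition beta (n : nat) : R := fine (\int[mu]_(u in `[0%R, 1%R[) (betaw alpha n u)%:E)%E.

Lemma betaE n : (\int[mu]_(u in `[0%R, 1%R[) (betaw alpha n u)%:E)%E = (beta n)%:E.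
Proof.
rewrite /beta fineK// ge0_fin_numE ?integral_betaw_fin//.
by apply: integral_ge0 => u; rewrite /= in_itv/= => /andP[u0 _]; rewrite lee_fin betaw_ge0.
Qed.

Lemma integral_wgt n :
  (\int[@leb2 R]_(p in (@Dset R : set plane)) (wgt alpha p * sqnorm p ^+ n)%:E)%E =
  (kap * disc_area R * beta n)%:E.
Proof.
pose f (u : RR) : R := kap * betaw alpha n u.
have mf : measurable_fun setT f by apply: measurable_funM => //; exact: measurable_betaw.
have f0 u : 0 <= u -> 0 <= f u.
  by move=> u0; rewrite mulr_ge0 ?betaw_ge0// ltW// kap_gt0.
have h := integral_radial mf f0.
transitivity (\int[@leb2 R]_(p in (@Dset R : set plane)) (f (sqnorm p))%:E)%E.
  by apply: eq_integral => p _; rewrite /f wgtE /betaw; congr EFin; ring.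
rewrite h.
have -> : (\int[mu]_(u in `[0%R, 1%R[) (f u)%:E)%E = (kap%:E * (beta n)%:E)%E.
  rewrite -betaE -ge0_integralZl_EFin//.
  - by move=> u; rewrite /= in_itv/= => /andP[u0 _]; rewrite lee_fin betaw_ge0.
  - by apply/measurable_EFinP; exact: measurable_betaw.
  - by rewrite ltW// kap_gt0.
by apply: (congr1 EFin); ring.
Qed.

Lemma momE n : mom n = kap * disc_area R * beta n.
Proof. by rewrite /mom /Rintegral integral_wgt. Qed.

Lemma wgt_integrable : leb2m.-integrable Dp (EFin \o (wgt alpha : plane -> R)).
Proof.
apply/integrableP; split; first by apply/measurable_EFinP; exact: measurable_wgt.
rewrite (@eq_integral _ _ _ leb2m Dp (fun p : plane => (wgt alpha p * sqnorm p ^+ 0)%:E)); last first.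
  by move=> p _; rewrite /= ger0_norm ?wgt_ge0// expr0 mulr1.
by rewrite [X in (X < _)%E]integral_wgt ltry.
Qed.

Lemma mom_ge (t : R) : 0 < t -> t < 1 ->
  exists2 c : R, 0 < c & forall n, c * t ^+ n <= mom n.
Proof.
move=> t0 t1; pose t' := (1 + t) / 2.
have tt : t < t' by rewrite /t'; lra.
have t'1 : t' < 1 by rewrite /t'; lra.
pose b0 := Num.min 1 ((1 - t') `^ alpha).
have b00 : 0 < b0 by rewrite lt_min ltr01 powR_gt0// subr_gt0.
have kd : 0 < kap * disc_area R by rewrite mulr_gt0 ?kap_gt0 ?disc_area_gt0.
exists (kap * disc_area R * (b0 * (t' - t))) => [|n].
  by rewrite mulr_gt0// mulr_gt0// subr_gt0.
rewrite momE -mulrA ler_pM2l// -lee_fin -betaE.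
apply: (@le_trans _ _ (\int[mu]_(u in `[t, t'[) (betaw alpha n u)%:E)%E); last first.
  apply: ge0_subset_integral => //.
  - by apply/measurable_EFinP; exact: measurable_betaw.
  - by move=> u; rewrite /= in_itv/= => /andP[u0 _]; rewrite lee_fin betaw_ge0.
  - move=> u /=; rewrite !in_itv/= => /andP[tu ut].
    by rewrite (le_trans (ltW t0))//= (lt_trans ut).
apply: (@le_trans _ _ (\int[mu]_(u in `[t, t'[) (cst (b0 * t ^+ n)%:E u))%E).
  rewrite integral_cst// [X in (_ * X)%E]lebesgue_measure_itv/= lte_fin tt.
  by rewrite -EFinB -EFinM lee_fin mulrAC.
have m0 : 0 <= b0 * t ^+ n by rewrite mulr_ge0 ?exprn_ge0// ltW.
apply: ge0_le_integral => //=.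
- by apply/measurable_EFinP; exact: measurable_betaw.
- move=> u; rewrite in_itv/= => /andP[tu ut]; rewrite lee_fin /betaw mulrC.
  have u0 : 0 <= u by rewrite (le_trans (ltW t0)).
  rewrite ler_pM ?exprn_ge0 ?(ltW t0) ?(ltW b00) ?lerXn2r ?nnegrE ?(ltW t0)//.
  have [a0|a0] := leP 0 alpha.
    rewrite /b0 ge_min; apply/orP; right; apply: ge0_ler_powR; rewrite ?nnegrE//; lra.
  rewrite /b0 ge_min; apply/orP; left.
  rewrite -(opprK alpha) powRN invf_ge1; last by rewrite powR_gt0//; lra.
  have e1 : 1 `^ (- alpha) = 1 :> R by rewrite powR1.
  by rewrite -[leRHS]e1; apply: ge0_ler_powR; rewrite ?nnegrE//; lra.
Qed.

Lemma mom_gt0 n : 0 < mom n.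
Proof.
have h0 : 0 < 2^-1 :> R by rewrite invr_gt0.
have h1 : 2^-1 < 1 :> R by rewrite invf_lt1// ltr1n.
have [c c0 h] := mom_ge h0 h1.
by rewrite (lt_le_trans _ (h n))// mulr_gt0// exprn_gt0.
Qed.

Lemma mom_noninc n : mom n.+1 <= mom n.
Proof.
have kd : 0 < kap * disc_area R by rewrite mulr_gt0 ?kap_gt0 ?disc_area_gt0.
rewrite !momE ler_pM2l// -lee_fin -!betaE; apply: ge0_le_integral => //=.
- by move=> u; rewrite in_itv/= => /andP[u0 _]; rewrite lee_fin betaw_ge0.
- by apply/measurable_EFinP; exact: measurable_betaw.
- by apply/measurable_EFinP; exact: measurable_betaw.
- move=> u; rewrite in_itv/= => /andP[u0 u1]; rewrite lee_fin /betaw.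
  by rewrite ler_wpM2r ?powR_ge0// exprS ler_piMl ?exprn_ge0// ltW.
Qed.

Lemma mom_doubling : exists2 k : R, 0 < k & forall n, mom n <= k * mom n.*2.+1.
Proof.
have kd : 0 < kap * disc_area R by rewrite mulr_gt0 ?kap_gt0 ?disc_area_gt0.
pose q : R := 2^-1 * 2^-1 `^ alpha * 2^-1.
have q0 : 0 < q.
  by rewrite mulr_gt0 ?invr_gt0// mulr_gt0 ?invr_gt0// powR_gt0// invr_gt0.
exists q^-1; first by rewrite invr_gt0.
move=> n; rewrite -ler_pdivrMl ?invr_gt0// invrK !momE mulrCA ler_pM2l//.
by have := integral_betaw_doubling alpha n; rewrite !betaE -EFinM lee_fin.
Qed.

End Moments.

(** * Power series with real coefficients *)

Section ComplexSeries.
Variable R : realType.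

Lemma sum_geometric (q : R) N : (1 - q) * (\sum_(n < N) q ^+ n) = 1 - q ^+ N.
Proof.
elim: N => [|N IH]; first by rewrite big_ord0 mulr0 expr0 subrr.
by rewrite big_ord_recr /= mulrDr IH exprS; ring.
Qed.

Lemma sum_geometric_le (q : R) N : 0 <= q -> q < 1 -> \sum_(n < N) q ^+ n <= (1 - q)^-1.
Proof.
move=> q0 q1; have p : 0 < 1 - q by rewrite subr_gt0.
by rewrite -(ler_pM2l p) mulfV ?gt_eqF// sum_geometric gerBl exprn_ge0.
Qed.

Lemma series_tail (u : nat -> R) (B q : R) : 0 <= q -> q < 1 ->
  (forall n, `|u n| <= B * q ^+ n) -> forall N,
  `|limn (series u) - \sum_(n < N) u n| <= B / (1 - q) * q ^+ N.
Proof.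
move=> q0 q1 uB N.
have B0 : 0 <= B by have := le_trans (normr_ge0 _) (uB 0%N); rewrite expr0 mulr1.
have cu : cvgn (series u).
  apply: normed_cvg; apply: (@series_le_cvg _ _ (fun n => B * q ^+ n)).
  - by move=> n /=.
  - by move=> n; rewrite mulr_ge0 ?exprn_ge0.
  - exact: uB.
  - by apply: is_cvg_geometric_series; rewrite ger0_norm.
have diff M : `|series u (N + M)%N - \sum_(n < N) u n| <= B / (1 - q) * q ^+ N.
  have -> : series u (N + M)%N - \sum_(n < N) u n = \sum_(n < M) u (N + n)%N.
    by rewrite /series /= big_mkord big_split_ord /= addrAC subrr add0r.
  rewrite (le_trans (ler_norm_sum _ _ _))//.
  rewrite (@le_trans _ _ (\sum_(n < M) B * q ^+ N * q ^+ n))//.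
    by apply: ler_sum => n _; rewrite (le_trans (uB _))// exprD mulrA.
  rewrite -mulr_sumr -!mulrA ler_wpM2l// mulrC ler_wpM2r ?exprn_ge0//.
  exact: sum_geometric_le.
have cv : (fun n => `|series u (n + N)%N - \sum_(n < N) u n|) @ \oo -->
    `|limn (series u) - \sum_(n < N) u n|.
  apply: cvg_norm; apply: cvgB; last exact: cvg_cst.
  by rewrite (@cvg_shiftn N _ (series u)).
rewrite -(cvg_lim _ cv)//; apply: limr_le; first by apply/cvg_ex; eexists; exact: cv.
by apply: nearW => n; rewrite addnC; exact: diff.
Qed.

Definition csum (f : nat -> R[i]) : R[i] :=
  (limn (series (fun n => Re (f n))) +i* limn (series (fun n => Im (f n))))%C.

Lemma Re_sum (f : nat -> R[i]) N : Re (\sum_(n < N) f n) = \sum_(n < N) Re (f n).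
Proof. by elim: N => [|N IH]; rewrite ?big_ord0// !big_ord_recr /= ReD IH. Qed.

Lemma Im_sum (f : nat -> R[i]) N : Im (\sum_(n < N) f n) = \sum_(n < N) Im (f n).
Proof. by elim: N => [|N IH]; rewrite ?big_ord0// !big_ord_recr /= ImD IH. Qed.

Lemma csum_tail (f : nat -> R[i]) (B q : R) : 0 <= q -> q < 1 ->
  (forall n, cabs (f n) <= B * q ^+ n) -> forall N,
  cabs (csum f - \sum_(n < N) f n) <= 2 * (B / (1 - q)) * q ^+ N.
Proof.
move=> q0 q1 fB N; rewrite (le_trans (cabs_le_ReIm _))//.
rewrite ReD ReN ImD ImN Re_sum Im_sum /= -mulrA mulr_natl mulr2n.
rewrite lerD//; apply: series_tail => // n.
  exact: le_trans (Re_le_cabs _) (fB n).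
exact: le_trans (Im_le_cabs _) (fB n).
Qed.

(* Such a series converges on the open unit disc. *)
Definition subexp (c : nat -> R) :=
  forall t, 0 < t -> t < 1 -> exists B, forall n, `|c n| * t ^+ n <= B.

Definition ps (c : nat -> R) (z : R[i]) : R[i] := csum (fun n => (c n)%:C%C * z ^+ n).
Definition pps (c : nat -> R) N (z : R[i]) : R[i] := \sum_(n < N) (c n)%:C%C * z ^+ n.

Lemma ps_coef_bound c (rho : R) : subexp c -> 0 <= rho -> rho < 1 ->
  exists B q : R, [/\ 0 <= B, 0 <= q, q < 1 & forall n, `|c n| * rho ^+ n <= B * q ^+ n].
Proof.
move=> hc r0 r1; pose t := (1 + rho) / 2.
have t0 : 0 < t by rewrite /t; lra.
have t1 : t < 1 by rewrite /t; lra.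
have rt : rho < t by rewrite /t; lra.
have [B hB] := hc _ t0 t1; exists B, (rho / t); split.
- by rewrite (le_trans _ (hB 0%N))// mulr_ge0 ?exprn_ge0// ltW.
- by rewrite divr_ge0// ltW.
- by rewrite ltr_pdivrMr// mul1r.
- move=> n.
  have -> : `|c n| * rho ^+ n = `|c n| * t ^+ n * (rho / t) ^+ n.
    by rewrite -mulrA -exprMn mulrCA mulfV ?mulr1// gt_eqF.
  by rewrite ler_wpM2r// exprn_ge0// divr_ge0// ltW.
Qed.

Lemma ps_tail c (rho : R) : subexp c -> 0 <= rho -> rho < 1 ->
  exists K q : R, [/\ 0 <= K, 0 <= q, q < 1 & forall N z, cabs z <= rho ->
    cabs (ps c z - pps c N z) <= K * q ^+ N].
Proof.
move=> hc r0 r1; have [B [q [B0 q0 q1 hB]]] := ps_coef_bound hc r0 r1.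
exists (2 * (B / (1 - q))), q; split=> //.
  by rewrite mulr_ge0// divr_ge0// subr_ge0 ltW.
move=> N z zr; apply: csum_tail => // n; rewrite cabsM cabsX cabs_real.
by rewrite (le_trans _ (hB n))// ler_wpM2l// lerXn2r ?nnegrE ?cabs_ge0.
Qed.

Lemma ps_sum_bound c (rho : R) : subexp c -> 0 <= rho -> rho < 1 ->
  exists2 M : R, 0 <= M & forall N, \sum_(n < N) `|c n| * rho ^+ n <= M.
Proof.
move=> hc r0 r1; have [B [q [B0 q0 q1 hB]]] := ps_coef_bound hc r0 r1.
exists (B / (1 - q)); first by rewrite divr_ge0// subr_ge0 ltW.
move=> N; apply: (@le_trans _ _ (\sum_(n < N) B * q ^+ n)); first exact: ler_sum.
by rewrite -mulr_sumr ler_wpM2l// sum_geometric_le.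
Qed.

Lemma ps_limit c (z : R[i]) (e : R) : subexp c -> cabs z < 1 -> 0 < e ->
  exists N0, forall N, (N0 <= N)%N -> cabs (ps c z - pps c N z) <= e.
Proof.
move=> hc z1 e0.
have [K [q [K0 q0 q1 h]]] := ps_tail hc (cabs_ge0 z) z1.
have [N0 hN] := geometric_small K q0 q1 e0.
by exists N0 => N hN0; rewrite (le_trans (h N z (lexx _)))// hN.
Qed.

Lemma subexp_shift c : subexp c -> subexp (fun n => c n.+1).
Proof.
move=> hc t t0 t1; have [B hB] := hc t t0 t1; exists (B / t) => n.
by rewrite ler_pdivlMr// -mulrA -exprSr.
Qed.

Lemma subexp_mulrn c : subexp c -> subexp (fun n => n%:R * c n).
Proof.
move=> hc t t0 t1.
have [B [q [B0 q0 q1 hB]]] := ps_coef_bound hc (ltW t0) t1.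
exists (B / (1 - q)) => n; rewrite normrM normr_nat -mulrA.
rewrite (@le_trans _ _ (n%:R * (B * q ^+ n)))// ?ler_wpM2l//.
rewrite mulrCA ler_wpM2l// (le_trans _ (sum_geometric_le n q0 q1))//.
rewrite mulr_natl -[X in _ *+ X]card_ord -sumr_const ler_sum// => i _.
by apply: ler_wiXn2l; [exact: q0|exact: ltW|exact: (ltnW (ltn_ord i))].
Qed.

Lemma expr_second_order (rho : R) (z h : R[i]) n : 0 <= rho -> cabs z <= rho ->
  cabs (z + h) <= rho ->
  rho ^+ 2 * cabs ((z + h) ^+ n - z ^+ n - n%:R * z ^+ n.-1 * h) <=
  n%:R ^+ 2 * rho ^+ n * cabs h ^+ 2.
Proof.
move=> r0 zr zhr; elim: n => [|n IH].
  by rewrite !expr0 subrr mul0r mul0r subrr cabs0 mulr0 expr0n/= mul0r mul0r.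
have -> : (z + h) ^+ n.+1 - z ^+ n.+1 - n.+1%:R * z ^+ n.+1.-1 * h =
    (z + h) * ((z + h) ^+ n - z ^+ n - n%:R * z ^+ n.-1 * h) +
    n%:R * z ^+ n.-1 * h ^+ 2.
  case: n {IH} => [|n]; first by rewrite !expr0 !expr1 /=; ring.
  by rewrite /= !exprS -!natr1; ring.
set A := (z + h) ^+ n - _ - _ in IH *.
have r2 : 0 <= rho ^+ 2 by rewrite exprn_ge0.
apply: (@le_trans _ _ (rho ^+ 2 * (rho * cabs A) + rho ^+ 2 * (n%:R * rho ^+ n.-1 * cabs h ^+ 2))).
  rewrite -mulrDr ler_wpM2l// (le_trans (cabsD _ _))// lerD//.
    by rewrite cabsM ler_wpM2r ?cabs_ge0.
  rewrite cabsM (cabsM n%:R) (cabsX z) (cabsX h).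
  rewrite -(rmorph_nat (real_complex R)) cabs_real normr_nat.
  apply: ler_wpM2r; first by rewrite exprn_ge0 ?cabs_ge0.
  apply: ler_wpM2l; first exact: ler0n.
  by rewrite lerXn2r ?nnegrE ?cabs_ge0.
have -> : rho ^+ 2 * (rho * cabs A) = rho * (rho ^+ 2 * cabs A) by ring.
apply: (@le_trans _ _ (rho * (n%:R ^+ 2 * rho ^+ n * cabs h ^+ 2) +
    n%:R * rho ^+ n.+1 * cabs h ^+ 2)).
  rewrite lerD ?ler_wpM2l//.
  case: n {IH A} => [|n]; first by rewrite !mul0r mulr0.
  rewrite /= -[n.+2]/(2 + n)%N exprD; set m : R := n.+1%:R.
  rewrite le_eqVlt; apply/orP; left; apply/eqP; ring.
have -> : rho * (n%:R ^+ 2 * rho ^+ n * cabs h ^+ 2) + n%:R * rho ^+ n.+1 * cabs h ^+ 2 =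
  (n%:R ^+ 2 + n%:R) * rho ^+ n.+1 * cabs h ^+ 2 by rewrite [rho ^+ n.+1]exprS; ring.
rewrite ler_wpM2r ?exprn_ge0 ?cabs_ge0// ler_wpM2r ?exprn_ge0//.
by rewrite -natr1; have : 0 <= n%:R :> R by []; lra.
Qed.

Lemma ps_cdiff c (z : R[i]) : subexp c -> cabs z < 1 ->
  cdiff (ps c) z (ps (fun n => n.+1%:R * c n.+1) z).
Proof.
move=> hc z1; set c' := fun n => _.
have hc' : subexp c' by exact: (subexp_shift (subexp_mulrn hc)).
have hc2 : subexp (fun n => n%:R * (n%:R * c n)) by do 2 apply: subexp_mulrn.
pose rho := (1 + cabs z) / 2.
have z0 := cabs_ge0 z.
have rho0 : 0 < rho by rewrite /rho; lra.
have rho1 : rho < 1 by rewrite /rho; lra.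
have zr : cabs z < rho by rewrite /rho; lra.
have [M M0 hM] := ps_sum_bound hc2 (ltW rho0) rho1.
move=> e e0; pose M1 := M / rho ^+ 2 + 1.
have M10 : 0 < M1 by rewrite ltr_wpDl// divr_ge0// exprn_ge0// ltW.
exists (Num.min (rho - cabs z) (e / M1)); first by rewrite lt_min subr_gt0 zr divr_gt0.
move=> h; rewrite lt_min => /andP[hz he].
have zh : cabs (z + h) <= rho by rewrite (le_trans (cabsD _ _))//; lra.
have zh1 : cabs (z + h) < 1 by rewrite (le_lt_trans zh).
apply: (@le_trans _ _ (M / rho ^+ 2 * cabs h ^+ 2)); last first.
  rewrite expr2 mulrA ler_wpM2r ?cabs_ge0//.
  apply: (@le_trans _ _ (M1 * cabs h)); first by rewrite ler_wpM2r ?cabs_ge0// lerDl.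
  by rewrite mulrC -ler_pdivlMr// ltW.
apply/ler_addgt0Pr => d d0.
have d3 : 0 < d / 3 by rewrite divr_gt0.
have [N1 h1] := ps_limit hc zh1 d3.
have [N2 h2] := ps_limit hc z1 d3.
have hh : 0 < d / 3 / (cabs h + 1) by rewrite divr_gt0// ltr_wpDl// cabs_ge0.
have [N3 h3] := ps_limit hc' z1 hh.
pose N := (N1 + N2 + N3)%N.
have {}h1 := h1 N.+1 (leqW (leq_trans (leq_addr _ _) (leq_addr _ _))).
have {}h2 := h2 N.+1 (leqW (leq_trans (leq_addl _ _) (leq_addr _ _))).
have {}h3 := h3 N (leq_addl _ _).
have poly : cabs (pps c N.+1 (z + h) - pps c N.+1 z - pps c' N z * h) <=
    M / rho ^+ 2 * cabs h ^+ 2.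
  have -> : pps c N.+1 (z + h) - pps c N.+1 z - pps c' N z * h =
     \sum_(n < N.+1) (c n)%:C%C * ((z + h) ^+ n - z ^+ n - n%:R * z ^+ n.-1 * h).
    have -> : pps c' N z * h = \sum_(n < N.+1) (c n)%:C%C * (n%:R * z ^+ n.-1 * h).
      rewrite big_ord_recl mul0r mul0r mulr0 add0r mulr_suml; apply: eq_bigr => n _.
      by rewrite /c' lift0 /= rmorphM rmorph_nat; set m : R[i] := n.+1%:R; ring.
    by rewrite /pps -!sumrB; apply: eq_bigr => n _; ring.
  rewrite (le_trans (cabs_sum _ _ _))// mulrAC ler_pdivlMr ?exprn_gt0//.
  apply: (@le_trans _ _ (\sum_(n < N.+1) `|n%:R * (n%:R * c n)| * rho ^+ n * cabs h ^+ 2)).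
    rewrite mulr_suml; apply: ler_sum => n _.
    rewrite cabsM cabs_real !normrM !normr_nat.
    have := expr_second_order n (ltW rho0) (ltW zr) zh.
    move=> /(ler_wpM2l (normr_ge0 (c n))); set A := cabs _ => hs.
    have -> : `|c n| * A * rho ^+ 2 = `|c n| * (rho ^+ 2 * A) by ring.
    by rewrite (le_trans hs)// le_eqVlt; apply/orP; left; apply/eqP; ring.
  by rewrite -mulr_suml ler_wpM2r ?exprn_ge0 ?cabs_ge0.
have -> : ps c (z + h) - ps c z - ps c' z * h =
  (pps c N.+1 (z + h) - pps c N.+1 z - pps c' N z * h) +
  ((ps c (z + h) - pps c N.+1 (z + h)) - (ps c z - pps c N.+1 z) -
   (ps c' z - pps c' N z) * h).
  move: (ps c (z + h)) (pps c N.+1 (z + h)) (ps c z) (pps c N.+1 z) (ps c' z) (pps c' N z).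
  by move=> *; ring.
apply: le_trans (cabsD _ _) (lerD poly _).
apply: le_trans (cabsB _ _) _; apply: (@le_trans _ _ (d / 3 + d / 3 + d / 3)); last first.
  by rewrite le_eqVlt; apply/orP; left; apply/eqP; field.
apply: lerD; first exact: le_trans (cabsB _ _) (lerD h1 h2).
rewrite cabsM; apply: le_trans (ler_wpM2r (cabs_ge0 _) h3) _.
rewrite mulrAC ler_pdivrMr; last by rewrite ltr_wpDl// cabs_ge0.
by rewrite ler_wpM2l ?(ltW d3)// lerDl.
Qed.

End ComplexSeries.

Lemma ler_wpM_addr (R : realType) (a x y d : R) : 0 <= a -> a <= 1 -> 0 <= d -> x <= y + d ->
  a * x <= a * y + d.
Proof.
move=> a0 a1 d0 xy; apply: (le_trans (ler_wpM2l a0 xy)).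
by rewrite mulrDr lerD2l ler_piMl.
Qed.

Section KernelEstimates.
Variables (R : realType) (c : nat -> R).
Hypotheses (c_ge0 : forall n, 0 <= c n) (c_nd : forall n, c n <= c n.+1).
Hypothesis (csub : subexp c).

Definition psr (t : R) : R := Re (ps c (t%:C)%C).

Lemma pps_real N (t : R) : pps c N (t%:C)%C = ((\sum_(n < N) c n * t ^+ n)%:C)%C.
Proof. by rewrite /pps rmorph_sum; apply: eq_bigr => n _; rewrite rmorphM rmorphXn. Qed.

Lemma psr_limit (t e : R) : 0 <= t -> t < 1 -> 0 < e -> exists N0, forall N, (N0 <= N)%N ->
  `|psr t - \sum_(n < N) c n * t ^+ n| <= e.
Proof.
move=> t0 t1 e0.
have ct : cabs (t%:C)%C < 1 by rewrite cabs_real ger0_norm.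
have [N0 h] := ps_limit csub ct e0; exists N0 => N /h.
by apply: le_trans; rewrite pps_real (le_trans _ (Re_le_cabs _))// ReD ReN.
Qed.

Lemma psE (t : R) : 0 <= t -> t < 1 -> ps c (t%:C)%C = ((psr t)%:C)%C.
Proof.
move=> t0 t1; apply: complexP => //=.
have ct : cabs (t%:C)%C < 1 by rewrite cabs_real ger0_norm.
apply/eqP; rewrite -normr_eq0 eq_le normr_ge0 andbT; apply/ler_addgt0Pr => e e0.
have [N0 h] := ps_limit csub ct e0; rewrite add0r.
apply: le_trans (h N0 (leqnn _)); rewrite pps_real.
by rewrite (le_trans _ (Im_le_cabs _))// ImD ImN /= oppr0 addr0.
Qed.

Lemma psr_ge (t : R) : 0 <= t -> t < 1 -> c 0%N <= psr t.
Proof.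
move=> t0 t1; apply/ler_addgt0Pr => e e0.
have [N0 h] := psr_limit t0 t1 e0; have := h N0.+1 (leqnSn _).
rewrite ler_norml => /andP[+ _]; rewrite big_ord_recl expr0 mulr1.
have : 0 <= \sum_(i < N0) c (lift ord0 i) * t ^+ (lift ord0 i).
  by apply: sumr_ge0 => i _; rewrite mulr_ge0 ?exprn_ge0.
by lra.
Qed.

Lemma coef_small (t e : R) : 0 <= t -> t < 1 -> 0 < e -> exists N0, forall N, (N0 <= N)%N ->
  c N * t ^+ N.+1 <= e.
Proof.
move=> t0 t1 e0; have [B [q [B0 q0 q1 hB]]] := ps_coef_bound csub t0 t1.
have [N0 hN] := geometric_small B q0 q1 e0; exists N0 => N /hN.
apply: le_trans; apply: le_trans (hB N); rewrite ger0_norm// ler_wpM2l//.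
by rewrite exprS ler_piMl ?exprn_ge0// ltW.
Qed.

Lemma onem_mul_pps N (x : R[i]) : (1 - x) * pps c N.+1 x =
  (c 0%N)%:C%C + \sum_(n < N) (c n.+1 - c n)%:C%C * x ^+ n.+1 - (c N)%:C%C * x ^+ N.+1.
Proof.
elim: N => [|N IH].
  by rewrite /pps big_ord_recl !big_ord0 expr0 expr1; ring.
rewrite /pps big_ord_recr /= -/(pps c N.+1 x) mulrDr IH big_ord_recr /=.
by rewrite rmorphB [x ^+ N.+2]exprS; ring.
Qed.

Lemma onem_mul_sum N (t : R) : (1 - t) * (\sum_(n < N.+1) c n * t ^+ n) =
  c 0%N + \sum_(n < N) (c n.+1 - c n) * t ^+ n.+1 - c N * t ^+ N.+1.
Proof.
elim: N => [|N IH].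
  by rewrite big_ord_recl !big_ord0 expr0 expr1; ring.
rewrite big_ord_recr /= mulrDr IH big_ord_recr /=.
by rewrite [t ^+ N.+2]exprS; ring.
Qed.

(* Abel summation: the coefficients c n.+1 - c n of (1 - x) K(x) are nonnegative. *)
Lemma onem_ps_le (x : R[i]) : cabs x < 1 ->
  cabs (1 - x) * cabs (ps c x) <= (1 - cabs x) * psr (cabs x).
Proof.
move=> x1; have x0 := cabs_ge0 x.
apply/ler_addgt0Pr => e e0; have e5 : 0 < e / 5 by rewrite divr_gt0.
have [N1 h1] := ps_limit csub x1 e5.
have [N2 h2] := psr_limit x0 x1 e5.
have [N3 h3] := coef_small x0 x1 e5.
pose N := (N1 + N2 + N3)%N.
have {}h1 := h1 N.+1 (leqW (leq_trans (leq_addr _ _) (leq_addr _ _))).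
have {}h2 := h2 N.+1 (leqW (leq_trans (leq_addl _ _) (leq_addr _ _))).
have {}h3 := h3 N (leq_addl _ _).
have b1 : cabs ((1 - x) * pps c N.+1 x) <=
    (1 - cabs x) * (\sum_(n < N.+1) c n * cabs x ^+ n) + 2 * (c N * cabs x ^+ N.+1).
  rewrite onem_mul_pps onem_mul_sum (le_trans (cabsB _ _))//.
  have : cabs ((c N)%:C%C * x ^+ N.+1) = c N * cabs x ^+ N.+1.
    by rewrite cabsM cabsX cabs_real ger0_norm.
  have : cabs ((c 0%N)%:C%C + \sum_(n < N) (c n.+1 - c n)%:C%C * x ^+ n.+1) <=
      c 0%N + \sum_(n < N) (c n.+1 - c n) * cabs x ^+ n.+1.
    rewrite (le_trans (cabsD _ _))// lerD//; first by rewrite cabs_real ger0_norm.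
    rewrite (le_trans (cabs_sum _ _ _))//; apply: ler_sum => n _.
    by rewrite cabsM cabsX cabs_real ger0_norm// subr_ge0.
  by move=> ? ->; lra.
have b2 : cabs (1 - x) <= 2.
  by rewrite (le_trans (cabsB _ _))// cabs1; lra.
have b3 : cabs (ps c x) <= cabs (pps c N.+1 x) + e / 5.
  by rewrite -lerBlDl (le_trans (cabs_dist _ _)).
move: b1 h2; rewrite cabsM ler_norml => b1 /andP[h2 _].
have b4 : cabs (1 - x) * cabs (ps c x) <= cabs (1 - x) * cabs (pps c N.+1 x) + 2 * (e / 5).
  rewrite (le_trans (ler_wpM2l (cabs_ge0 _) b3))// mulrDr lerD2l.
  by rewrite ler_wpM2r// ltW.
set S := \sum_(n < N.+1) _ in b1 h2.
have b5 : (1 - cabs x) * S <= (1 - cabs x) * psr (cabs x) + e / 5.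
  have : (1 - cabs x) * S <= (1 - cabs x) * (psr (cabs x) + e / 5).
    by rewrite ler_wpM2l// ?subr_ge0 ?(ltW x1)//; lra.
  have : (1 - cabs x) * (e / 5) <= e / 5 by rewrite ler_piMl// ?(ltW e5)//; lra.
  by lra.
by lra.
Qed.

Lemma onem_psr_nondecreasing (s t : R) : 0 <= s -> s <= t -> t < 1 ->
  (1 - s) * psr s <= (1 - t) * psr t.
Proof.
move=> s0 st t1; have t0 := le_trans s0 st; have s1 := le_lt_trans st t1.
apply/ler_addgt0Pr => e e0; have e5 : 0 < e / 5 by rewrite divr_gt0.
have [N1 h1] := psr_limit s0 s1 e5.
have [N2 h2] := psr_limit t0 t1 e5.
have [N3 h3] := coef_small t0 t1 e5.
pose N := (N1 + N2 + N3)%N.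
have {}h1 := h1 N.+1 (leqW (leq_trans (leq_addr _ _) (leq_addr _ _))).
have {}h2 := h2 N.+1 (leqW (leq_trans (leq_addl _ _) (leq_addr _ _))).
have {}h3 := h3 N (leq_addl _ _).
have := onem_mul_sum N s; have := onem_mul_sum N t.
have c0 : 0 <= c N * s ^+ N.+1 by rewrite mulr_ge0 ?exprn_ge0.
have : \sum_(n < N) (c n.+1 - c n) * s ^+ n.+1 <= \sum_(n < N) (c n.+1 - c n) * t ^+ n.+1.
  by apply: ler_sum => n _; rewrite ler_wpM2l ?subr_ge0// lerXn2r ?nnegrE.
move: h1 h2; rewrite !ler_norml => /andP[_ h1] /andP[h2 _].
set Ss := \sum_(n < N.+1) c n * s ^+ n in h1 *.
set St := \sum_(n < N.+1) c n * t ^+ n in h2 *.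
set A := \sum_(n < N) _; set B := \sum_(n < N) _ => AB eT eS.
have b1 : (1 - s) * psr s <= (1 - s) * Ss + e / 5.
  apply: ler_wpM_addr; [by rewrite subr_ge0 ltW|by rewrite gerBl|exact: ltW|].
  by rewrite -lerBlDl.
have b2 : (1 - t) * St <= (1 - t) * psr t + e / 5.
  apply: ler_wpM_addr; [by rewrite subr_ge0 ltW|by rewrite gerBl|exact: ltW|].
  by rewrite -lerBlDl -(opprB (psr t)) lerNl.
clearbody A B Ss St; move: eT eS b1 b2 c0 h3 AB e5; clear.
move: (c N * s ^+ N.+1) (c N * t ^+ N.+1) (psr s) (psr t) (c 0%N) => u v x y z.
by lra.
Qed.

Variable k : R.
Hypothesis c_doubling : forall n, c n.*2.+1 <= k * c n.

Lemma sum_doubling N (t : R) : 0 <= t -> t < 1 ->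
  \sum_(n < N.*2) c n * t ^+ n <= 2 * k * \sum_(n < N) c n * (t ^+ 2) ^+ n.
Proof.
move=> t0 t1; elim: N => [|N IH]; first by rewrite !big_ord0 mulr0.
rewrite doubleS !big_ord_recr /= [leRHS]mulrDr -addrA lerD//.
have tN : 0 <= t ^+ N.*2 by rewrite exprn_ge0.
have e2 : (t ^+ 2) ^+ N = t ^+ N.*2 by rewrite -exprM mul2n.
rewrite e2 exprS.
have h1 : c N.*2 * t ^+ N.*2 <= k * c N * t ^+ N.*2.
  by rewrite ler_wpM2r// (le_trans (c_nd _)).
have h2 : c N.*2.+1 * (t * t ^+ N.*2) <= k * c N * t ^+ N.*2.
  rewrite (@le_trans _ _ (c N.*2.+1 * t ^+ N.*2))//.
    by rewrite ler_wpM2l// ler_piMl// ltW.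
  by rewrite ler_wpM2r.
by lra.
Qed.

Lemma psr_doubling (t : R) : 0 <= k -> 0 <= t -> t < 1 -> psr t <= 2 * k * psr (t ^+ 2).
Proof.
move=> k0 t0 t1.
have tt0 : 0 <= t ^+ 2 by rewrite exprn_ge0.
have tt1 : t ^+ 2 < 1 by rewrite exprn_ilt1.
apply/ler_addgt0Pr => e e0.
pose d := e / (2 * k + 1).
have kp : 0 < 2 * k + 1 by lra.
have d0 : 0 < d by rewrite divr_gt0.
have [N1 h1] := psr_limit t0 t1 d0.
have [N2 h2] := psr_limit tt0 tt1 d0.
pose N := (N1 + N2)%N.
have {}h1 : `|psr t - \sum_(n < N.*2) c n * t ^+ n| <= d.
  by apply: h1; rewrite -addnn; apply: leq_trans (leq_addr _ _); exact: leq_addr.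
have {}h2 := h2 N (leq_addl _ _).
have h3 := sum_doubling N t0 t1.
move: h1 h2 h3; rewrite !ler_norml => /andP[_ h1] /andP[h2 _].
set S1 := \sum_(n < N.*2) _ in h1 *; set S2 := \sum_(n < N) _ in h2 * => h3.
have ed : e = 2 * k * d + d by rewrite /d; field; rewrite gt_eqF.
rewrite ed; clearbody S1 S2 d; move: h1 h2 h3 k0 d0; clear.
move: (psr t) (psr (t ^+ 2)) => x y h1 h2 h3 k0 d0.
have : 2 * k * S2 <= 2 * k * (y + d).
  by apply: ler_wpM2l; [apply: mulr_ge0|rewrite -lerBlDl -(opprB y) lerNl].
by lra.
Qed.

Lemma kernel_ratio (r : R) (x : R[i]) : 0 <= k -> r < 1 -> cabs x <= r ->
  cabs (1 - x) * cabs (ps c x) <= (1 - r) * (2 * k * psr (r ^+ 2)).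
Proof.
move=> k0 r1 xr; have r0 := le_trans (cabs_ge0 _) xr.
rewrite (le_trans (onem_ps_le (le_lt_trans xr r1)))//.
rewrite (le_trans (onem_psr_nondecreasing (cabs_ge0 _) xr r1))//.
by rewrite ler_wpM2l ?psr_doubling// subr_ge0 ltW.
Qed.

End KernelEstimates.

(** * The reproducing kernel of the Bergman space *)

Section WeightedIntegral.
Variable R : realType.
Notation mu := (@lebesgue_measure R).
Local Notation plane := (measurableTypeR R * measurableTypeR R)%type.
Variable alpha : R.
Hypothesis halpha : -1 < alpha.

Definition leb2m : {measure set plane -> \bar R} := (mu \x mu)%E.

Definition wint (S : set plane) (h : R[i] -> R[i]) : R[i] :=
  (Rintegral leb2m S (fun p => wgt alpha p * Re (h (toC p))) +i*
   Rintegral leb2m S (fun p => wgt alpha p * Im (h (toC p))))%C.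

Definition cmeas (S : set plane) (h : R[i] -> R[i]) :=
  measurable_fun S (fun p : plane => Re (h (toC p))) /\
  measurable_fun S (fun p : plane => Im (h (toC p))).

Definition wable (S : set plane) (h : R[i] -> R[i]) :=
  leb2m.-integrable S (EFin \o (fun p : plane => wgt alpha p * Re (h (toC p)))) /\
  leb2m.-integrable S (EFin \o (fun p : plane => wgt alpha p * Im (h (toC p)))).

Lemma cmeasS S S' h : measurable S -> S' `<=` S -> cmeas S h -> cmeas S' h.
Proof. by move=> mS sS [h1 h2]; split; [exact: measurable_funS h1|exact: measurable_funS h2]. Qed.

Lemma cmeas_cst S k : cmeas S (fun=> k).
Proof. by split; exact: measurable_cst. Qed.

Lemma cmeas_id S : cmeas S (fun z => z).
Proof.
split; [apply: (@measurable_funS _ _ plane R setT)|apply: (@measurable_funS _ _ plane R setT)] => //.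
- exact: (@measurable_fst _ _ (measurableTypeR R) (measurableTypeR R)).
- exact: (@measurable_snd _ _ (measurableTypeR R) (measurableTypeR R)).
Qed.

Lemma cmeasD S f g : cmeas S f -> cmeas S g -> cmeas S (fun z => f z + g z).
Proof.
move=> [f1 f2] [g1 g2]; split.
  under eq_fun do rewrite ReD; exact: measurable_funD.
under eq_fun do rewrite ImD; exact: measurable_funD.
Qed.

Lemma cmeasM S f g : cmeas S f -> cmeas S g -> cmeas S (fun z => f z * g z).
Proof.
move=> [f1 f2] [g1 g2]; split.
  by under eq_fun do rewrite ReM; apply: measurable_funB; apply: measurable_funM.
by under eq_fun do rewrite ImM; apply: measurable_funD; apply: measurable_funM.
Qed.

Lemma cmeas_conj S f : cmeas S f -> cmeas S (fun z => (f z)^*%C).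
Proof.
move=> [f1 f2]; split.
  by rewrite (_ : (fun _ => _) = (fun p : plane => Re (f (toC p))))//;
    apply/funext => p; case: (f _).
rewrite (_ : (fun _ => _) = (fun p : plane => - Im (f (toC p)))).
  exact: measurable_funN.
by apply/funext => p; case: (f _).
Qed.

Lemma cmeasX S f n : cmeas S f -> cmeas S (fun z => f z ^+ n).
Proof.
move=> mf; elim: n => [|n IH].
  by under [fun z => _]eq_fun do rewrite expr0; exact: cmeas_cst.
by under [fun z => _]eq_fun do rewrite exprS; exact: cmeasM.
Qed.

Lemma cmeas_sum S (f : nat -> R[i] -> R[i]) N : (forall n, cmeas S (f n)) ->
  cmeas S (fun z => \sum_(n < N) f n z).
Proof.
move=> mf; elim: N => [|N IH].
  by under [fun z => _]eq_fun do rewrite big_ord0; exact: cmeas_cst.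
by under [fun z => _]eq_fun do rewrite big_ord_recr /=; exact: cmeasD.
Qed.

Lemma cabs_toC (p : plane) : cabs (toC p) ^+ 2 = sqnorm p.
Proof. by rewrite sqr_cabs. Qed.

Lemma Dset_cabs (p : plane) : (@Dset R : set plane) p <-> cabs (toC p) < 1.
Proof.
rewrite -(@expr_lt1 _ 2) ?cabs_ge0// cabs_toC.
by split.
Qed.

Lemma cmeas_lim S (f : R[i] -> R[i]) (fN : nat -> R[i] -> R[i]) :
  (forall N, cmeas S (fN N)) ->
  (forall p : plane, S p -> forall e : R, 0 < e -> exists N0, forall N, (N0 <= N)%N ->
     cabs (f (toC p) - fN N (toC p)) <= e) -> cmeas S f.
Proof.
move=> mf lf; split.
  apply: (measurable_fun_cvg (h := fun N (p : plane) => Re (fN N (toC p)))).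
    by move=> N; exact: (mf N).1.
  move=> p Sp; apply/cvgrPdist_le => e e0.
  have [N0 h] := lf p Sp e e0; exists N0 => // N /h; apply: le_trans.
  by rewrite -ReN -ReD Re_le_cabs.
apply: (measurable_fun_cvg (h := fun N (p : plane) => Im (fN N (toC p)))).
  by move=> N; exact: (mf N).2.
move=> p Sp; apply/cvgrPdist_le => e e0.
have [N0 h] := lf p Sp e e0; exists N0 => // N /h; apply: le_trans.
by rewrite -ImN -ImD Im_le_cabs.
Qed.

Lemma taylor_limit (a : nat -> R[i]) F (rho e : R) : taylor_on_D a F ->
  0 < rho -> rho < 1 -> 0 < e -> exists N0, forall N, (N0 <= N)%N ->
  forall z, cabs z <= rho -> cabs (F z - \sum_(n < N) a n * z ^+ n) <= e.
Proof.
move=> ta r0 r1 e0; have [K [r [K0 rr h]]] := ta _ r0 r1.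
have rp : 0 < r by apply: lt_trans rr.
have q1 : rho / r < 1 by rewrite ltr_pdivrMr// mul1r.
have q0 : 0 <= rho / r by rewrite divr_ge0// ltW.
have [N0 hN] := geometric_small K q0 q1 e0; exists N0 => N /hN hN0 z zr.
rewrite (le_trans (h N z zr))// (le_trans _ hN0)// ler_wpM2l//.
have qz : cabs z / r <= rho / r by rewrite ler_wpM2r// invr_ge0 ltW.
by rewrite lerXn2r ?nnegrE// divr_ge0 ?cabs_ge0// ltW.
Qed.

Lemma cmeas_analytic F : analytic_on_D F -> cmeas (@Dset R : set plane) F.
Proof.
move=> aF; have [a [ta _]] := taylor_exists aF.
apply: (@cmeas_lim _ _ (fun N z => \sum_(n < N) a n * z ^+ n)).
  move=> N; apply: (@cmeas_sum _ (fun n z => a n * z ^+ n)) => n.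
  by apply: cmeasM; [exact: cmeas_cst|apply: cmeasX; exact: cmeas_id].
move=> p /Dset_cabs p1 e e0.
have p0 := cabs_ge0 (toC p : R[i]).
pose rho := (1 + cabs (toC p)) / 2.
have r0 : 0 < rho by rewrite /rho; lra.
have r1 : rho < 1 by rewrite /rho; lra.
have [N0 h] := taylor_limit ta r0 r1 e0.
by exists N0 => N hN; apply: h => //; rewrite /rho; lra.
Qed.

Lemma measurable_cabs S h : cmeas S h -> measurable_fun S (fun p : plane => cabs (h (toC p))).
Proof.
move=> [h1 h2].
rewrite (_ : (fun _ => _) = (fun p : plane => Num.sqrt (Re (h (toC p)) ^+ 2 + Im (h (toC p)) ^+ 2))).
  apply: (@measurableT_comp _ _ _ _ _ _ (@Num.sqrt R)).
    exact: (continuous_measurable_fun (@sqrt_continuous R)).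
  by apply: measurable_funD; apply: measurable_funX.
by apply/funext => p; case: (h _).
Qed.

Lemma wable_dominated (S : set plane) h (G : plane -> R) : measurable S -> cmeas S h ->
  leb2m.-integrable S (EFin \o (fun p : plane => wgt alpha p * G p)) ->
  (forall p : plane, S p -> cabs (h (toC p)) <= G p) -> wable S h.
Proof.
move=> mS [h1 h2] iG hG.
have w0 p := wgt_ge0 halpha p.
split; apply: le_integrable iG => //.
- by apply/measurable_EFinP; apply: measurable_funM => //; exact: measurable_wgt.
- move=> p Sp; rewrite /= lee_fin !normrM ler_wpM2l// (le_trans (Re_le_cabs _))//.
  by rewrite (le_trans (hG p Sp))// ler_norm.
- by apply/measurable_EFinP; apply: measurable_funM => //; exact: measurable_wgt.
- move=> p Sp; rewrite /= lee_fin !normrM ler_wpM2l// (le_trans (Im_le_cabs _))//.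
  by rewrite (le_trans (hG p Sp))// ler_norm.
Qed.

Lemma wable_bounded (S : set plane) h (M : R) : measurable S -> S `<=` (@Dset R : set plane) ->
  cmeas S h -> (forall p : plane, S p -> cabs (h (toC p)) <= M) -> wable S h.
Proof.
move=> mS SD mh hM; apply: (@wable_dominated S h (fun=> M)) => //.
have iw : leb2m.-integrable S (EFin \o (wgt alpha : plane -> R)).
  by apply: integrableS (wgt_integrable halpha) => //; exact: measurable_Dset.
rewrite (_ : EFin \o _ = (fun p : plane => M%:E * (wgt alpha p)%:E)%E).
  exact: integrableZl.
by apply/funext => p /=; rewrite -EFinM mulrC.
Qed.

Lemma eq_wint (S : set plane) f g : (forall p : plane, S p -> f (toC p) = g (toC p)) ->
  wint S f = wint S g.
Proof.
by move=> fg; rewrite /wint; congr Complex; apply: eq_Rintegral => p /set_mem Sp; rewrite fg.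
Qed.

Lemma eq_wable (S : set plane) f g : measurable S -> (forall p : plane, S p -> f (toC p) = g (toC p)) ->
  wable S f -> wable S g.
Proof.
by move=> mS fg [h1 h2]; split; [move: h1|move: h2];
  apply: eq_integrable => // p /set_mem Sp /=; rewrite fg.
Qed.

Lemma wableD S f g : measurable S -> wable S f -> wable S g -> wable S (fun z => f z + g z).
Proof.
move=> mS [f1 f2] [g1 g2]; have h1 := integrableD mS f1 g1; have h2 := integrableD mS f2 g2.
split; [move: h1|move: h2]; apply: eq_integrable => // p _ /=;
  by rewrite ?ReD ?ImD mulrDr EFinD.
Qed.

Lemma wintD S f g : measurable S -> wable S f -> wable S g ->
  wint S (fun z => f z + g z) = wint S f + wint S g.
Proof.
move=> mS [f1 f2] [g1 g2]; apply: complexP.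
  rewrite ReD /= -RintegralD//; apply: eq_Rintegral => p _.
  by rewrite ReD mulrDr.
rewrite ImD /= -RintegralD//; apply: eq_Rintegral => p _.
by rewrite ImD mulrDr.
Qed.

Lemma wableZ S k f : measurable S -> wable S f -> wable S (fun z => k * f z).
Proof.
move=> mS [f1 f2].
have i1 (r : R) := @integrableZl _ _ _ leb2m _ mS r _ f1.
have i2 (r : R) := @integrableZl _ _ _ leb2m _ mS r _ f2.
have h1 := integrableB mS (i1 (Re k)) (i2 (Im k)).
have h2 := integrableD mS (i2 (Re k)) (i1 (Im k)).
split; [move: h1|move: h2]; apply: eq_integrable => // p _ /=.
  by rewrite ReM -!EFinM -EFinB; congr EFin; ring.
by rewrite ImM -!EFinM -EFinD; congr EFin; ring.
Qed.

Lemma wintZ S k f : measurable S -> wable S f -> wint S (fun z => k * f z) = k * wint S f.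
Proof.
move=> mS [f1 f2].
have i1 (r : R) : leb2m.-integrable S (EFin \o (fun p : plane => r * (wgt alpha p * Re (f (toC p))))).
  exact: (@integrableZl _ _ _ leb2m _ mS r _ f1).
have i2 (r : R) : leb2m.-integrable S (EFin \o (fun p : plane => r * (wgt alpha p * Im (f (toC p))))).
  exact: (@integrableZl _ _ _ leb2m _ mS r _ f2).
apply: complexP.
  rewrite ReM /= -!RintegralZl// -RintegralB//.
  by apply: eq_Rintegral => p _; rewrite ReM; ring.
rewrite ImM /= -!RintegralZl// -RintegralD//.
by apply: eq_Rintegral => p _; rewrite ImM; ring.
Qed.

Lemma wint_sum S (f : nat -> R[i] -> R[i]) N : measurable S -> (forall n, wable S (f n)) ->
  wable S (fun z => \sum_(n < N) f n z) /\
  wint S (fun z => \sum_(n < N) f n z) = \sum_(n < N) wint S (f n).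
Proof.
move=> mS wf; elim: N => [|N [IH1 IH2]].
  have -> : (fun z : R[i] => \sum_(n < 0) f n z) = (fun z => 0 * f 0%N z).
    by apply/funext => z; rewrite big_ord0 mul0r.
  split; first exact: (wableZ 0 mS (wf 0%N)).
  by rewrite (wintZ 0 mS (wf 0%N)) mul0r big_ord0.
have -> : (fun z : R[i] => \sum_(n < N.+1) f n z) = (fun z => \sum_(n < N) f n z + f N z).
  by apply/funext => z; rewrite big_ord_recr.
split; first exact: (wableD mS IH1 (wf N)).
by rewrite (wintD mS IH1 (wf N)) IH2 big_ord_recr.
Qed.

Lemma wint_bound (S : set plane) h (G : plane -> R) : measurable S -> cmeas S h ->
  leb2m.-integrable S (EFin \o (fun p : plane => wgt alpha p * G p)) ->
  (forall p : plane, S p -> cabs (h (toC p)) <= G p) ->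
  cabs (wint S h) <= 2 * Rintegral leb2m S (fun p => wgt alpha p * G p).
Proof.
move=> mS mh iG hG; have [h1 h2] := wable_dominated mS mh iG hG.
have w0 p := wgt_ge0 halpha p.
rewrite (le_trans (cabs_le_ReIm _))//= mulr_natl mulr2n lerD//.
  rewrite (le_trans (le_normr_Rintegral _ _))//; apply: le_Rintegral => //.
    exact: (integrable_norm h1).
  move=> p Sp; rewrite normrM ger0_norm// ler_wpM2l// (le_trans (Re_le_cabs _))//.
  exact: hG.
rewrite (le_trans (le_normr_Rintegral _ _))//; apply: le_Rintegral => //.
  exact: (integrable_norm h2).
move=> p Sp; rewrite normrM ger0_norm// ler_wpM2l// (le_trans (Im_le_cabs _))//.
exact: hG.
Qed.

End WeightedIntegral.

Section Reproducing.
Variable R : realType.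
Notation mu := (@lebesgue_measure R).
Local Notation plane := (measurableTypeR R * measurableTypeR R)%type.
Variable alpha : R.
Hypothesis halpha : -1 < alpha.
Local Notation wint := (wint alpha).
Local Notation wable := (wable alpha).
Local Notation leb2m := (leb2m R).

Let Dp : set plane := @Dset R.

Definition disc (s : R) : set plane := [set p | sqnorm p < s].

Lemma mdisc s : measurable (disc s).
Proof. exact: measurable_disc. Qed.

Lemma Dset_disc : Dp = disc 1.
Proof. by []. Qed.

Lemma disc_sub s : s <= 1 -> disc s `<=` Dp.
Proof. by move=> s1 p ps; rewrite Dset_disc /disc/=; exact: lt_le_trans ps s1. Qed.

Lemma Rintegral_rot (c s r : R) (f : plane -> R) : c ^+ 2 + s ^+ 2 = 1 -> s != 0 ->
  measurable_fun setT f ->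
  let T := fun p : plane => (c * p.1 - s * p.2, s * p.1 + c * p.2) : plane in
  leb2m.-integrable (disc r) (EFin \o (f \o T)) ->
  Rintegral leb2m (disc r) f = Rintegral leb2m (disc r) (f \o T).
Proof.
move=> cs s0 mf T iT.
have [mT presT] := leb2_preserving_rot cs s0.
have TE : T @^-1` (disc r) = disc r.
  apply/seteqP; split => -[x y]; rewrite /disc/T/sqnorm/=.
    have -> : (c * x - s * y) ^+ 2 + (s * x + c * y) ^+ 2 = (c ^+ 2 + s ^+ 2) * (x ^+ 2 + y ^+ 2).
      by ring.
    by rewrite cs mul1r.
  have -> : (c * x - s * y) ^+ 2 + (s * x + c * y) ^+ 2 = (c ^+ 2 + s ^+ 2) * (x ^+ 2 + y ^+ 2).
    by ring.
  by rewrite cs mul1r.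
pose q : {measure set plane -> \bar R} :=
  measure_function_pushforward__canonical__measure_function_Measure leb2m mT.
rewrite /Rintegral; congr fine.
transitivity (\int[q]_(p in disc r) (f p)%:E)%E.
  by apply: eq_measure_integral => A mA _; rewrite /q /= /pushforward; exact/esym/presT.
rewrite /q integral_pushforward//; last 3 first.
- by apply/measurable_EFinP.
- by rewrite TE.
- exact: mdisc.
by rewrite TE.
Qed.

Lemma conjcM (x y : R[i]) : conjc (x * y) = conjc x * conjc y.
Proof. exact: (rmorphM (@conjc R)). Qed.

Definition mon m n (z : R[i]) : R[i] := z ^+ m * (z^*%C) ^+ n.

Lemma cmeas_mon S m n : cmeas S (mon m n).
Proof.
apply: cmeasM; apply: cmeasX; first exact: cmeas_id.
by apply: cmeas_conj; exact: cmeas_id.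
Qed.

Lemma cabs_mon m n (z : R[i]) : cabs (mon m n z) = cabs z ^+ (m + n).
Proof. by rewrite cabsM !cabsX cabs_conj exprD. Qed.

Lemma wable_mon s m n : s <= 1 -> wable (disc s) (mon m n).
Proof.
move=> s1; apply: (@wable_bounded _ _ halpha _ _ 1); [exact: mdisc|exact: disc_sub|exact: cmeas_mon|].
move=> p ps; rewrite cabs_mon exprn_ile1 ?cabs_ge0//.
by rewrite ltW//; apply/Dset_cabs; exact: (disc_sub s1 ps).
Qed.

Lemma wint_rot s m n t : s <= 1 -> sin t != 0 ->
  wint (disc s) (mon m n) = expi t ^+ m * expi (- t) ^+ n * wint (disc s) (mon m n).
Proof.
move=> s1 st.
have cs : cos t ^+ 2 + sin t ^+ 2 = 1 by exact: cos2Dsin2.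
pose T := fun p : plane => (cos t * p.1 - sin t * p.2, sin t * p.1 + cos t * p.2) : plane.
have TE p : toC (T p) = expi t * toC p.
  by apply: complexP; rewrite ?ReM ?ImM /=; ring.
have wT p : wgt alpha (T p) = wgt alpha p.
  rewrite !wgtE; congr (_ * (1 - _) `^ _); rewrite /sqnorm /T /=.
  have -> : (cos t * p.1 - sin t * p.2) ^+ 2 + (sin t * p.1 + cos t * p.2) ^+ 2 =
    (cos t ^+ 2 + sin t ^+ 2) * (p.1 ^+ 2 + p.2 ^+ 2) by ring.
  by rewrite cs mul1r.
have conjE : (expi t)^*%C = expi (- t) :> R[i].
  by rewrite /expi cosN sinN.
have monT p : mon m n (toC (T p)) = expi t ^+ m * expi (- t) ^+ n * mon m n (toC p).
  by rewrite TE /mon conjcM conjE !exprMn; ring.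
rewrite -wintZ; [|exact: mdisc|exact: wable_mon].
have [i1 i2] := wableZ (expi t ^+ m * expi (- t) ^+ n) (mdisc s) (wable_mon m n s1).
have mw := @measurable_wgt R alpha setT.
rewrite /wint; congr Complex.
  rewrite (@Rintegral_rot (cos t) (sin t) s _ cs st) -/T.
  - by apply: eq_Rintegral => p _; rewrite /= wT monT.
  - by apply: measurable_funM => //; exact: (cmeas_mon setT m n).1.
  - by apply: eq_integrable i1 => //; [exact: mdisc|move=> p _; rewrite /= -/T wT monT].
rewrite (@Rintegral_rot (cos t) (sin t) s _ cs st) -/T.
- by apply: eq_Rintegral => p _; rewrite /= wT monT.
- by apply: measurable_funM => //; exact: (cmeas_mon setT m n).2.
- by apply: eq_integrable i2 => //; [exact: mdisc|move=> p _; rewrite /= -/T wT monT].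
Qed.

Lemma wint_mon_orth s m n : s <= 1 -> m != n -> wint (disc s) (mon m n) = 0.
Proof.
move=> s1 mn.
have key (d : R) t : (0 < t)%R -> t <= 1 -> expi t ^+ m * expi (- t) ^+ n = expi d ->
    sin d != 0 -> wint (disc s) (mon m n) = 0.
  move=> t0 t1 et sd.
  have st : sin t != 0.
    rewrite gt_eqF// sin_gt0_pi// t0 (le_lt_trans t1)//.
    by rewrite (lt_le_trans _ (pi_ge2 R))// ltr1n.
  have := wint_rot m n s1 st; rewrite et => h; apply/eqP.
  have : (1 - expi d) * wint (disc s) (mon m n) = 0 by rewrite mulrBl mul1r -h subrr.
  move=> /eqP; rewrite mulf_eq0 => /orP[|//].
  rewrite subr_eq0 => /eqP /(congr1 (@complex.Im R)) /= e0.
  by move: sd; rewrite -e0 eqxx.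
have s1gt : 0 < sin (1 : R).
  by rewrite sin_gt0_pi// ltr01 (lt_le_trans _ (pi_ge2 R))// ltr1n.
have eN t : expi (- t) ^+ n = expi (- (n%:R * t)) :> R[i].
  by rewrite expiX mulrN.
move: mn; rewrite neq_ltn => /orP[mn|mn].
  have k0 : 0 < (n - m)%:R :> R by rewrite ltr0n subn_gt0.
  apply: (key (-1) ((n - m)%:R^-1)).
  - by rewrite invr_gt0.
  - by rewrite invf_le1// ler1n subn_gt0.
  - rewrite eN expiX -expiD; congr expi; rewrite -mulrBl -opprB -natrB ?(ltnW mn)//.
    by rewrite mulNr mulfV// gt_eqF.
  - by rewrite sinN oppr_eq0 gt_eqF.
have k0 : 0 < (m - n)%:R :> R by rewrite ltr0n subn_gt0.
apply: (key 1 ((m - n)%:R^-1)).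
- by rewrite invr_gt0.
- by rewrite invf_le1// ler1n subn_gt0.
- rewrite eN expiX -expiD; congr expi; rewrite -mulrBl -natrB ?(ltnW mn)//.
  by rewrite mulfV// gt_eqF.
- by rewrite gt_eqF.
Qed.

Lemma wint_mon_diag n : wint Dp (mon n n) = ((mom alpha n)%:C)%C.
Proof.
have monE (p : plane) : mon n n (toC p) = ((sqnorm p ^+ n)%:C)%C.
  rewrite /mon -exprMn -cabs_toC rmorphXn; congr (_ ^+ _).
  by rewrite -sqr_normc normcE rmorphXn.
rewrite /wint; congr Complex.
  by apply: eq_Rintegral => p _; rewrite monE.
by rewrite /Rintegral integral0_eq// => p _; rewrite monE /= mulr0.
Qed.

Definition rad k : R := 1 - 2^-1 ^+ k.

Lemma rad_lt1 k : rad k < 1.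
Proof. by rewrite /rad gtrBl exprn_gt0// invr_gt0. Qed.

Lemma Rintegral_rad (f : plane -> R) (e : R) : leb2m.-integrable Dp (EFin \o f) -> 0 < e ->
  exists k0, forall k, (k0 <= k)%N ->
  `|Rintegral leb2m Dp f - Rintegral leb2m (disc (rad k)) f| <= e.
Proof.
move=> i_f e0.
have half0 : 0 <= 2^-1 :> R by rewrite invr_ge0.
have half1 : 2^-1 < 1 :> R by rewrite invf_lt1// ltr1n.
have mD : measurable Dp by exact: measurable_Dset.
have i_af := integrable_norm i_f.
have subD k : disc (rad k) `<=` Dp by apply: disc_sub; exact: ltW (rad_lt1 k).
have DU : \bigcup_k disc (rad k) = Dp.
  apply/seteqP; split => p; first by move=> [k _]; exact: subD.
  rewrite Dset_disc /disc/= => p1.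
  have p2 : 0 < (1 - sqnorm p) / 2 by rewrite divr_gt0// subr_gt0.
  have [N hN] := geometric_small 1 half0 half1 p2.
  exists N => //=; have := hN N (leqnn N); rewrite mul1r /rad; lra.
have nd : nondecreasing_seq (fun k => disc (rad k)).
  apply/nondecreasing_seqP => k; apply/subsetPset => p; rewrite /disc/= => ps.
  rewrite (lt_le_trans ps)// /rad lerB// exprS.
  have : 0 <= 2^-1 ^+ k :> R by rewrite exprn_ge0.
  by lra.
pose g : plane -> \bar R := EFin \o (fun p => `|f p|).
have cv := @ge0_nondecreasing_set_cvg_integral _ plane R (fun k => disc (rad k))
  g leb2m nd (fun k => mdisc _)
  (fun k => @measurable_funS _ _ _ _ _ _ _ mD (subD k) (measurable_int _ i_af))
  (fun k p _ => normr_ge0 _).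
rewrite DU in cv.
have fin : (\int[leb2m]_(x in Dp) g x)%E \is a fin_num.
  exact: (integrable_fin_num mD i_af).
rewrite -(fineK fin) in cv.
have fc : (fun i => fine (\int[leb2m]_(x in disc (rad i)) g x)%E) @ \oo -->
    fine (\int[leb2m]_(x in Dp) g x)%E by exact: fine_cvg cv.
move: fc => /cvgrPdist_le/(_ _ e0)[k0 _ hk].
exists k0 => k /hk /=.
have iS := integrableS mD (mdisc (rad k)) (subD k) i_f.
have split_int (u : plane -> R) : leb2m.-integrable Dp (EFin \o u) ->
    Rintegral leb2m Dp u - Rintegral leb2m (disc (rad k)) u =
    Rintegral leb2m (Dp `\` disc (rad k)) u.
  move=> ig; have -> : Rintegral leb2m Dp u =
      Rintegral leb2m (disc (rad k) `|` (Dp `\` disc (rad k))) u.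
    by rewrite setDUK//; exact: subD.
  rewrite Rintegral_setU//; first by rewrite addrC addKr.
  - exact: mdisc.
  - by apply: measurableD => //; exact: mdisc.
  - by rewrite setDUK//; exact: subD.
  - by apply/disj_set2P; rewrite setDE setICA setICr setI0.
rewrite -[X in `|X - _| <= _ -> _]/(Rintegral leb2m Dp (fun p => `|f p|)).
rewrite -[X in `|_ - X| <= _ -> _]/(Rintegral leb2m (disc (rad k)) (fun p => `|f p|)).
rewrite (split_int _ i_f) (split_int _ i_af); apply: le_trans.
have mdiff : measurable (Dp `\` disc (rad k)) by apply: measurableD => //; exact: mdisc.
rewrite (le_trans (le_normr_Rintegral _ _))//.
  by apply: integrableS i_f => //; exact: subDsetl.
exact: ler_norm.
Qed.

Lemma wint_rad (h1 h2 : R[i] -> R[i]) (e : R) : wable Dp h1 -> wable Dp h2 -> 0 < e ->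
  exists k, cabs (wint Dp h1 - wint (disc (rad k)) h1) <= e /\
            cabs (wint Dp h2 - wint (disc (rad k)) h2) <= e.
Proof.
move=> [a1 a2] [b1 b2] e0; have e2 : 0 < e / 2 by rewrite divr_gt0.
have [k1 hk1] := Rintegral_rad a1 e2; have [k2 hk2] := Rintegral_rad a2 e2.
have [k3 hk3] := Rintegral_rad b1 e2; have [k4 hk4] := Rintegral_rad b2 e2.
pose k := (k1 + k2 + (k3 + k4))%N.
have {}hk1 := hk1 k (leq_trans (leq_addr _ _) (leq_addr _ _)).
have {}hk2 := hk2 k (leq_trans (leq_addl _ _) (leq_addr _ _)).
have {}hk3 := hk3 k (leq_trans (leq_addr _ _) (leq_addl _ _)).
have {}hk4 := hk4 k (leq_trans (leq_addl _ _) (leq_addl _ _)).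
exists k; split; rewrite (le_trans (cabs_le_ReIm _))// ReD ReN ImD ImN /=.
  by rewrite [leRHS](splitr e) lerD.
by rewrite [leRHS](splitr e) lerD.
Qed.

End Reproducing.

Section BergmanKernel.
Variable R : realType.
Local Notation plane := (measurableTypeR R * measurableTypeR R)%type.
Variable alpha : R.
Hypothesis halpha : -1 < alpha.
Local Notation wint := (wint alpha).
Local Notation wable := (wable alpha).
Local Notation leb2m := (leb2m R).
Local Notation Dp := (@Dset R : set plane).

Lemma wintB S f g : measurable S -> wable S f -> wable S g ->
  wint S (fun z => f z - g z) = wint S f - wint S g.
Proof.
move=> mS wf wg; have wg' := wableZ (-1) mS wg.
rewrite -mulN1r -(wintZ (-1) mS wg) -(wintD mS wf wg').
by apply: eq_wint => p _; rewrite mulN1r.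
Qed.

Let mD : measurable Dp. Proof. exact: measurable_Dset. Qed.

Lemma disc_cabs (s : R) (p : plane) : 0 <= s -> disc s p -> cabs (toC p) <= (1 + s) / 2.
Proof.
move=> s0 ps; rewrite -(@ler_pXn2r _ 2) ?nnegrE ?cabs_ge0//; last by lra.
rewrite cabs_toC (le_trans (ltW ps))//.
have := sqr_ge0 (1 - s); rewrite !expr2; lra.
Qed.

Lemma wint_disc_coef (a : nat -> R[i]) g n (s : R) : taylor_on_D a g -> analytic_on_D g ->
  0 <= s -> s < 1 -> wint (disc s) (fun z => g z * (z^*%C) ^+ n) =
  a n * wint (disc s) (mon n n).
Proof.
move=> ta ag s0 s1.
have mS : measurable (disc s) by exact: mdisc.
have SD : disc s `<=` Dp by apply: disc_sub; exact: ltW.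
have iw : leb2m.-integrable (disc s) (EFin \o (wgt alpha : plane -> R)).
  by apply: integrableS (wgt_integrable halpha).
pose W := Rintegral leb2m (disc s) (wgt alpha).
have W0 : 0 <= W by apply: Rintegral_ge0 => p _; exact: wgt_ge0.
have r0 : 0 < (1 + s) / 2 by lra.
have r1 : (1 + s) / 2 < 1 by lra.
have mg : cmeas (disc s) g by apply: cmeasS SD _ => //; exact: cmeas_analytic.
have mconj : cmeas (disc s) (fun z => (z^*%C) ^+ n).
  by apply: cmeasX; apply: cmeas_conj; exact: cmeas_id.
apply/eqP; rewrite -subr_eq0; apply/eqP; apply: cabs_small_eq0 => e e0.
pose d := e / (2 * W + 1).
have W1 : 0 < 2 * W + 1 by lra.
have d0 : 0 < d by rewrite divr_gt0.
have [N0 hN] := taylor_limit ta r0 r1 d0.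
pose N := (N0 + n.+1)%N.
have {}hN := hN N (leq_addr _ _).
have nN : (n < N)%N by exact: leq_addl.
have s1' := ltW s1.
have wm m : wable (disc s) (fun z => a m * mon m n z).
  by apply: wableZ => //; exact: wable_mon.
have [w1 w2] := wint_sum N mS wm.
have eS : a n * wint (disc s) (mon n n) =
    wint (disc s) (fun z => \sum_(m < N) a m * mon m n z).
  rewrite w2 (bigD1 (Ordinal nN)) //= (wintZ _ mS (wable_mon halpha n n s1')).
  rewrite big1 ?addr0// => m mn.
  rewrite (wintZ _ mS (wable_mon halpha m n s1')) wint_mon_orth ?mulr0//.
rewrite eS.
have mh : cmeas (disc s) (fun z => (g z - \sum_(m < N) a m * z ^+ m) * (z^*%C) ^+ n).
  apply: cmeasM => //.
  have mz : cmeas (disc s) (fun z => \sum_(m < N) a m * z ^+ m).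
    apply: (@cmeas_sum _ _ (fun m z => a m * z ^+ m)) => m.
    by apply: cmeasM; [exact: cmeas_cst|apply: cmeasX; exact: cmeas_id].
  have := cmeasD mg (cmeasM (cmeas_cst (disc s) (-1)) mz).
  by congr cmeas; apply/funext => z; rewrite mulN1r.
have bh (p : plane) : disc s p ->
    cabs ((g (toC p) - \sum_(m < N) a m * (toC p) ^+ m) * ((toC p)^*%C) ^+ n) <= d.
  move=> ps; rewrite cabsM cabsX cabs_conj.
  have z1 := disc_cabs s0 ps.
  rewrite (le_trans (ler_wpM2r _ (hN _ z1)))// ?exprn_ge0 ?cabs_ge0//.
  by rewrite ler_piMr ?(ltW d0)// exprn_ile1 ?cabs_ge0// (le_trans z1)// ltW.
have wh := wable_bounded halpha mS SD mh bh.
have sumE z : \sum_(m < N) a m * mon m n z = (\sum_(m < N) a m * z ^+ m) * (z^*%C) ^+ n.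
  by rewrite mulr_suml; apply: eq_bigr => m _; rewrite /mon mulrA.
have wg : wable (disc s) (fun z => g z * (z^*%C) ^+ n).
  apply: eq_wable mS _ (wableD mS wh w1) => p _.
  by rewrite sumE; ring.
rewrite -(wintB mS wg w1).
rewrite (@eq_wint _ _ _ _ (fun z => (g z - \sum_(m < N) a m * z ^+ m) * (z^*%C) ^+ n)); last first.
  by move=> p _; rewrite sumE; ring.
have iG : leb2m.-integrable (disc s) (EFin \o (fun p : plane => wgt alpha p * d)).
  have := @integrableZl _ _ _ leb2m _ mS d _ iw.
  by apply: eq_integrable => // p _; rewrite /= mulrC.
rewrite (le_trans (wint_bound halpha mS mh iG bh))//.
rewrite RintegralZr// -/W /d.
have -> : 2 * (W * (e / (2 * W + 1))) = e * (2 * W / (2 * W + 1)).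
  by field; rewrite gt_eqF.
by rewrite ler_piMr ?(ltW e0)// ler_pdivrMr// mul1r lerDl.
Qed.

Lemma wint_taylor_coef (a : nat -> R[i]) g n : taylor_on_D a g -> analytic_on_D g ->
  wable Dp (fun z => g z * (z^*%C) ^+ n) ->
  wint Dp (fun z => g z * (z^*%C) ^+ n) = a n * ((mom alpha n)%:C)%C.
Proof.
move=> ta ag wg.
have wm : wable Dp (mon n n) by rewrite (@Dset_disc R); exact: wable_mon.
rewrite -(wint_mon_diag alpha n).
apply/eqP; rewrite -subr_eq0; apply/eqP; apply: cabs_small_eq0 => e e0.
have a1 : 0 < 1 + cabs (a n) by rewrite ltr_pwDl// cabs_ge0.
pose d := e / (1 + cabs (a n)).
have d0 : 0 < d by rewrite divr_gt0.
have [k [h1 h2]] := wint_rad wg wm d0.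
have rk0 : 0 <= rad R k.
  by rewrite /rad subr_ge0 exprn_ile1 ?invr_ge0// invf_le1// ler1n.
have eq := wint_disc_coef n ta ag rk0 (rad_lt1 R k).
have -> : wint Dp (fun z => g z * (z^*%C) ^+ n) - a n * wint Dp (mon n n) =
  (wint Dp (fun z => g z * (z^*%C) ^+ n) - wint (disc (rad R k)) (fun z => g z * (z^*%C) ^+ n)) -
  a n * (wint Dp (mon n n) - wint (disc (rad R k)) (mon n n)).
  by rewrite eq; ring.
rewrite (le_trans (cabsB _ _))// cabsM.
apply: (@le_trans _ _ (d + cabs (a n) * d)).
  by rewrite lerD// ler_wpM2l// cabs_ge0.
by rewrite le_eqVlt; apply/orP; left; apply/eqP; rewrite /d; field; rewrite gt_eqF.
Qed.

Definition kcoef (n : nat) : R := (mom alpha n)^-1.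

Lemma kcoef_gt0 n : 0 < kcoef n.
Proof. by rewrite invr_gt0 mom_gt0. Qed.

Lemma kcoef_ge0 n : 0 <= kcoef n.
Proof. exact: ltW (kcoef_gt0 n). Qed.

Lemma kcoef_nondecreasing n : kcoef n <= kcoef n.+1.
Proof. by rewrite lef_pV2 ?posrE ?mom_gt0// mom_noninc. Qed.

Lemma subexp_kcoef : subexp kcoef.
Proof.
move=> t t0 t1; have [c c0 h] := mom_ge halpha t0 t1.
exists c^-1 => n; rewrite ger0_norm ?kcoef_ge0//.
by rewrite ler_pdivrMl ?mom_gt0// -ler_pdivrMr ?invr_gt0// invrK mulrC.
Qed.

Lemma kcoef_doubling : exists2 k : R, 0 < k & forall n, kcoef n.*2.+1 <= k * kcoef n.
Proof.
have [k k0 h] := mom_doubling halpha; exists k => // n.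
by rewrite ler_pdivlMr ?mom_gt0// mulrC ler_pdivrMr ?mom_gt0.
Qed.

Definition kern (w z : R[i]) : R[i] := ps kcoef (w^*%C * z).

Lemma cabs_conjM_lt1 (w z : R[i]) : cabs w < 1 -> cabs z < 1 -> cabs (w^*%C * z) < 1.
Proof.
move=> w1 z1; rewrite cabsM cabs_conj (le_lt_trans _ z1)//.
by rewrite ler_piMl ?cabs_ge0// ltW.
Qed.

Lemma kern_analytic w : cabs w < 1 -> analytic_on_D (kern w).
Proof.
move=> w1; apply/analytic_cdiff => z z1.
have h := ps_cdiff subexp_kcoef (cabs_conjM_lt1 w1 z1).
exists (w^*%C * ps (fun n => n.+1%:R * kcoef n.+1) (w^*%C * z)) => e e0.
have [d d0 hd] := h _ e0; exists d => // u ud.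
have ub : cabs (w^*%C * u) <= cabs u.
  by rewrite cabsM cabs_conj ler_piMl ?cabs_ge0// ltW.
have := hd (w^*%C * u) (le_lt_trans ub ud); rewrite -mulrDr.
rewrite -/(kern w (z + u)) -/(kern w z) => hu.
set l := ps _ _ in hu *.
have -> : w^*%C * l * u = l * (w^*%C * u) by ring.
by rewrite (le_trans hu)// ler_wpM2l// ltW.
Qed.

Lemma kern_bounded w : cabs w < 1 -> exists2 M : R, 0 <= M &
  forall z, cabs z < 1 -> cabs (kern w z) <= M.
Proof.
move=> w1; have [K [q [K0 q0 q1 h]]] := ps_tail subexp_kcoef (cabs_ge0 w) w1.
exists K => // z z1.
have zw : cabs (w^*%C * z) <= cabs w.
  by rewrite cabsM cabs_conj ler_piMr ?cabs_ge0// ltW.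
by have := h 0%N _ zw; rewrite /pps big_ord0 subr0 expr0 mulr1.
Qed.

Lemma normA2E f : normA2 alpha f =
  (\int[leb2m]_(p in Dp) (wgt alpha p * cabs (f (toC p)) ^+ 2)%:E)%E.
Proof.
by apply: eq_integral => p _; rewrite normcE -rmorphXn.
Qed.

Lemma measurable_wgt_sqcabs f : cmeas Dp f ->
  measurable_fun Dp (fun p : plane => (wgt alpha p * cabs (f (toC p)) ^+ 2)%:E).
Proof.
move=> mf; apply/measurable_EFinP; apply: measurable_funM; first exact: measurable_wgt.
by apply: measurable_funX; exact: measurable_cabs.
Qed.

Lemma wgt_sqcabs_ge0 f (p : plane) : 0 <= wgt alpha p * cabs (f (toC p)) ^+ 2.
Proof. by rewrite mulr_ge0 ?wgt_ge0// exprn_ge0// cabs_ge0. Qed.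

Lemma inA2_integrable f : inA2 alpha f ->
  leb2m.-integrable Dp (EFin \o (fun p : plane => wgt alpha p * (1 + cabs (f (toC p)) ^+ 2))).
Proof.
move=> [af nf]; rewrite normA2E in nf.
have mf := cmeas_analytic af.
have i2 : leb2m.-integrable Dp (EFin \o (fun p : plane => wgt alpha p * cabs (f (toC p)) ^+ 2)).
  apply/integrableP; split; first exact: measurable_wgt_sqcabs.
  rewrite (@eq_integral _ _ _ leb2m Dp (fun p : plane => (wgt alpha p * cabs (f (toC p)) ^+ 2)%:E))//.
  by move=> p _; rewrite /= ger0_norm// wgt_sqcabs_ge0.
have := integrableD mD (wgt_integrable halpha) i2.
by apply: eq_integrable => // p _ /=; rewrite mulrDr mulr1 EFinD.
Qed.

Lemma inA2_mul_bounded f h (M : R) : inA2 alpha f -> cmeas Dp h -> 0 <= M ->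
  (forall p : plane, Dp p -> cabs (h (toC p)) <= M) ->
  leb2m.-integrable Dp (EFin \o (fun p : plane => wgt alpha p * (M * (1 + cabs (f (toC p)) ^+ 2)))) /\
  forall p : plane, Dp p -> cabs (f (toC p) * h (toC p)) <= M * (1 + cabs (f (toC p)) ^+ 2).
Proof.
move=> hf mh M0 hM; split.
  have := @integrableZl _ _ _ leb2m _ mD M _ (inA2_integrable hf).
  by apply: eq_integrable => // p _; rewrite /= -EFinM; congr EFin; ring.
move=> p Dpp; rewrite cabsM mulrC ler_pM ?cabs_ge0 ?hM//.
have := sqr_ge0 (1 - cabs (f (toC p))); have := cabs_ge0 (f (toC p)); rewrite !expr2; lra.
Qed.

Lemma inA2_wable f h (M : R) : inA2 alpha f -> cmeas Dp h -> 0 <= M ->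
  (forall p : plane, Dp p -> cabs (h (toC p)) <= M) -> wable Dp (fun z => f z * h z).
Proof.
move=> hf mh M0 hM; have [i b] := inA2_mul_bounded hf mh M0 hM.
by apply: wable_dominated i b => //; apply: cmeasM => //; apply: cmeas_analytic; case: hf.
Qed.

Lemma conjcD (x y : R[i]) : conjc (x + y) = conjc x + conjc y.
Proof. exact: (rmorphD (@conjc R)). Qed.

Lemma conjcX (x : R[i]) n : conjc (x ^+ n) = conjc x ^+ n.
Proof. exact: (rmorphXn (@conjc R)). Qed.

Lemma cabs_conjB (x y : R[i]) : cabs (conjc x - conjc y) = cabs (x - y).
Proof. by rewrite -[RHS]cabs_conj; congr cabs; apply/esym/(rmorphB (@conjc R)). Qed.

Lemma conj_pps N (w z : R[i]) :
  (pps kcoef N (w^*%C * z))^*%C = \sum_(n < N) (kcoef n)%:C%C * w ^+ n * (z^*%C) ^+ n.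
Proof.
elim: N => [|N IH]; first by rewrite /pps !big_ord0 conjc0.
rewrite /pps !big_ord_recr /= -/(pps kcoef N _).
rewrite conjcD IH; congr (_ + _).
by rewrite conjcM conjcX conjcM conjcK conjc_real exprMn mulrA.
Qed.

Lemma kern_reproducing g w : inA2 alpha g -> cabs w < 1 ->
  wint Dp (fun z => g z * (kern w z)^*%C) = g w.
Proof.
move=> hg w1; have [ag _] := hg.
have [a [ta _]] := taylor_exists ag.
have mg := cmeas_analytic ag.
have mk := cmeas_analytic (kern_analytic w1).
have [M M0 kM] := kern_bounded w1.
have wk : wable Dp (fun z => g z * (kern w z)^*%C).
  apply: (inA2_wable (M := M)) => //; first exact: cmeas_conj.
  by move=> p /Dset_cabs p1; rewrite cabs_conj kM.
have mX n : cmeas Dp (fun z => (z^*%C) ^+ n).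
  by apply: cmeasX; apply: cmeas_conj; exact: cmeas_id.
have wX n : wable Dp (fun z => g z * (z^*%C) ^+ n).
  apply: (inA2_wable (M := 1)) => // p /Dset_cabs p1.
  by rewrite cabsX cabs_conj exprn_ile1 ?cabs_ge0// ltW.
have [K [q [K0 q0 q1 hK]]] := ps_tail subexp_kcoef (cabs_ge0 w) w1.
pose G := Rintegral leb2m Dp (fun p : plane => wgt alpha p * (1 + cabs (g (toC p)) ^+ 2)).
have G0 : 0 <= G.
  apply: Rintegral_ge0 => p _; rewrite mulr_ge0 ?wgt_ge0//.
  by rewrite addr_ge0// exprn_ge0// cabs_ge0.
apply/eqP; rewrite -subr_eq0; apply/eqP; apply: cabs_small_eq0 => e e0.
have e2 : 0 < e / 2 by rewrite divr_gt0.
have w0 := cabs_ge0 w.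
have r0 : 0 < (1 + cabs w) / 2 by lra.
have r1 : (1 + cabs w) / 2 < 1 by lra.
have [N1 h1] := taylor_limit ta r0 r1 e2.
have [N2 h2] := geometric_small (2 * (K * G)) q0 q1 e2.
pose N := (N1 + N2)%N.
have wr : cabs w <= (1 + cabs w) / 2 by lra.
have {}h1 := h1 N (leq_addr _ _) w wr.
have {}h2 := h2 N (leq_addl _ _).
have wS n : wable Dp (fun z => ((kcoef n)%:C%C * w ^+ n) * (g z * (z^*%C) ^+ n)).
  by apply: wableZ.
have [wsum wsumE] := wint_sum N mD wS.
have sumE z : \sum_(n < N) ((kcoef n)%:C%C * w ^+ n) * (g z * (z^*%C) ^+ n) =
    g z * (pps kcoef N (w^*%C * z))^*%C.
  by rewrite conj_pps mulr_sumr; apply: eq_bigr => n _; ring.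
have BE : wint Dp (fun z => \sum_(n < N) ((kcoef n)%:C%C * w ^+ n) * (g z * (z^*%C) ^+ n)) =
    \sum_(n < N) a n * w ^+ n.
  rewrite wsumE; apply: eq_bigr => n _.
  rewrite (wintZ _ mD (wX n)) (wint_taylor_coef ta ag (wX n)).
  have -> : (kcoef n)%:C%C * w ^+ n * (a n * (mom alpha n)%:C%C) =
    a n * w ^+ n * ((kcoef n)%:C%C * (mom alpha n)%:C%C) by ring.
  rewrite -rmorphM /kcoef mulVf ?gt_eqF ?mom_gt0//.
  by rewrite -[X in _ * X]/(1 : R[i]) mulr1.
have mpps : cmeas Dp (fun z => (pps kcoef N (w^*%C * z))^*%C).
  apply: cmeas_conj; apply: (@cmeas_sum _ _ (fun n z => (kcoef n)%:C%C * (w^*%C * z) ^+ n)) => n.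
  apply: cmeasM; first exact: cmeas_cst.
  by apply: cmeasX; apply: cmeasM; [exact: cmeas_cst|exact: cmeas_id].
pose hd z := (kern w z)^*%C - (pps kcoef N (w^*%C * z))^*%C.
have mhd : cmeas Dp hd.
  have := cmeasD (cmeas_conj mk) (cmeasM (cmeas_cst Dp (-1)) mpps).
  by congr cmeas; apply/funext => z; rewrite mulN1r.
have KqN : 0 <= K * q ^+ N by rewrite mulr_ge0// exprn_ge0.
have bhd (p : plane) : Dp p -> cabs (hd (toC p)) <= K * q ^+ N.
  move=> /Dset_cabs p1; rewrite /hd cabs_conjB.
  by apply: hK; rewrite cabsM cabs_conj ler_piMr ?cabs_ge0// ltW.
have [iB bB] := inA2_mul_bounded hg mhd KqN bhd.
have hAB : cabs (wint Dp (fun z => g z * (kern w z)^*%C) - \sum_(n < N) a n * w ^+ n) <= e / 2.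
  rewrite -BE -(wintB mD wk wsum).
  rewrite (@eq_wint _ _ _ _ (fun z => g z * hd z)); last first.
    by move=> p _; rewrite sumE /hd mulrBr.
  rewrite (le_trans (wint_bound halpha mD (cmeasM mg mhd) iB bB))//.
  rewrite (_ : Rintegral leb2m Dp _ = K * q ^+ N * G).
    by rewrite (le_trans _ h2)// le_eqVlt; apply/orP; left; apply/eqP; ring.
  rewrite /G -RintegralZl//; last exact: inA2_integrable.
  by apply: eq_Rintegral => p _; ring.
set A := wint Dp _ in hAB *; set S := \sum_(n < N) _ in h1 hAB.
have -> : A - g w = (A - S) - (g w - S) by ring.
by rewrite (le_trans (cabsB _ _))// [leRHS](splitr e) lerD.
Qed.

End BergmanKernel.

(** * Numerical range *)

Section BoundaryPoint.
Variable R : realType.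
Local Notation C := (R[i]^o).

Lemma analyticM (f g : R[i] -> R[i]) : analytic_on_D f -> analytic_on_D g ->
  analytic_on_D (fun z => f z * g z).
Proof. by move=> af ag z z1; apply: (@derivableM R[i] C); [exact: af|exact: ag]. Qed.

Lemma analyticB (f g : R[i] -> R[i]) : analytic_on_D f -> analytic_on_D g ->
  analytic_on_D (fun z => f z - g z).
Proof. by move=> af ag z z1; apply: (@derivableB R[i] C C); [exact: af|exact: ag]. Qed.

Lemma analytic_cst (k : R[i]) : analytic_on_D (fun=> k).
Proof. by move=> z z1; exact: derivable_cst. Qed.

Lemma analytic_id : analytic_on_D (fun z : R[i] => z).
Proof. by move=> z z1; exact: derivable_id. Qed.

Lemma conj_mul_self (w : R[i]) : conjc w * w = ((cabs w ^+ 2)%:C)%C.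
Proof. by rewrite mulrC -sqr_normc normcE rmorphXn. Qed.

Lemma analytic_zero_boundary (F : R[i] -> R[i]) (M : R) : analytic_on_D F ->
  (forall z, cabs z < 1 -> cabs (F z) <= M * (1 - cabs z)) ->
  forall z, cabs z < 1 -> F z = 0.
Proof.
move=> aF FM; have [a [ta ha]] := taylor_exists aF.
apply: (taylor_zero ta) => n; apply: cabs_small_eq0 => e e0.
have M0 : 0 <= M.
  have := FM 0; rewrite cabs0 ltr01 subr0 mulr1 => /(_ isT).
  by apply: le_trans; exact: cabs_ge0.
have h2 : 0 < 2^-1 ^+ n :> R by rewrite exprn_gt0// invr_gt0.
pose B := 2 * M / 2^-1 ^+ n + 1.
have B0 : 0 < B by rewrite ltr_wpDl// divr_ge0 ?mulr_ge0// ltW.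
pose d := Num.min 2^-1 (e / B).
have d0 : 0 < d by rewrite lt_min invr_gt0 ltr0n divr_gt0.
have d2 : d <= 2^-1 by rewrite ge_min lexx.
have de : d <= e / B by rewrite ge_min lexx orbT.
have r0 : 0 < 1 - d by lra.
have r1 : 1 - d < 1 by lra.
have hM : forall z, cabs z = 1 - d -> cabs (F z) <= M * d.
  move=> z z1; have := FM z; rewrite z1 r1 => /(_ isT).
  by have -> : 1 - (1 - d) = d by ring.
have han := ha (1 - d) (M * d) n r0 r1 hM.
have hn : cabs (a n) * 2^-1 ^+ n <= 2 * (M * d).
  apply: le_trans han; rewrite ler_wpM2l ?cabs_ge0// lerXn2r ?nnegrE ?invr_ge0//; last by lra.
  exact: ltW.
move: hn; rewrite -ler_pdivlMr// => /le_trans; apply.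
apply: (@le_trans _ _ (B * d)); last by rewrite mulrC -ler_pdivlMr.
have -> : 2 * (M * d) / 2^-1 ^+ n = 2 * M / 2^-1 ^+ n * d by ring.
by rewrite ler_wpM2r ?(ltW d0)// /B lerDl.
Qed.

(* Otherwise z (z - phi1 z) (z - phi2 z) is O(1 - |z|). *)
Lemma exists_far_from_fixed (phi1 phi2 : R[i] -> R[i]) (e : R) :
  selfmap_D phi1 -> selfmap_D phi2 -> ~ is_id_D phi1 -> ~ is_id_D phi2 -> 0 < e ->
  exists2 w : R[i], cabs w < 1 &
    1 - cabs w <= e * cabs (1 - w^*%C * phi1 w) /\
    1 - cabs w <= e * cabs (1 - w^*%C * phi2 w).
Proof.
move=> [ap1 sp1] [ap2 sp2] n1 n2 e0; apply: contrapT => hno.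
have s1 w : cabs w < 1 -> cabs (phi1 w) < 1 by move=> /inDE/sp1/inDE.
have s2 w : cabs w < 1 -> cabs (phi2 w) < 1 by move=> /inDE/sp2/inDE.
pose h1 z := z - phi1 z; pose h2 z := z - phi2 z.
have aid := @analytic_id.
have ah1 : analytic_on_D h1 := @analyticB (fun z => z) phi1 aid ap1.
have ah2 : analytic_on_D h2 := @analyticB (fun z => z) phi2 aid ap2.
have nz (h phi : R[i] -> R[i]) : (forall z, h z = z - phi z) -> ~ is_id_D phi ->
    ~ (forall z, cabs z < 1 -> h z = 0).
  move=> hE nid h0; apply: nid => z /inDE z1; apply/eqP; rewrite eq_sym -subr_eq0 -hE.
  by rewrite h0.
have [d1 d10 hd1] := analytic_nonzero_near0 ah1 (nz h1 phi1 (fun=> erefl) n1).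
have [d2 d20 hd2] := analytic_nonzero_near0 ah2 (nz h2 phi2 (fun=> erefl) n2).
pose F z := z * (h1 z * h2 z).
have aF : analytic_on_D F := @analyticM (fun z => z) _ aid (@analyticM h1 h2 ah1 ah2).
have one (w p : R[i]) : cabs w < 1 -> cabs p < 1 -> ~ (1 - cabs w <= e * cabs (1 - w^*%C * p)) ->
    cabs w * cabs (w - p) <= (e^-1 + 2) * (1 - cabs w).
  move=> w1 p1 /negP; rewrite -ltNge => hw.
  have w0 := cabs_ge0 w.
  have -> : cabs w * cabs (w - p) = cabs ((1 - w^*%C * p) - (1 - w^*%C * w)).
    have -> : (1 - w^*%C * p) - (1 - w^*%C * w) = w^*%C * (w - p) by ring.
    by rewrite cabsM cabs_conj.
  have ww : 1 - w^*%C * w = ((1 - cabs w ^+ 2)%:C)%C.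
    by rewrite conj_mul_self rmorphB rmorph1.
  rewrite (le_trans (cabsB _ _))// ww cabs_real ger0_norm; last first.
    by rewrite subr_ge0 exprn_ile1// ltW.
  have k1 : cabs (1 - w^*%C * p) <= e^-1 * (1 - cabs w).
    by rewrite ler_pdivlMl// ltW.
  rewrite mulrDl lerD// expr2.
  have : 0 <= (1 - cabs w) ^+ 2 by exact: sqr_ge0.
  by rewrite expr2; lra.
have FM z : cabs z < 1 -> cabs (F z) <= 2 * (e^-1 + 2) * (1 - cabs z).
  move=> z1.
  have b1 : cabs (h1 z) <= 2.
    by rewrite (le_trans (cabsB _ _))//; have := s1 z z1; lra.
  have b2 : cabs (h2 z) <= 2.
    by rewrite (le_trans (cabsB _ _))//; have := s2 z z1; lra.
  have [g1|g1] := pselect (1 - cabs z <= e * cabs (1 - z^*%C * phi1 z)).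
    have g2 : ~ (1 - cabs z <= e * cabs (1 - z^*%C * phi2 z)).
      by move=> g2; apply: hno; exists z.
    have := one z (phi2 z) z1 (s2 z z1) g2; rewrite -/(h2 z) => k2.
    rewrite /F mulrCA !cabsM -mulrA.
    by rewrite ler_pM ?cabs_ge0// mulr_ge0 ?cabs_ge0.
  have := one z (phi1 z) z1 (s1 z z1) g1; rewrite -/(h1 z) => k1.
  rewrite /F mulrA mulrC cabsM -mulrA (cabsM z).
  by rewrite ler_pM ?cabs_ge0// mulr_ge0 ?cabs_ge0.
have F0 := analytic_zero_boundary aF FM.
pose t : R := Num.min 2^-1 (Num.min (d1 / 2) (d2 / 2)).
have t0 : 0 < t by rewrite !lt_min invr_gt0 ltr0n !divr_gt0.
have t2 : t <= 2^-1 by rewrite ge_min lexx.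
have td1 : t <= d1 / 2 by rewrite !ge_min lexx !orbT.
have td2 : t <= d2 / 2 by rewrite !ge_min lexx !orbT.
have tn0 : (t%:C)%C != 0 :> R[i] by rewrite eq_complex/= negb_and gt_eqF.
have ct : cabs (t%:C)%C = t by rewrite cabs_real gtr0_norm.
have := F0 (t%:C)%C; rewrite ct => /(_ ltac:(lra)) /eqP.
rewrite /F !mulf_eq0 (negbTE tn0) /= => /orP[].
  by rewrite (negbTE (hd1 _ tn0 _)) // ct; lra.
by rewrite (negbTE (hd2 _ tn0 _)) // ct; lra.
Qed.

End BoundaryPoint.

Section NumericalRange.
Variable R : realType.
Local Notation plane := (measurableTypeR R * measurableTypeR R)%type.
Local Notation Dp := (@Dset R : set plane).
Variable alpha : R.
Hypothesis halpha : -1 < alpha.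

Lemma ipA2_wint f g : ipA2 alpha f g = wint alpha Dp (fun z => f z * (g z)^*%C).
Proof. by []. Qed.

Lemma normA2_scale (k : R) f : analytic_on_D f ->
  normA2 alpha (fun z => (k%:C)%C * f z) = ((k ^+ 2)%:E * normA2 alpha f)%E.
Proof.
move=> af; rewrite !normA2E -ge0_integralZl_EFin ?sqr_ge0//.
- apply: eq_integral => p _; rewrite -EFinM; congr EFin.
  by rewrite cabsM cabs_real exprMn real_normK ?num_real//; ring.
- exact: measurable_Dset.
- by move=> p _; rewrite lee_fin wgt_sqcabs_ge0.
- by apply: measurable_wgt_sqcabs; exact: cmeas_analytic.
Qed.

Lemma kern_inA2 w : cabs w < 1 -> inA2 alpha (kern alpha w).
Proof.
move=> w1; have ak := kern_analytic halpha w1; split=> //.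
have [M M0 kM] := kern_bounded halpha w1.
have i := wgt_integrable halpha.
have mw := @integrableZl _ _ _ (leb2m R) Dp (@measurable_Dset R) (M ^+ 2) _ i.
move/integrableP : (mw) => [mM /le_lt_trans]; rewrite normA2E; apply.
apply: ge0_le_integral => //.
- exact: measurable_Dset.
- by move=> p _; rewrite lee_fin wgt_sqcabs_ge0.
- by apply: measurable_wgt_sqcabs; exact: cmeas_analytic.
- by apply: measurableT_comp.
- move=> p /Dset_cabs p1; rewrite -EFinM abse_EFin lee_fin ger0_norm; last first.
    by rewrite mulr_ge0 ?sqr_ge0 ?wgt_ge0.
  rewrite mulrC ler_wpM2r ?wgt_ge0// lerXn2r ?nnegrE ?cabs_ge0//.
  exact: kM.
Qed.

Definition knorm2 (w : R[i]) : R := psr (kcoef alpha) (cabs w ^+ 2).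

Lemma knorm2_gt0 w : cabs w < 1 -> 0 < knorm2 w.
Proof.
move=> w1; apply: lt_le_trans (kcoef_gt0 halpha 0%N) _.
apply: psr_ge; [exact: kcoef_ge0|exact: subexp_kcoef|by rewrite sqr_ge0|].
by rewrite exprn_ilt1 ?cabs_ge0.
Qed.

Lemma normA2_kern w : cabs w < 1 -> normA2 alpha (kern alpha w) = (knorm2 w)%:E.
Proof.
move=> w1; have hk := kern_inA2 w1.
have := kern_reproducing halpha hk w1.
have -> : kern alpha w w = ((knorm2 w)%:C)%C.
  rewrite /kern conj_mul_self /knorm2; apply: psE; [exact: subexp_kcoef|exact: sqr_ge0|].
  by rewrite exprn_ilt1 ?cabs_ge0.
move=> /(congr1 (@complex.Re R)) /= <-.
have fin : normA2 alpha (kern alpha w) \is a fin_num.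
  rewrite ge0_fin_numE; first by case: hk.
  by rewrite normA2E; apply: integral_ge0 => p _; rewrite lee_fin wgt_sqcabs_ge0.
rewrite -(fineK fin) normA2E; congr EFin.
apply: eq_Rintegral => p _; congr (_ * _).
by rewrite sqr_cabs /= mulrN opprK !expr2.
Qed.

Lemma numrange_kern (phi1 phi2 psi1 psi2 : R[i] -> R[i]) w : cabs w < 1 ->
  bounded_on_A2 alpha (wcomp psi1 phi1) -> bounded_on_A2 alpha (wcomp psi2 phi2) ->
  numrange alpha (opadd (wcomp psi1 phi1) (wcomp psi2 phi2))
    (((knorm2 w)^-1%:C)%C *
      (psi1 w * kern alpha w (phi1 w) + psi2 w * kern alpha w (phi2 w))).
Proof.
move=> w1 [hb1 _] [hb2 _].
have kp := knorm2_gt0 w1; have hk := kern_inA2 w1.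
pose l := (Num.sqrt (knorm2 w))^-1.
have l2 : l ^+ 2 = (knorm2 w)^-1 by rewrite exprVn sqr_sqrtr// ltW.
exists (fun z => (l%:C)%C * kern alpha w z).
have ak := hk.1.
have nE : normA2 alpha (fun z => (l%:C)%C * kern alpha w z) = 1%E.
  by rewrite normA2_scale// normA2_kern// l2 -EFinM mulVf// gt_eqF.
split; last split => //.
  split; last by rewrite nE ltry.
  exact: (@analyticM R (fun=> (l%:C)%C) _ (@analytic_cst R _) ak).
have hf1 := hb1 _ hk; have hf2 := hb2 _ hk.
have [M M0 kM] := kern_bounded halpha w1.
have mk : cmeas Dp (fun z => (kern alpha w z)^*%C).
  by apply: cmeas_conj; exact: cmeas_analytic.
have bk (p : plane) : Dp p -> cabs ((kern alpha w (toC p))^*%C) <= M.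
  by move=> /Dset_cabs p1; rewrite cabs_conj kM.
have i1 := inA2_wable halpha hf1 mk M0 bk.
have i2 := inA2_wable halpha hf2 mk M0 bk.
have mD := @measurable_Dset R.
have -> : psi1 w * kern alpha w (phi1 w) = wint alpha Dp
    (fun z => wcomp psi1 phi1 (kern alpha w) z * (kern alpha w z)^*%C).
  by rewrite kern_reproducing.
have -> : psi2 w * kern alpha w (phi2 w) = wint alpha Dp
    (fun z => wcomp psi2 phi2 (kern alpha w) z * (kern alpha w z)^*%C).
  by rewrite kern_reproducing.
rewrite -(wintD mD i1 i2) -(wintZ _ mD (wableD mD i1 i2)) ipA2_wint.
apply: eq_wint => p _; rewrite /opadd /wcomp conjcM conjc_real -l2 rmorphXn.
move: (kern alpha w (phi1 (toC p))) (kern alpha w (phi2 (toC p))) (kern alpha w (toC p)).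
by move=> *; ring.
Qed.

End NumericalRange.

Theorem theorem4p1 (R : realType) (alpha : R) (halpha : -1 < alpha)
  (phi1 phi2 psi1 psi2 : R[i] -> R[i])
  (hphi1 : selfmap_D phi1) (hphi2 : selfmap_D phi2)
  (hpsi1 : analytic_on_D psi1) (hpsi2 : analytic_on_D psi2)
  (hb1 : bounded_on_A2 alpha (wcomp psi1 phi1))
  (hb2 : bounded_on_A2 alpha (wcomp psi2 phi2)) :
  ((is_id_D phi1 /\ is_id_D phi2 /\
      (exists z0 : R[i], inD z0 /\ psi1 z0 = 0 /\ psi2 z0 = 0)) ->
     numrange alpha (opadd (wcomp psi1 phi1) (wcomp psi2 phi2)) 0)
  /\
  ((~ is_id_D phi1 /\ ~ is_id_D phi2 /\ Hinf psi1 /\ Hinf psi2) ->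
     closure (numrange alpha (opadd (wcomp psi1 phi1) (wcomp psi2 phi2)) : set R[i]^o) 0).
Proof.
split.
  move=> [_ [_ [z0 [/inDE z1 [p1 p2]]]]].
  have := numrange_kern halpha z1 hb1 hb2.
  rewrite p1 p2 !mul0r addr0 mulr0; exact.
move=> [n1 [n2 [[_ [M1 hM1]] [_ [M2 hM2]]]]] B /nbhs_cabsP[d d0 hB].
have [k k0 hk] := kcoef_doubling halpha.
pose L := 2 * k * (`|M1| + `|M2|) + 1.
have L0 : 0 < L by rewrite ltr_wpDl// mulr_ge0 ?mulr_ge0 ?addr_ge0// ltW.
pose e := d / 2 / L.
have e0 : 0 < e by rewrite !divr_gt0.
have [w w1 [far1 far2]] := exists_far_from_fixed hphi1 hphi2 n1 n2 e0.
exists (((knorm2 alpha w)^-1%:C)%C *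
  (psi1 w * kern alpha w (phi1 w) + psi2 w * kern alpha w (phi2 w))).
split; first exact: numrange_kern.
apply: hB; rewrite subr0.
have kp := knorm2_gt0 halpha w1.
have wB (psi : R[i] -> R[i]) (M : R) : (forall z, inD z -> `|psi z| <= (M%:C)%C) ->
    cabs (psi w) <= `|M|.
  by move=> /(_ w ((inDE w).2 w1)); rewrite normcE lecR => /le_trans; apply; exact: ler_norm.
have term (phi : R[i] -> R[i]) : selfmap_D phi ->
    1 - cabs w <= e * cabs (1 - w^*%C * phi w) ->
    cabs (kern alpha w (phi w)) <= e * (2 * k * knorm2 alpha w).
  move=> [_ sphi] far.
  have pw : cabs (phi w) < 1 by apply/inDE; apply: sphi; apply/inDE.
  have xw : cabs (w^*%C * phi w) <= cabs w.
    by rewrite cabsM cabs_conj ler_piMr ?cabs_ge0// ltW.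
  have := kernel_ratio (kcoef_ge0 halpha) (kcoef_nondecreasing halpha)
    (subexp_kcoef halpha) hk (ltW k0) w1 xw.
  rewrite -/(kern alpha w (phi w)) -/(knorm2 alpha w) => hr.
  have x0 : 0 < cabs (1 - w^*%C * phi w).
    by rewrite (lt_le_trans _ (cabs_dist _ _))// cabs1 subr_gt0 (le_lt_trans xw).
  rewrite -(ler_pM2l x0) (le_trans hr)// (mulrA _ e) (mulrC _ e).
  by rewrite ler_wpM2r// mulr_ge0 ?mulr_ge0// ltW.
have t1 := term _ hphi1 far1; have t2 := term _ hphi2 far2.
rewrite cabsM cabs_real ger0_norm ?invr_ge0 ?(ltW kp)// ltr_pdivrMl//.
apply: (@le_lt_trans _ _ ((`|M1| + `|M2|) * (e * (2 * k * knorm2 alpha w)))).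
  rewrite mulrDl; apply: le_trans (cabsD _ _) _; rewrite !cabsM.
  exact: lerD (ler_pM (cabs_ge0 _) (cabs_ge0 _) (wB _ _ hM1) t1)
    (ler_pM (cabs_ge0 _) (cabs_ge0 _) (wB _ _ hM2) t2).
have -> : (`|M1| + `|M2|) * (e * (2 * k * knorm2 alpha w)) =
  knorm2 alpha w * (d / 2 * ((L - 1) / L)).
  by rewrite /e /L; field; rewrite gt_eqF.
rewrite ltr_pM2l// (@le_lt_trans _ _ (d / 2))//.
  by rewrite ler_piMr ?divr_ge0 ?(ltW d0)// ler_pdivrMr// mul1r gerBl.
by rewrite ltr_pdivrMr// ltr_pMr// ltr1n.
Qed.
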